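(* Let $\lambda\in\mathbb{R}\setminus\{0\}$, $1\le p,q\le\infty$ and $f\in L^2(\mathbb{R}^{2n})$. Then $f\in M_\lambda^{p,q}(\mathbb{R}^{2n})$ if and only if the function $$F(\xi,\eta)=\sqrt{w_\lambda(\xi+i\eta)}\;B_\lambda f(\xi+i\eta),\qquad \xi,\eta\in\mathbb{R}^{2n},$$ belongs to $L^{p,q}(\mathbb{R}^{2n}\times\mathbb{R}^{2n})$.
   Context: Symplectic form: $[(x,u),(y,v)]=u\cdot y-v\cdot x$, extended complex-bilinearly to $\mathbb{C}^{2n}$. For $\lambda\neq0$, acting on functions on $\mathbb{R}^{2n}$: $\tau_\lambda(\eta)g(\xi)=g(\xi-\eta)e^{-i\frac{\lambda}{2}[\xi,\eta]}$; $e_\lambda(a,b)g(x,u)=g\big(x-\tanh(\tfrac\lambda2)b,\,u+\tanh(\tfrac\lambda2)a\big)e^{-i\frac\lambda2\coth(\frac\lambda2)(x\cdot a+u\cdot b)}$; and $\Pi_\lambda(\xi,\eta)=e^{i\frac\lambda2(\coth\lambda)\xi\cdot\eta}e_\lambda(\eta)\tau_\lambda(\xi)$ for $\xi,\eta\in\mathbb{R}^{2n}$. $L^{p,q}(\mathbb{R}^{2n}\times\mathbb{R}^{2n})$ has norm $\|F\|_{p,q}=\big(\int(\int|F(\xi,\eta)|^pd\xi)^{q/p}d\eta\big)^{1/q}$ (usual modification for $\infty$). The twisted modulation space $M_\lambda^{p,q}(\mathbb{R}^{2n})$ is the space of tempered distributions $f$ such that $\langle f,\Pi_\lambda(\xi,\eta)g\rangle\in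 L^{p,q}(\mathbb{R}^{2n}\times\mathbb{R}^{2n})$ for some nonzero $g\in\mathcal S(\mathbb{R}^{2n})$ (the space does not depend on the choice of $g$); here $\langle f,g\rangle$ is linear in $f$ and conjugate-linear in $g$. Let $p_t^\lambda(x,u)=(4\pi)^{-n}\lambda^n(\sinh t\lambda)^{-n}e^{-\frac14\lambda(\coth t\lambda)(|x|^2+|u|^2)}$, extended holomorphically to $p_t^\lambda(z,w)$ on $\mathbb{C}^{2n}$ (replace $|x|^2+|u|^2$ by $\sum z_j^2+\sum w_j^2$), and $c_\lambda=(4\pi)^{-n}(\lambda/\sinh\lambda)^n$. The twisted Bargmann transform of $f\in L^2(\mathbb{R}^{2n})$ is the entire function $B_\lambda f(\zeta)=c_\lambda\,p_1^\lambda(\zeta)^{-1}\,f\ast_\lambda p_{1/2}^\lambda(\zeta)$, $\zeta\in\mathbb{C}^{2n}$, where $f\ast_\lambda p_{1/2}^\lambda(\zeta)=\int_{\mathbb{R}^{2n}}f(\eta)\,p_{1/2}^\lambda(\zeta-\eta)\,e^{-i\frac\lambda2[\zeta,\eta]}d\eta$. The weight is $w_\lambda(\zeta)=c_\lambda\,e^{-\frac12\lambda(\coth\lambda)|\zeta|^2}e^{\lambda[\Re\zeta,\Im\zeta]}$. *)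

(* Defs.v *)
From HB Require Import structures.
From mathcomp Require Import all_boot all_order all_algebra.
From mathcomp Require Import all_classical all_reals all_analysis.
From mathcomp Require Import complex.

Set Implicit Arguments.
Unset Strict Implicit.
Unset Printing Implicit Defensive.
Import Order.TTheory GRing.Theory Num.Theory.
Import numFieldNormedType.Exports.

Local Open Scope classical_set_scope.
Local Open Scope ring_scope.
Local Open Scope complex_scope.

(* The sigma-algebra on row vectors generated by the coordinates (for
   'rV[R]_N, the Borel sets of R^N), as the library does for tuples. *)
Definition measure_rV_display : measure_display -> measure_display.
Proof. exact. Qed.

Section measurable_rV.
Context {d} {T : measurableType d}.
Variable N : nat.

Definition rV_coord (i : 'I_N) (v : 'rV[T]_N) : T := v ord0 i.

Let rV_set0 : g_sigma_preimage rV_coord set0.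
Proof. exact: sigma_algebra0. Qed.

Let rV_setC A : g_sigma_preimage rV_coord A -> g_sigma_preimage rV_coord (~` A).
Proof. exact: sigma_algebraC. Qed.

Let rV_bigcup (F : (set 'rV[T]_N)^nat) :
  (forall i, g_sigma_preimage rV_coord (F i)) ->
  g_sigma_preimage rV_coord (\bigcup_i (F i)).
Proof. exact: sigma_algebra_bigcup. Qed.

HB.instance Definition _ := @isMeasurable.Build (measure_rV_display d)
  'rV[T]_N (g_sigma_preimage rV_coord) rV_set0 rV_setC rV_bigcup.

End measurable_rV.

Lemma measurable_rV_coord d (T : measurableType d) N (i : 'I_N) :
  measurable_fun [set: 'rV[T]_N] (rV_coord i).
Proof.
move=> _ Y mY; rewrite setTI; apply: sub_sigma_algebra => /=.
rewrite -bigcup_seq/=; exists i => /=; first by rewrite mem_index_enum.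
by exists Y => //; rewrite setTI.
Qed.

Lemma measurable_fun_rVP d1 d2 (T1 : measurableType d1) (T2 : measurableType d2)
    N (f : T1 -> 'rV[T2]_N) :
  measurable_fun [set: T1] f <->
  forall i, measurable_fun [set: T1] (rV_coord i \o f).
Proof.
split=> [mf i|mf]; first exact: measurableT_comp (measurable_rV_coord i) mf.
move=> _ Y mY; move: Y mY; apply: smallest_sub.
  exact: sigma_algebra_image (sigma_algebra_measurable _).
rewrite -bigcup_seq => Y [i _] [B mB <-].
rewrite /image_set_system /= !setTI.
by have := mf i measurableT B mB; rewrite setTI.
Qed.

Section lebesgue_rV.
Context {R : realType}.
Local Open Scope ereal_scope.

Definition rV_cons N (p : 'rV[R]_N * measurableTypeR R) : 'rV[R]_N.+1 :=
  row_mx (p.2)%:M p.1.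

Fixpoint lebesgue_rV N : set 'rV[R]_N -> \bar R :=
  match N with
  | 0 => \d_(0%R : 'rV[R]_0)
  | N'.+1 => pushforward (@lebesgue_rV N' \x @lebesgue_measure R) (@rV_cons N')
  end.

Lemma measurable_rV_cons N : measurable_fun setT (@rV_cons N).
Proof.
apply/measurable_fun_rVP => i; rewrite /rV_coord/=.
rewrite (_ : _ \o _ = match fintype.split (i : 'I_(1 + N)) with
  | inl _ => fun p : 'rV[R]_N * measurableTypeR R => p.2 : R
  | inr j => fun p => rV_coord j p.1 end); last first.
  apply/funext => p /=; rewrite mxE; case: fintype.split => // k.
  by rewrite !ord1 mxE eqxx.
case: fintype.split => j; first exact: measurable_snd.
apply: measurableT_comp => //; exact: measurable_rV_coord.
Qed.

Let lebesgue_rV_ex N :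
  exists m : {measure set 'rV[R]_N -> \bar R}, m = @lebesgue_rV N :> (_ -> _).
Proof.
elim: N => [|N [m mE]] /=; first by eexists.
rewrite -mE.
pose g :=
  measure_function_pushforward__canonical__measure_function_Measure
   (m \x @lebesgue_measure R) (@measurable_rV_cons N).
by exists g.
Qed.

Let lebesgue_rV0 N : @lebesgue_rV N set0 = 0.
Proof. by have [m <-] := lebesgue_rV_ex N; rewrite measure0. Qed.

Let lebesgue_rV_ge0 N A : 0 <= @lebesgue_rV N A.
Proof. by have [m <-] := lebesgue_rV_ex N. Qed.

Let lebesgue_rV_sigma_additive N : semi_sigma_additive (@lebesgue_rV N).
Proof.
by have [m <-] := lebesgue_rV_ex N; exact: measure_semi_sigma_additive.
Qed.

HB.instance Definition _ N := isMeasure.Build _ _ _ (@lebesgue_rV N)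
  (lebesgue_rV0 N) (@lebesgue_rV_ge0 N) (@lebesgue_rV_sigma_additive N).

End lebesgue_rV.
Arguments lebesgue_rV : clear implicits.

Lemma lebesgue_rV_box (R : realType) N (A : 'I_N -> set R) :
  (forall i, measurable (A i)) ->
  lebesgue_rV R N [set v | forall i, A i (v ord0 i)] =
  (\prod_i lebesgue_measure (A i))%E.
Proof.
elim: N A => [|N IH] A mA /=.
  rewrite big_ord0 diracE mem_set//= => -[]//.
have Er p (i : 'I_N) : (@rV_cons R N p) ord0 (lift ord0 i) = p.1 ord0 i.
  by rewrite -rshift1; exact: (@row_mxEr _ 1 1 N).
have El p : (@rV_cons R N p) ord0 ord0 = p.2.
  have -> : (ord0 : 'I_N.+1) = lshift N (ord0 : 'I_1) by exact/val_inj.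
  by transitivity (((p.2)%:M : 'M[R]_1) ord0 ord0); [exact: (@row_mxEl _ 1 1 N)|rewrite mxE eqxx mulr1n].
rewrite big_ord_recl -IH//.
rewrite muleC -product_measure1E//.
- rewrite /pushforward; congr (_ _); apply/seteqP; split => -[v t] /=.
  + move=> h; split => /=; last by have := h ord0; rewrite El.
    by move=> i; have := h (lift ord0 i); rewrite Er.
  + by move=> [h1 h2] i; case: (unliftP ord0 i) => [j|] ->; rewrite ?Er ?El.
- suff -> : (fun x : 'rV[R]_N => forall i, A (lift ord0 i) (x ord0 i)) =
      \bigcap_(i in setT) (rV_coord i @^-1` (A (lift ord0 i))).
    apply: fin_bigcap_measurable => [|i _]; first exact: finite_finset.
    by rewrite -[X in measurable X]setTI; exact: measurable_rV_coord.
  by apply/seteqP; split => v h i; [move=> _|]; exact: h.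
- exact: (mA ord0).
Qed.

Notation normc := ComplexField.Normc.normc.

Section complex_functions.
Context {R : realType}.

Definition cexp (z : R[i]) : R[i] :=
  (expR (complex.Re z))%:C * (cos (complex.Im z) +i* sin (complex.Im z)).

Definition sinh (x : R) : R := (expR x - expR (- x)) / 2.
Definition cosh (x : R) : R := (expR x + expR (- x)) / 2.
Definition tanh (x : R) : R := sinh x / cosh x.
Definition coth (x : R) : R := cosh x / sinh x.

Definition cmeasurable d (T : measurableType d) (f : T -> R[i]) :=
  measurable_fun [set: T] (fun x => complex.Re (f x)) /\
  measurable_fun [set: T] (fun x => complex.Im (f x)).

Definition cintegral N (f : 'rV[R]_N -> R[i]) : R[i] :=
  (\int[lebesgue_rV R N]_x complex.Re (f x)) +i*
  (\int[lebesgue_rV R N]_x complex.Im (f x)).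

Local Open Scope ereal_scope.

Definition Lp N (p : \bar R) : set ('rV[R]_N -> R[i]) :=
  [set f | cmeasurable f /\
           'N[lebesgue_rV R N]_p[(fun x => (normc (f x))%:E)] < +oo].

(* L^{p,q}: the inner norm, of exponent p, is taken in the first variable.
   For p or q infinite 'N is the essential supremum. *)
Definition Lpq N M (p q : \bar R) : set ('rV[R]_N * 'rV[R]_M -> R[i]) :=
  [set F | cmeasurable F /\
           'N[lebesgue_rV R M]_q[(fun eta =>
             'N[lebesgue_rV R N]_p[(fun xi => (normc (F (xi, eta)))%:E)])] < +oo].

End complex_functions.

Section schwartz.
Context {R : realType} {N : nat}.
Implicit Types (g h : 'rV[R]_N -> R[i]) (a : {ffun 'I_N -> nat})
  (s : seq 'I_N).

(* Iterated partial derivatives of a real function, along the list of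
   coordinate directions s. *)
Definition partials s (u : 'rV[R]_N -> R) : 'rV[R]_N -> R :=
  foldr (fun i v x => 'D_('e_i) v x) u s.

Definition smooth (u : 'rV[R]_N -> R) := forall s,
  continuous (partials s u) /\
  forall i x, derivable (partials s u) x 'e_i.

(* x^a times the iterated derivative of g along s *)
Definition weighted_partials a s g (x : 'rV[R]_N) : R[i] :=
  (\prod_i x ord0 i ^+ a i)%:C *
  (partials s (fun y => complex.Re (g y)) x +i*
   partials s (fun y => complex.Im (g y)) x).

Definition schwartz : set ('rV[R]_N -> R[i]) :=
  [set g | [/\ smooth (fun x => complex.Re (g x)),
               smooth (fun x => complex.Im (g x)) &
               forall a s, exists B : R,
                 forall x, normc (weighted_partials a s g x) <= B]].

Definition schwartz_seminorm a s g : R :=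
  sup [set normc (weighted_partials a s g x) | x in [set: 'rV[R]_N]].

(* A distribution T is represented by the conjugate-linear functional
   g |-> <T, g>; its values outside the Schwartz space are irrelevant.
   Continuity is with respect to the topology of the Schwartz space generated
   by the family of seminorms: basic neighbourhoods of g0 are given by finitely
   many seminorms (the list L) and a radius delta. *)
Definition tempered (T : ('rV[R]_N -> R[i]) -> R[i]) :=
  (forall (c : R[i]) g h, schwartz g -> schwartz h ->
     T (fun x => c * g x + h x) = conjc c * T g + T h) /\
  (forall g0, schwartz g0 -> forall eps : R, 0 < eps ->
     exists L : seq ({ffun 'I_N -> nat} * seq 'I_N),
     exists2 delta : R, 0 < delta &
       forall g, schwartz g ->
         (forall k, k \in L ->
            schwartz_seminorm k.1 k.2 (fun x => g x - g0 x) < delta) ->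
         normc (T g - T g0) < eps).

Definition distribution_of (f : 'rV[R]_N -> R[i]) :
    ('rV[R]_N -> R[i]) -> R[i] :=
  fun g => cintegral (fun x => f x * conjc (g x)).

End schwartz.

(* A point (x, u) of K^{2n} is the row vector row_mx x u; hence x = lsubmx and
   u = rsubmx. *)
Section symplectic.
Context {K : comPzRingType}.

Definition dot m (x y : 'rV[K]_m) : K := \sum_i x ord0 i * y ord0 i.

Definition symp n (z w : 'rV[K]_(n + n)) : K :=
  dot (rsubmx z) (lsubmx w) - dot (rsubmx w) (lsubmx z).

End symplectic.

Section twisted.
Context {R : realType} {n : nat}.
Local Notation E := 'rV[R]_(n + n).
Local Notation CE := 'rV[R[i]]_(n + n).
Implicit Types (lam t : R) (xi eta : E) (z zeta : CE) (f g : E -> R[i]).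

Definition tau lam eta g : E -> R[i] :=
  fun xi => g (xi - eta) * cexp (0 +i* - (lam / 2 * symp xi eta)).

Definition e_ lam eta g : E -> R[i] :=
  let a := lsubmx eta in let b := rsubmx eta in
  fun xi => let x := lsubmx xi in let u := rsubmx xi in
    g (row_mx (x - tanh (lam / 2) *: b) (u + tanh (lam / 2) *: a)) *
    cexp (0 +i* - (lam / 2 * coth (lam / 2) * (dot x a + dot u b))).

Definition Pi lam xi eta g : E -> R[i] :=
  fun x => cexp (0 +i* (lam / 2 * coth lam * dot xi eta)) *
           e_ lam eta (tau lam xi g) x.

Definition twisted_modulation lam (p q : \bar R) :
    set ((E -> R[i]) -> R[i]) :=
  [set T | tempered T /\
     exists g, [/\ schwartz g, g <> cst 0 &
       Lpq p q (fun w : E * E => T (Pi lam w.1 w.2 g))]].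

Definition real_pt xi : CE := \row_j (xi ord0 j)%:C.

Definition complex_pt xi eta : CE := \row_j (xi ord0 j +i* eta ord0 j).

Definition re_pt zeta : E := \row_j complex.Re (zeta ord0 j).
Definition im_pt zeta : E := \row_j complex.Im (zeta ord0 j).

(* the holomorphic extension of the twisted heat kernel; dot zeta zeta is the
   bilinear sum of squares, not the squared norm *)
Definition heat lam t zeta : R[i] :=
  ((4 * pi) ^- n * lam ^+ n * sinh (t * lam) ^- n)%:C *
  cexp (- (4^-1 * lam * coth (t * lam))%:C * dot zeta zeta).

Definition c_ lam : R := (4 * pi) ^- n * (lam / sinh lam) ^+ n.

Definition twisted_conv_heat lam t f zeta : R[i] :=
  cintegral (fun eta : E => f eta * heat lam t (zeta - real_pt eta) *
    cexp (- (0 +i* (lam / 2)) * symp zeta (real_pt eta))).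

Definition bargmann lam f zeta : R[i] :=
  (c_ lam)%:C * (heat lam 1 zeta)^-1 * twisted_conv_heat lam 2^-1 f zeta.

Definition weight lam zeta : R :=
  c_ lam *
  expR (- (2^-1 * lam * coth lam * \sum_j normc (zeta ord0 j) ^+ 2)) *
  expR (lam * symp (re_pt zeta) (im_pt zeta)).

End twisted.

(* Main.v *)
(* With b = lam coth(lam/2) / 4, completing squares in the exponents shows that
   sqrt(w) B f is exactly a nonzero constant times <f, Pi(xi, eta) g0> for the
   Gaussian window g0 = exp(-b |X|^2), so that one implication only needs g0 to
   be a Schwartz function. For the other one, an arbitrary window g has to be
   exchanged for g0. Up to a unimodular factor Pi(xi, eta) g is the
   time-frequency shift exp(-i s w.X) g(X - y), s = lam / sinh lam, where (y, w)
   depends on (xi, eta) through a composition of two linear shears, hence in a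
   linear and measure preserving way. Some Gaussian average of the
   time-frequency shifts of g is a nonzero multiple of g0, because a narrow
   Gaussian centred at a point where g does not vanish pairs nontrivially with
   g. By Fubini, |<f, Pi g0>| is then dominated by the convolution of
   |<f, Pi g>| with an integrable Gaussian, and Young's inequality in
   L^{p,q} concludes. *)
Require Import Defs.
From HB Require Import structures.
From mathcomp Require Import all_boot all_order all_algebra.
From mathcomp Require Import all_classical all_reals all_analysis.
From mathcomp Require Import measurable_realfun ess_sup_inf.
From mathcomp Require Import complex ring lra.

Set Implicit Arguments.
Unset Strict Implicit.
Unset Printing Implicit Defensive.
Import Order.TTheory GRing.Theory Num.Theory.
Import numFieldNormedType.Exports.

Local Open Scope classical_set_scope.
Local Open Scope ring_scope.
Local Open Scope complex_scope.

(** * Integrals of complex-valued functions *)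

(** The second of the two shears, which moves the frequency by a multiple of [rot y], does not in
    general preserve a mixed norm with p different from q, so the norms cannot be transported to the
    parameters (y, w). The way round is that the shear is additive: translating these parameters by
    [shear lam w] amounts to translating (xi, eta) by w. The pointwise convolution bound is
    therefore pulled back to (xi, eta), where Young's inequality is applied, and the invariance of
    measure only serves to change the variable of averaging and to compute the mass of the kernel.
    The exponents may be infinite, and the inner norm must still be measurable in eta when it is an
    essential supremum. Almost-everywhere bounds are for this reason rewritten as vanishing
    integrals, to which Tonelli's theorem applies. Both signs of lam are treated together: the
    quantities that have to be positive, lam coth(lam/2) and lam / sinh lam, are even in lam. *)

Section complex_basics.
Context {R : realType}.
Implicit Types (z w : R[i]).

Lemma normc_ge0 z : 0 <= normc z.
Proof. by case: z => a b; exact: sqrtr_ge0. Qed.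

Lemma le_normr_Re z : `|complex.Re z| <= normc z.
Proof. by case: z => a b /=; rewrite -sqrtr_sqr ler_wsqrtr// lerDl sqr_ge0. Qed.

Lemma le_normr_Im z : `|complex.Im z| <= normc z.
Proof. by case: z => a b /=; rewrite -sqrtr_sqr ler_wsqrtr// lerDr sqr_ge0. Qed.

Lemma normc_le_ReIm z : normc z <= `|complex.Re z| + `|complex.Im z|.
Proof.
case: z => a b /=; rewrite -(@ger0_norm _ (`|a| + `|b|)) ?addr_ge0//.
rewrite -sqrtr_sqr ler_wsqrtr// sqrrD !real_normK ?num_real//.
by rewrite lerD2r lerDl mulrn_wge0// mulr_ge0.
Qed.

Lemma normc_conj z : normc (conjc z) = normc z.
Proof. by case: z => a b /=; rewrite sqrrN. Qed.

Lemma normc_real (x : R) : normc x%:C = `|x|.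
Proof. by rewrite /= expr0n/= addr0 sqrtr_sqr. Qed.

Lemma normc_eq0 z : (normc z == 0) = (z == 0).
Proof.
by apply/eqP/eqP => [/Normc.eq0_normc//|->]; rewrite Normc.normc0.
Qed.

Lemma cexpD z w : cexp (z + w) = cexp z * cexp w.
Proof.
case: z w => [a b] [c d]; rewrite /cexp /= expRD cosD sinD; simpc.
by apply/eqP; rewrite eq_complex/=; apply/andP; split; apply/eqP; ring.
Qed.

Lemma normc_cexp z : normc (cexp z) = expR (complex.Re z).
Proof.
rewrite /cexp Normc.normcM normc_real ger0_norm ?expR_ge0//=.
by rewrite cos2Dsin2 sqrtr1 mulr1.
Qed.

Lemma cexp0 : cexp 0 = 1 :> R[i].
Proof. by rewrite /cexp/= expR0 cos0 sin0 mul1r. Qed.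

Lemma cexpN z : cexp (- z) = (cexp z)^-1.
Proof.
have h : cexp z * cexp (- z) = 1 by rewrite -cexpD subrr cexp0.
have z0 : cexp z != 0.
  by apply/eqP => z0; move: h; rewrite z0 mul0r => /esym/eqP; rewrite oner_eq0.
by apply: (mulfI z0); rewrite h mulfV.
Qed.

Lemma cexp_conj z : conjc (cexp z) = cexp (conjc z).
Proof.
case: z => a b; rewrite /cexp/= cosN sinN; simpc.
by apply/eqP; rewrite eq_complex/= eqxx/=; apply/eqP; ring.
Qed.

Lemma cexp_real (x : R) : cexp x%:C = (expR x)%:C.
Proof. by rewrite /cexp/= cos0 sin0 mulr1. Qed.

Lemma normc_phase (x : R) : normc (cexp (0 +i* x)) = 1.
Proof. by rewrite normc_cexp/= expR0. Qed.

End complex_basics.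

Section cmeasurable.
Context d (T : measurableType d) {R : realType}.
Implicit Types (f g : T -> R[i]).

Lemma cmeasurable_cst (c : R[i]) : cmeasurable (fun _ : T => c).
Proof. by split; exact: measurable_cst. Qed.

Lemma cmeasurableM f g : cmeasurable f -> cmeasurable g ->
  cmeasurable (fun x => f x * g x).
Proof.
move=> [fr fi] [gr gi]; split.
  rewrite (_ : (fun _ => _) = (fun x => complex.Re (f x) * complex.Re (g x) -
     complex.Im (f x) * complex.Im (g x))); last first.
    by apply/funext => x; case: (f x) (g x) => [a b] [c e].
  by apply: measurable_funB; exact: measurable_funM.
rewrite (_ : (fun _ => _) = (fun x => complex.Re (f x) * complex.Im (g x) +
   complex.Im (f x) * complex.Re (g x))); last first.
  by apply/funext => x; case: (f x) (g x) => [a b] [c e].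
by apply: measurable_funD; exact: measurable_funM.
Qed.

Lemma cmeasurable_conj f : cmeasurable f -> cmeasurable (fun x => conjc (f x)).
Proof.
move=> [fr fi]; split.
  rewrite (_ : (fun _ => _) = (fun x => complex.Re (f x)))//.
  by apply/funext => x; case: (f x).
rewrite (_ : (fun _ => _) = (fun x => - complex.Im (f x))).
  exact: measurable_funN.
by apply/funext => x; case: (f x).
Qed.

Lemma cmeasurable_mk (u v : T -> R) : measurable_fun setT u ->
  measurable_fun setT v -> cmeasurable (fun x => u x +i* v x).
Proof. by []. Qed.

Lemma cmeasurable_real (u : T -> R) : measurable_fun setT u ->
  cmeasurable (fun x => (u x)%:C).
Proof. by move=> mu; split => //; exact: measurable_cst. Qed.

Lemma measurable_normc f : cmeasurable f ->
  measurable_fun setT (fun x => normc (f x)).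
Proof.
move=> [fr fi].
rewrite (_ : (fun _ => _) = (fun x => Num.sqrt (complex.Re (f x) ^+ 2 +
   complex.Im (f x) ^+ 2))); last by apply/funext => x; case: (f x).
apply: (measurableT_comp (@continuous_measurable_fun _ (@Num.sqrt R) _)).
  exact: sqrt_continuous.
by apply: measurable_funD; exact: measurable_funX.
Qed.

Lemma cmeasurable_cexp f : cmeasurable f -> cmeasurable (fun x => cexp (f x)).
Proof.
move=> [fr fi]; rewrite /cexp; apply: cmeasurableM.
  by apply: cmeasurable_real; apply: measurableT_comp => //; exact: measurable_expR.
apply: cmeasurable_mk; apply: measurableT_comp fi;
  apply: continuous_measurable_fun; [exact: continuous_cos|exact: continuous_sin].
Qed.

End cmeasurable.

Lemma cmeasurable_comp d d' (T : measurableType d) (T' : measurableType d')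
    (R : realType) (f : T -> R[i]) (h : T' -> T) :
  cmeasurable f -> measurable_fun setT h -> cmeasurable (fun x => f (h x)).
Proof. by move=> [fr fi] mh; split; [exact: measurableT_comp fr mh|exact: measurableT_comp fi mh]. Qed.

Section cint.
Context d (T : measurableType d) {R : realType}.
Variable mu : {measure set T -> \bar R}.
Implicit Types (f g : T -> R[i]).

Definition cint f : R[i] :=
  (\int[mu]_x complex.Re (f x)) +i* (\int[mu]_x complex.Im (f x)).

Definition cintegrable f := cmeasurable f /\
  (\int[mu]_x (normc (f x))%:E < +oo)%E.

Lemma cintegrable_Re f : cintegrable f ->
  mu.-integrable setT (fun x => (complex.Re (f x))%:E).
Proof.
move=> [[fr fi] foo]; apply/integrableP; split; first exact/measurable_EFinP.
apply: le_lt_trans foo; apply: ge0_le_integral => //.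
- by apply/measurable_EFinP; exact: measurableT_comp fr.
- by apply/measurable_EFinP; exact: measurable_normc.
- by move=> x _; rewrite lee_fin le_normr_Re.
Qed.

Lemma cintegrable_Im f : cintegrable f ->
  mu.-integrable setT (fun x => (complex.Im (f x))%:E).
Proof.
move=> [[fr fi] foo]; apply/integrableP; split; first exact/measurable_EFinP.
apply: le_lt_trans foo; apply: ge0_le_integral => //.
- by apply/measurable_EFinP; exact: measurableT_comp fi.
- by apply/measurable_EFinP; exact: measurable_normc.
- by move=> x _; rewrite lee_fin le_normr_Im.
Qed.

Lemma cintegrable_real (u : T -> R) : mu.-integrable setT (EFin \o u) ->
  cintegrable (fun x => (u x)%:C).
Proof.
move=> /integrableP[/measurable_EFinP mu_ uoo]; split; first exact: cmeasurable_real.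
by under eq_integral do rewrite normc_real.
Qed.

Lemma cint_real (u : T -> R) : cint (fun x => (u x)%:C) = (\int[mu]_x u x)%:C.
Proof. by rewrite /cint/= /Rintegral integral0. Qed.

Lemma cintegrable_le f (u : T -> R) : cmeasurable f ->
  mu.-integrable setT (EFin \o u) -> (forall x, normc (f x) <= u x) ->
  cintegrable f.
Proof.
move=> mf /integrableP[mu_ uoo] fu; split => //; apply: le_lt_trans uoo.
apply: ge0_le_integral => //.
- by move=> x _; rewrite lee_fin normc_ge0.
- by apply/measurable_EFinP; exact: measurable_normc.
- exact: measurableT_comp.
- by move=> x _; rewrite lee_fin (le_trans (fu x))// ler_norm.
Qed.

Lemma cintegrable_normc f : cintegrable f ->
  mu.-integrable setT (EFin \o (fun x => normc (f x))).
Proof.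
move=> [mf foo]; apply/integrableP; split.
  by apply/measurable_EFinP; exact: measurable_normc.
by under eq_integral do rewrite /= ger0_norm ?normc_ge0//.
Qed.

Lemma cintegrableZ (c : R[i]) f : cintegrable f ->
  cintegrable (fun x => c * f x).
Proof.
move=> cf; apply: (@cintegrable_le _ (fun x => normc c * normc (f x))).
- by apply: cmeasurableM; [exact: cmeasurable_cst|exact: cf.1].
- rewrite (_ : _ \o _ = (fun x => (normc c)%:E * (normc (f x))%:E))%E//.
  by apply: integrableZl => //; exact: cintegrable_normc.
- by move=> x; rewrite Normc.normcM.
Qed.

Lemma cintZ (c : R[i]) f : cintegrable f -> cint (fun x => c * f x) = c * cint f.
Proof.
move=> cf; have ir := cintegrable_Re cf; have ii := cintegrable_Im cf.
case: c => a b; rewrite /cint; simpc; apply/eqP; rewrite eq_complex/=.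
have E1 x : complex.Re ((a +i* b) * f x) =
   a * complex.Re (f x) - b * complex.Im (f x) by case: (f x).
have E2 x : complex.Im ((a +i* b) * f x) =
   a * complex.Im (f x) + b * complex.Re (f x) by case: (f x).
have iZ (k : R) (h : T -> R) : mu.-integrable setT (fun x => (h x)%:E) ->
    mu.-integrable setT (EFin \o (fun x => k * h x)).
  by move=> ih; rewrite (_ : _ \o _ = (fun x => k%:E * (h x)%:E)%E)//; exact: integrableZl.
apply/andP; split; apply/eqP.
  under eq_Rintegral do rewrite E1.
  by rewrite RintegralB//; [rewrite !RintegralZl//|exact: iZ|exact: iZ].
under eq_Rintegral do rewrite E2.
by rewrite RintegralD//; [rewrite !RintegralZl//|exact: iZ|exact: iZ].
Qed.

Lemma cintegrableD f g : cintegrable f -> cintegrable g ->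
  cintegrable (fun x => f x + g x).
Proof.
move=> cf cg; apply: (@cintegrable_le _ (fun x => normc (f x) + normc (g x))).
- case: cf cg => [[f1 f2] _] [[g1 g2] _]; split.
    rewrite (_ : (fun _ => _) = (fun x => complex.Re (f x) + complex.Re (g x))); first exact: measurable_funD.
    by apply/funext => x; case: (f x) (g x) => [? ?] [].
  rewrite (_ : (fun _ => _) = (fun x => complex.Im (f x) + complex.Im (g x))); first exact: measurable_funD.
  by apply/funext => x; case: (f x) (g x) => [? ?] [].
- rewrite (_ : _ \o _ = (fun x => (normc (f x))%:E + (normc (g x))%:E))%E//.
  by apply: integrableD => //; exact: cintegrable_normc.
- by move=> x; exact: le_normcD.
Qed.

Lemma cintD f g : cintegrable f -> cintegrable g ->
  cint (fun x => f x + g x) = cint f + cint g.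
Proof.
move=> cf cg; rewrite /cint; apply/eqP; rewrite eq_complex/=.
apply/andP; split; apply/eqP.
  rewrite -RintegralD//; [|exact: cintegrable_Re|exact: cintegrable_Re].
  by apply: eq_Rintegral => x _; case: (f x) (g x) => [? ?] [].
rewrite -RintegralD//; [|exact: cintegrable_Im|exact: cintegrable_Im].
by apply: eq_Rintegral => x _; case: (f x) (g x) => [? ?] [].
Qed.

Lemma cint_conj f : cintegrable f -> cint (fun x => conjc (f x)) = conjc (cint f).
Proof.
move=> cf; rewrite /cint/=; congr (_ +i* _).
  by apply: eq_Rintegral => x _; case: (f x).
rewrite -mulN1r -RintegralZl//; last exact: cintegrable_Im.
by apply: eq_Rintegral => x _; rewrite mulN1r; case: (f x).
Qed.

Lemma cintegrable_conj f : cintegrable f -> cintegrable (fun x => conjc (f x)).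
Proof.
move=> [mf foo]; split; first exact: cmeasurable_conj.
by under eq_integral do rewrite normc_conj.
Qed.

Lemma eq_cint f g : f =1 g -> cint f = cint g.
Proof. by move=> /funext ->. Qed.

(** Real and imaginary parts are estimated separately, which costs the factor 2; it reappears in the
    kernel of [stft_window_change], where only finiteness matters. *)
Lemma normc_cint_le f : cintegrable f ->
  ((normc (cint f))%:E <= 2%:E * \int[mu]_x (normc (f x))%:E)%E.
Proof.
move=> cf; have ir := cintegrable_Re cf; have ii := cintegrable_Im cf.
have Ioo := cf.2.
have nI : (\int[mu]_x (normc (f x))%:E)%E = (\int[mu]_x normc (f x))%:E.
  rewrite fineK// ge0_fin_numE//; apply: integral_ge0 => x _.
  by rewrite lee_fin normc_ge0.
rewrite nI -EFinM lee_fin (le_trans (normc_le_ReIm _))//= mulr_natl mulr2n.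
have inf := cintegrable_normc cf.
apply: lerD.
  rewrite (le_trans (le_normr_Rintegral _ _))// le_Rintegral//.
    exact: integrable_norm ir.
  by move=> x _; exact: le_normr_Re.
rewrite (le_trans (le_normr_Rintegral _ _))// le_Rintegral//.
  exact: integrable_norm ii.
by move=> x _; exact: le_normr_Im.
Qed.

End cint.

(** The integral of a section is [fine] of the difference of the integrals of its positive and
    negative parts; each of these is measurable in x by Tonelli, and [fine] is measurable, so
    sections of infinite integral do no harm. *)
Lemma measurable_Rintegral_param d1 d2 (T1 : measurableType d1)
    (T2 : measurableType d2) (R : realType)
    (m2 : {sigma_finite_measure set T2 -> \bar R}) (f : T1 * T2 -> R) :
  measurable_fun setT f ->
  measurable_fun setT (fun x => \int[m2]_y f (x, y)).
Proof.
move=> mf; have mEf : measurable_fun setT (EFin \o f) by exact/measurable_EFinP.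
rewrite /Rintegral; apply: (measurableT_comp (fine_measurable measurableT)).
under eq_fun do rewrite integralE.
apply: emeasurable_funB.
  under eq_fun do (under eq_integral do
    rewrite -[X in X^\+%E]/((EFin \o f) \o pair _) funepos_comp/=).
  by apply: (measurable_fun_fubini_tonelli_F ((EFin \o f)^\+%E)) => //;
     exact: measurable_funepos.
under eq_fun do (under eq_integral do
  rewrite -[X in X^\-%E]/((EFin \o f) \o pair _) funeneg_comp/=).
by apply: (measurable_fun_fubini_tonelli_F ((EFin \o f)^\-%E)) => //;
   exact: measurable_funeneg.
Qed.

Lemma cmeasurable_cint_param d1 d2 (T1 : measurableType d1)
    (T2 : measurableType d2) (R : realType)
    (m2 : {sigma_finite_measure set T2 -> \bar R}) (f : T1 * T2 -> R[i]) :
  cmeasurable f -> cmeasurable (fun x => cint m2 (fun y => f (x, y))).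
Proof.
move=> [fr fi]; split => /=.
  exact: (measurable_Rintegral_param m2 fr).
exact: (measurable_Rintegral_param m2 fi).
Qed.

Section fubini.
Context d1 d2 (T1 : measurableType d1) (T2 : measurableType d2) {R : realType}.
Variable m1 : {sigma_finite_measure set T1 -> \bar R}.
Variable m2 : {sigma_finite_measure set T2 -> \bar R}.

Lemma Rintegral12_prod (f : T1 * T2 -> R) :
  (m1 \x m2)%E.-integrable setT (EFin \o f) ->
  \int[m1]_x \int[m2]_y f (x, y) = \int[(m1 \x m2)%E]_z f z.
Proof.
move=> imf; rewrite {3}/Rintegral -(integral12_prod_meas1 imf); congr fine.
have iF := integrable_fubini_F imf.
(* [Rintegral] replaces an infinite inner integral by 0, so the two inner integrals are compared
   only where the extended one is finite, which is almost everywhere. *)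
apply: ae_eq_integral => //.
- apply/measurable_EFinP; apply: measurable_Rintegral_param.
  by apply/measurable_EFinP; exact: measurable_int imf.
- exact: measurable_int iF.
- have := integrable_ae measurableT iF; apply: filterS => x /(_ I) Fx _.
  by rewrite /Rintegral fineK.
Qed.

Lemma Rintegral21_prod (f : T1 * T2 -> R) :
  (m1 \x m2)%E.-integrable setT (EFin \o f) ->
  \int[m2]_y \int[m1]_x f (x, y) = \int[(m1 \x m2)%E]_z f z.
Proof.
move=> imf; rewrite {3}/Rintegral -(integral21_prod_meas1 imf); congr fine.
apply: ae_eq_integral => //.
- apply/measurable_EFinP.
  apply: (measurableT_comp (fine_measurable measurableT)).
  exact: measurable_fubini_G imf.
- exact: measurable_fubini_G imf.
- have := ae_integrable2 imf; apply: filterS => y iy _.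
  by rewrite /Rintegral fineK//; exact: integrable_fin_num.
Qed.

Variable f : T1 * T2 -> R[i].

Lemma cintegrable_prodP : cmeasurable f ->
  (\int[m1]_x \int[m2]_y (normc (f (x, y)))%:E < +oo)%E ->
  cintegrable (m1 \x m2)%E f.
Proof.
move=> mf foo; split => //; rewrite fubini_tonelli1//.
- by apply/measurable_EFinP; exact: measurable_normc.
- by move=> x; rewrite lee_fin normc_ge0.
Qed.

Hypothesis cf : cintegrable (m1 \x m2)%E f.

Lemma cint_prod12 :
  cint m1 (fun x => cint m2 (fun y => f (x, y))) = cint (m1 \x m2)%E f.
Proof.
rewrite /cint; congr (_ +i* _).
  by rewrite -Rintegral12_prod//; exact: cintegrable_Re.
by rewrite -Rintegral12_prod//; exact: cintegrable_Im.
Qed.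

Lemma cint_prod21 :
  cint m2 (fun y => cint m1 (fun x => f (x, y))) = cint (m1 \x m2)%E f.
Proof.
rewrite /cint; congr (_ +i* _).
  by rewrite -Rintegral21_prod//; exact: cintegrable_Re.
by rewrite -Rintegral21_prod//; exact: cintegrable_Im.
Qed.

End fubini.

(** * Lebesgue measure on row vectors *)

Section measure_preserving.
Context d1 d2 (X : measurableType d1) (Y : measurableType d2) {R : realType}.
Variables (mu : {measure set X -> \bar R}) (nu : {measure set Y -> \bar R}).
Variable phi : X -> Y.
Hypothesis mphi : measurable_fun setT phi.
Hypothesis phiE : forall A, measurable A -> mu (phi @^-1` A) = nu A.

Lemma ge0_integral_preserving (f : Y -> \bar R) :
  measurable_fun setT f -> (forall y, 0 <= f y)%E ->
  (\int[mu]_x f (phi x) = \int[nu]_y f y)%E.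
Proof.
move=> mf f0; rewrite -[LHS](@ge0_integral_pushforward _ _ _ _ _ _ mphi mu setT)//.
by apply: eq_measure_integral => A mA _; exact: phiE.
Qed.

Lemma Rintegral_preserving (f : Y -> R) : measurable_fun setT f ->
  \int[mu]_x f (phi x) = \int[nu]_y f y.
Proof.
move=> /measurable_EFinP mf; rewrite /Rintegral; congr fine.
rewrite integralE [RHS]integralE; congr (_ - _)%E.
  rewrite -[RHS]ge0_integral_preserving//; last exact: measurable_funepos.
  by apply: eq_integral => x _; rewrite funepos.unlock.
rewrite -[RHS]ge0_integral_preserving//; last exact: measurable_funeneg.
by apply: eq_integral => x _; rewrite funeneg.unlock.
Qed.

Lemma cint_preserving (f : Y -> R[i]) : cmeasurable f ->
  cint mu (fun x => f (phi x)) = cint nu f.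
Proof.
move=> [fr fi]; rewrite /cint; congr (_ +i* _).
  exact: (Rintegral_preserving fr).
exact: (Rintegral_preserving fi).
Qed.

Lemma cintegrable_preserving (f : Y -> R[i]) : cintegrable nu f ->
  cintegrable mu (fun x => f (phi x)).
Proof.
move=> [mf foo]; split; first exact: cmeasurable_comp mf mphi.
rewrite (ge0_integral_preserving (f := fun y => (normc (f y))%:E))//.
  by apply/measurable_EFinP; exact: measurable_normc.
by move=> v; rewrite lee_fin normc_ge0.
Qed.

End measure_preserving.

Section lebesgue_1d.
Context {R : realType}.
Local Notation mu := (@lebesgue_measure R).

(** The image of Lebesgue measure under the translation agrees with it on the intervals []b, c]],
    which determine it. *)
Lemma lebesgue_measure_shift (a : R) (A : set R) : measurable A ->
  mu ((fun x => x + a) @^-1` A) = mu A.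
Proof.
move=> mA.
have ms : measurable_fun setT ((fun x => x + a) : measurableTypeR R -> measurableTypeR R).
  exact: measurable_funD.
pose nu := measure_function_pushforward__canonical__measure_function_Measure mu ms.
rewrite -[LHS]/(nu A).
apply/esym/lebesgue_measure_unique => //= _ [[b c]] _ <-.
rewrite /pushforward (_ : _ @^-1` _ = `](b - a), (c - a)]%classic); last first.
  by apply/seteqP; split => x /=; rewrite !in_itv/= ltrBlDr lerBrDr.
rewrite !lebesgue_measure_itv/= !lte_fin ltrD2r; case: ifPn => // _.
by congr (_%:E); ring.
Qed.

End lebesgue_1d.

Section sigma_finite_rV.
Context {R : realType} (N : nat).

Lemma measurable_rV_box (A : 'I_N -> set R) : (forall i, measurable (A i)) ->
  measurable [set v : 'rV[R]_N | forall i, A i (v ord0 i)].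
Proof.
move=> mA; rewrite (_ : [set v | _] = \bigcap_(i in setT) (rV_coord i @^-1` A i)).
  apply: fin_bigcap_measurable => [|i _]; first exact: finite_finset.
  by rewrite -[X in measurable X]setTI; exact: measurable_rV_coord.
by apply/seteqP; split => v h i; [move=> _|]; exact: h.
Qed.

Lemma lebesgue_rV_sigma_finite : sigma_finite setT (lebesgue_rV R N).
Proof.
exists (fun k : nat => [set v : 'rV[R]_N | forall i, `[- k%:R, k%:R]%classic (v ord0 i)]).
  apply/esym/seteqP; split => // v _.
  pose B := \sum_i `|v ord0 i|.
  exists (Num.bound B) => //= i; rewrite in_itv/= -ler_norml.
  have h : `|v ord0 i| <= B by rewrite /B (bigD1 i)//= lerDl sumr_ge0.
  rewrite (le_trans h)// ltW// archi_boundP// sumr_ge0//.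
move=> k; split; first by apply: (@measurable_rV_box (fun=> `[- k%:R, k%:R]%classic)) => i; exact: measurable_itv.
rewrite (@lebesgue_rV_box R N (fun=> `[- k%:R, k%:R]%classic))//.
under eq_bigr => i _.
  rewrite (_ : lebesgue_measure _ = (k%:R + k%:R)%:E); last first.
    (* For k = 0 the interval is a point and the strict comparison fails; the resulting length 0 is
       still k + k. *)
    rewrite lebesgue_measure_itv/= lte_fin; case: ifPn; first by rewrite opprK.
    have k0 : 0 <= k%:R :> R by [].
    rewrite -leNgt => ?; congr (_%:E); apply/eqP.
    by rewrite eq_le; apply/andP; split; lra.
  over.
by rewrite prodEFin ltry.
Qed.

HB.instance Definition _ := Measure_isSigmaFinite.Build _ _ _ (lebesgue_rV R N)
  lebesgue_rV_sigma_finite.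

End sigma_finite_rV.

Section rV_induction.
Context {R : realType}.

Lemma rV_consE N (p : 'rV[R]_N * R) :
  ((rV_cons p) ord0 ord0 = p.2) *
  (forall i, (rV_cons p) ord0 (lift ord0 i) = p.1 ord0 i).
Proof.
split=> [|i].
  have -> : (ord0 : 'I_N.+1) = lshift N (ord0 : 'I_1) by exact/val_inj.
  transitivity (((p.2)%:M : 'M[R]_1) ord0 ord0); last by rewrite mxE eqxx mulr1n.
  exact: (@row_mxEl _ 1 1 N).
by rewrite -rshift1; exact: (@row_mxEr _ 1 1 N).
Qed.

Lemma rV_cons_surj N (a : 'rV[R]_N.+1) : a = rV_cons (\row_i a ord0 (lift ord0 i), a ord0 ord0).
Proof.
by apply/rowP => i; case: (unliftP ord0 i) => [j|] ->; rewrite rV_consE ?mxE.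
Qed.

Lemma rV_consD N (p q : 'rV[R]_N * R) : rV_cons p + rV_cons q = rV_cons (p.1 + q.1, p.2 + q.2).
Proof.
by apply/rowP => i; rewrite mxE; case: (unliftP ord0 i) => [j|] ->; rewrite !rV_consE ?mxE.
Qed.

Lemma rV_consN N (p : 'rV[R]_N * R) : - rV_cons p = rV_cons (- p.1, - p.2).
Proof.
by apply/rowP => i; rewrite mxE; case: (unliftP ord0 i) => [j|] ->; rewrite !rV_consE ?mxE.
Qed.

(** Tonelli along the recursive definition of [lebesgue_rV]; the invariance statements below are
    inductions on the dimension through it. *)
Lemma ge0_integral_rVS N (f : 'rV[R]_N.+1 -> \bar R) :
  measurable_fun setT f -> (forall v, 0 <= f v)%E ->
  (\int[lebesgue_rV R N.+1]_v f v =
   \int[lebesgue_rV R N]_v \int[lebesgue_measure]_t f (rV_cons (v, t)))%E.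
Proof.
move=> mf f0.
have mc := @measurable_rV_cons R N.
rewrite [LHS](@ge0_integral_pushforward _ _ _ _ _ _ mc (lebesgue_rV R N \x lebesgue_measure)%E setT f)//.
rewrite preimage_setT fubini_tonelli1//.
  exact: measurableT_comp.
move=> p; exact: f0.
Qed.

Lemma measurable_rV_shift N (a : 'rV[R]_N) :
  measurable_fun setT (fun v : 'rV[R]_N => v + a).
Proof.
apply/measurable_fun_rVP => i.
rewrite (_ : _ \o _ = (fun v : 'rV[R]_N => (v ord0 i : R) + a ord0 i)).
  by apply: measurable_funD => //; exact: measurable_rV_coord.
by apply/funext => v; rewrite /rV_coord/= mxE.
Qed.

Lemma measurable_rVN N : measurable_fun setT (fun v : 'rV[R]_N => - v).
Proof.
apply/measurable_fun_rVP => i.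
rewrite (_ : _ \o _ = (fun v : 'rV[R]_N => - (v ord0 i : R))).
  by apply: measurableT_comp => //; exact: measurable_rV_coord.
by apply/funext => v; rewrite /rV_coord/= mxE.
Qed.

(** Peeling off the first coordinate splits the translation into one on the line and one in
    dimension N. *)
Lemma ge0_integral_rV_shift N (a : 'rV[R]_N) (f : 'rV[R]_N -> \bar R) :
  measurable_fun setT f -> (forall v, 0 <= f v)%E ->
  (\int[lebesgue_rV R N]_v f (v + a)%R = \int[lebesgue_rV R N]_v f v)%E.
Proof.
elim: N a f => [|N IH] a f mf f0.
  by rewrite (thinmx0 a); under eq_integral do rewrite addr0.
have ma := measurable_rV_shift a.
rewrite (ge0_integral_rVS mf f0).
rewrite (ge0_integral_rVS (f := fun v => f (v + a)) (measurableT_comp mf ma) (fun v => f0 _)).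
rewrite {1}(rV_cons_surj a); set a' := \row_i _; set a0 := a _ _.
pose F v := (\int[lebesgue_measure]_t f (rV_cons (v, t)))%E.
have mfc : measurable_fun setT (f \o @rV_cons R N).
  by apply: measurableT_comp => //; exact: measurable_rV_cons.
transitivity (\int[lebesgue_rV R N]_v F (v + a')%R)%E.
  apply: eq_integral => v _; rewrite /F.
  under eq_integral do rewrite rV_consD/=.
  have mg : measurable_fun setT (fun t => f (rV_cons (v + a', t))).
    exact: measurableT_comp mfc (measurable_pair1 _).
  have ms : measurable_fun setT ((fun x => x + a0) : measurableTypeR R -> measurableTypeR R).
    exact: measurable_funD.
  rewrite -[LHS](@ge0_integral_pushforward _ _ _ _ _ _ ms lebesgue_measure setT
    (fun t => f (rV_cons (v + a', t))))//.
  by apply: eq_measure_integral => A mA _; exact: lebesgue_measure_shift.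
apply: IH; last by move=> v; exact: integral_ge0.
exact: (measurable_fun_fubini_tonelli_F (f \o @rV_cons R N) mfc (fun p => f0 _)).
Qed.

Lemma ge0_integral_rVN N (f : 'rV[R]_N -> \bar R) :
  measurable_fun setT f -> (forall v, 0 <= f v)%E ->
  (\int[lebesgue_rV R N]_v f (- v)%R = \int[lebesgue_rV R N]_v f v)%E.
Proof.
elim: N f => [|N IH] f mf f0.
  by apply: eq_integral => v _; rewrite (thinmx0 v) oppr0.
have ma := @measurable_rVN N.+1.
rewrite (ge0_integral_rVS mf f0).
rewrite (ge0_integral_rVS (f := fun v => f (- v)) (measurableT_comp mf ma) (fun v => f0 _)).
pose F v := (\int[lebesgue_measure]_t f (rV_cons (v, t)))%E.
have mfc : measurable_fun setT (f \o @rV_cons R N).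
  by apply: measurableT_comp => //; exact: measurable_rV_cons.
transitivity (\int[lebesgue_rV R N]_v F (- v)%R)%E.
  apply: eq_integral => v _; rewrite /F.
  under eq_integral do rewrite rV_consN/=.
  have mg : measurable_fun setT (fun t => f (rV_cons (- v, t))).
    exact: measurableT_comp mfc (measurable_pair1 _).
  have ms : measurable_fun setT ((fun x => - x) : measurableTypeR R -> measurableTypeR R).
    exact: oppr_measurable.
  rewrite -[LHS](@ge0_integral_pushforward _ _ _ _ _ _ ms lebesgue_measure setT
    (fun t => f (rV_cons (- v, t))))//.
  by apply: eq_measure_integral => A mA _; exact: lebesgue_measureN.
apply: IH; last by move=> v; exact: integral_ge0.
exact: (measurable_fun_fubini_tonelli_F (f \o @rV_cons R N) mfc (fun p => f0 _)).
Qed.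

Lemma lebesgue_rV_shift N (a : 'rV[R]_N) (A : set 'rV[R]_N) : measurable A ->
  lebesgue_rV R N ((fun v => v + a) @^-1` A) = lebesgue_rV R N A.
Proof.
move=> mA; have mpre : measurable ((fun v => v + a) @^-1` A).
  by rewrite -[X in measurable X]setTI; exact: measurable_rV_shift.
have mI : measurable_fun setT (fun v => (\1_A v : R)%:E).
  by apply/measurable_EFinP; exact: measurable_indic.
have I0 v : (0 <= (\1_A v : R)%:E)%E by rewrite lee_fin indicE.
have : (\int[lebesgue_rV R N]_v (\1_((fun v => v + a)%R @^-1` A) v)%:E =
        \int[lebesgue_rV R N]_v (\1_A v)%:E)%E := ge0_integral_rV_shift a mI I0.
by rewrite !integral_indic// !setIT.
Qed.

Lemma lebesgue_rVN N (A : set 'rV[R]_N) : measurable A ->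
  lebesgue_rV R N ((fun v => - v) @^-1` A) = lebesgue_rV R N A.
Proof.
move=> mA; have mpre : measurable ((fun v => - v) @^-1` A).
  by rewrite -[X in measurable X]setTI; exact: measurable_rVN.
have mI : measurable_fun setT (fun v => (\1_A v : R)%:E).
  by apply/measurable_EFinP; exact: measurable_indic.
have I0 v : (0 <= (\1_A v : R)%:E)%E by rewrite lee_fin indicE.
have : (\int[lebesgue_rV R N]_v (\1_((fun v => - v)%R @^-1` A) v)%:E =
        \int[lebesgue_rV R N]_v (\1_A v)%:E)%E := ge0_integral_rVN mI I0.
by rewrite !integral_indic// !setIT.
Qed.

(** Gaussians and characters factor over the coordinates, so this reduces their integrals to the
    line. In dimension 0 the measure is a Dirac mass, which matches the empty product 1. *)
Lemma cint_prod_rV N (h : 'I_N -> R -> R[i]) :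
  (forall i, cintegrable (@lebesgue_measure R) (h i)) ->
  cintegrable (lebesgue_rV R N) (fun v => \prod_i h i (v ord0 i)) /\
  cint (lebesgue_rV R N) (fun v => \prod_i h i (v ord0 i)) =
  \prod_i cint (@lebesgue_measure R) (h i).
Proof.
elim: N h => [|N IH] h ch.
  rewrite (_ : (fun _ => _) = (fun=> 1)); last first.
    by apply/funext => v; rewrite big_ord0.
  split; first split.
  - exact: cmeasurable_cst.
  - suff: (\int[\d_(0%R:'rV[R]_0)]_x (normc (1%R:R[i]))%:E < +oo)%E by [].
    by rewrite integral_dirac// Normc.normc1 diracT mul1e ltry.
  - rewrite big_ord0 /cint/= /Rintegral.
    suff H (r : R) : (\int[\d_(0%R:'rV[R]_0)]__ r%:E)%E = r%:E.
      by congr (_ +i* _); rewrite [X in fine X]H.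
    by rewrite integral_dirac// diracT mul1e.
have [cI EI] := IH (fun i => h (lift ord0 i)) (fun i => ch (lift ord0 i)).
pose F (p : 'rV[R]_N * R) := h ord0 p.2 * \prod_i h (lift ord0 i) (p.1 ord0 i).
have FE p : \prod_i h i (rV_cons p ord0 i) = F p.
  rewrite /F big_ord_recl rV_consE; congr (_ * _).
  by apply: eq_bigr => i _; rewrite rV_consE.
have mF : cmeasurable F.
  apply: cmeasurableM.
    by apply: cmeasurable_comp (ch ord0).1 _; exact: measurable_snd.
  by apply: cmeasurable_comp cI.1 _; exact: measurable_fst.
have cF : cintegrable (lebesgue_rV R N \x @lebesgue_measure R)%E F.
  apply: cintegrable_prodP => //.
  rewrite /F/=; under eq_integral do under eq_integral do rewrite Normc.normcM EFinM.
  have i0 := cintegrable_normc (ch ord0).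
  under eq_integral => v _.
    rewrite ge0_integralZr//.
    - over.
    - by apply/measurable_EFinP; apply: measurable_normc; exact: (ch ord0).1.
    - by move=> t _; rewrite lee_fin normc_ge0.
    - by rewrite lee_fin normc_ge0.
  rewrite ge0_integralZl//.
  - have := (ch ord0).2; have := cI.2.
    set a := (\int[_]_x _)%E; set b := (\int[_]_x _)%E => aoo boo.
    apply: lte_mul_pinfty => //.
      by apply: integral_ge0 => t _; rewrite lee_fin normc_ge0.
    rewrite ge0_fin_numE//.
    by apply: integral_ge0 => t _; rewrite lee_fin normc_ge0.
  - by apply/measurable_EFinP; apply: measurable_normc; exact: cI.1.
  - by move=> t _; rewrite lee_fin normc_ge0.
  - by apply: integral_ge0 => t _; rewrite lee_fin normc_ge0.
have mf : cmeasurable (fun v : 'rV[R]_N.+1 => \prod_i h i (v ord0 i)).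
  have : cmeasurable (fun v : 'rV[R]_N.+1 => F (\row_i v ord0 (lift ord0 i), v ord0 ord0)).
    apply: (cmeasurable_comp mF); apply: measurable_fun_pair => /=.
      apply/measurable_fun_rVP => i.
      rewrite (_ : _ \o _ = rV_coord (lift ord0 i)); first exact: measurable_rV_coord.
      by apply/funext => v; rewrite /rV_coord/= mxE.
    exact: (measurable_rV_coord ord0).
  congr cmeasurable; apply/funext => v; rewrite -FE.
  by apply: eq_bigr => i _; rewrite -rV_cons_surj.
have cf : cintegrable (lebesgue_rV R N.+1) (fun v => \prod_i h i (v ord0 i)).
  split => //.
  rewrite -(ge0_integral_preserving (mu := (lebesgue_rV R N \x lebesgue_measure)%E)
    (@measurable_rV_cons R N))//.
  - by under eq_integral do rewrite FE; exact: cF.2.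
  - by apply/measurable_EFinP; exact: measurable_normc.
  - by move=> t; rewrite lee_fin normc_ge0.
split => //; rewrite big_ord_recl -EI.
rewrite -(cint_preserving (mu := (lebesgue_rV R N \x lebesgue_measure)%E)
  (@measurable_rV_cons R N))//.
under eq_cint do rewrite FE.
rewrite -cint_prod12// /F/=.
under eq_cint do under eq_cint do rewrite mulrC.
under eq_cint do rewrite cintZ//.
under eq_cint do rewrite mulrC.
by rewrite cintZ.
Qed.

End rV_induction.

(** * Fourier transforms of Gaussians on the line *)

Section gauss_1d.
Context {R : realType}.
Local Notation mu := (@lebesgue_measure R).
Implicit Types (b x y : R).

Definition gauss b x := expR (- (b * x ^+ 2)).

Lemma gauss_ge0 b x : 0 <= gauss b x. Proof. exact: expR_ge0. Qed.

Lemma measurable_gauss b : measurable_fun setT (gauss b).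
Proof.
apply: measurableT_comp; first exact: measurable_expR.
by apply: measurableT_comp => //; apply: measurable_funM => //; exact: measurable_funX.
Qed.

(** The normal density of variance 1/(2b) provides both the integrability and the total mass. *)
Lemma gauss_normal b : 0 < b ->
  gauss b = (fun x => Num.sqrt (pi / b) * normal_pdf 0 (Num.sqrt (2 * b)^-1) x).
Proof.
move=> b0; have s0 : Num.sqrt (2 * b)^-1 != 0.
  by rewrite gt_eqF// sqrtr_gt0 invr_gt0 mulr_gt0.
apply/funext => x; rewrite normal_pdfE// /normal_fun /normal_peak /gauss.
rewrite sqr_sqrtr ?invr_ge0 ?mulr_ge0 ?(ltW b0)//.
have -> : (2 * b)^-1 * pi *+ 2 = pi / b by field; rewrite gt_eqF.
rewrite mulVKf; last by rewrite gt_eqF// sqrtr_gt0 divr_gt0// pi_gt0.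
by congr expR; field; rewrite gt_eqF.
Qed.

Lemma integrable_gauss b : 0 < b -> mu.-integrable setT (EFin \o gauss b).
Proof.
move=> b0; rewrite gauss_normal//.
rewrite (_ : _ \o _ = (fun x => (Num.sqrt (pi / b))%:E *
  (normal_pdf 0 (Num.sqrt (2 * b)^-1) x)%:E)%E)//.
by apply: integrableZl => //; exact: integrable_normal_pdf.
Qed.

Lemma Rintegral_gauss b : 0 < b -> \int[mu]_x gauss b x = Num.sqrt (pi / b).
Proof.
move=> b0; rewrite gauss_normal// RintegralZl//; last exact: integrable_normal_pdf.
by rewrite [X in _ * X]/Rintegral integral_normal_pdf mulr1.
Qed.

Lemma norm_le_expR b y : 0 < b -> `|y| <= (1 + b^-1) * expR (b * y ^+ 2).
Proof.
move=> b0; have h := expR_ge1Dx (b * y ^+ 2).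
have b1 : 0 < b^-1 by rewrite invr_gt0.
have h1 : `|y| <= 1 + y ^+ 2.
  by rewrite -(@real_normK _ y) ?num_real//; have := normr_ge0 y; nra.
apply: (le_trans h1).
have h2 : 1 <= expR (b * y ^+ 2) by rewrite -expR0 ler_expR mulr_ge0 ?sqr_ge0 ?ltW.
have h3 : y ^+ 2 <= b^-1 * expR (b * y ^+ 2).
  by rewrite -(@ler_pM2l _ b)// mulVKf ?gt_eqF//; lra.
by rewrite mulrDl mul1r lerD.
Qed.

(** Half of the exponent absorbs the linear factor that appears when a Gaussian integral is
    differentiated in a parameter. *)
Lemma gauss_norm_le b y : 0 < b ->
  `|y| * gauss b y <= (1 + 2 / b) * gauss (b / 2) y.
Proof.
move=> b0; have b20 : 0 < b / 2 by rewrite divr_gt0.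
have := norm_le_expR y b20; rewrite invf_div => h.
rewrite (_ : gauss b y = gauss (b / 2) y * gauss (b / 2) y); last first.
  by rewrite /gauss -expRD; congr expR; field.
rewrite mulrA ler_wpM2r ?gauss_ge0// (le_trans (ler_wpM2r _ h)) ?gauss_ge0//.
by rewrite /gauss -(mulrA (1 + _)) -expRD subrr expR0 mulr1.
Qed.

(** From (x + t)^2 = x^2/2 - t^2 + (x + 2t)^2/2, hence (x + t)^2 >= x^2/2 - 1. This gives one
    integrable majorant for all translates by at most 1. *)
Lemma gauss_shift_le b x t : 0 < b -> `|t| <= 1 ->
  gauss b (x + t) <= expR b * gauss (b / 2) x.
Proof.
move=> b0 t1; rewrite /gauss -expRD ler_expR.
have : t ^+ 2 <= 1 by rewrite -real_normK ?num_real// expr_le1.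
have := sqr_ge0 (x + t *+ 2) => h1 h2.
have h3 : x ^+ 2 / 2 - 1 <= (x + t) ^+ 2.
  rewrite -subr_ge0 (_ : _ - _ = (x + t *+ 2) ^+ 2 / 2 + (1 - t ^+ 2)).
    by rewrite addr_ge0 ?divr_ge0// subr_ge0.
  by field.
rewrite -subr_ge0 (_ : _ - _ = b * ((x + t) ^+ 2 - (x ^+ 2 / 2 - 1))); last by field.
by apply: mulr_ge0; [exact: ltW|rewrite subr_ge0].
Qed.

Lemma is_derive_gauss b x :
  is_derive x 1 (gauss b) (- (2 * b * x) * gauss b x).
Proof.
rewrite /gauss; have h : is_derive x 1 (fun y => - (b * y ^+ 2)) (- (2 * b * x)).
  by apply: is_derive_eq; rewrite /GRing.scale/=; ring.
have hs := is_derive_expR (- (b * x ^+ 2)).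
by have := @is_derive1_comp _ expR _ x _ _ hs h; rewrite mulrC.
Qed.

Lemma is_derive_gauss_sin b k x :
  is_derive x 1 (fun y => gauss b y * sin (y * k))
   (k * (gauss b x * cos (x * k)) - 2 * b * (x * gauss b x * sin (x * k))).
Proof.
have h1 := is_derive_gauss b x.
have h2 : is_derive x 1 (fun y => sin (y * k)) (k * cos (x * k)).
  have h : is_derive x 1 (fun y => y * k) k.
    by apply: is_derive_eq; rewrite /GRing.scale/=; ring.
  have hs := is_derive_sin (x * k).
  by have := @is_derive1_comp _ sin ( *%R^~ k) x _ _ hs h; rewrite mulrC.
by apply: is_derive_eq; rewrite /GRing.scale/=; ring.
Qed.

Lemma is_derive_cos_param y x :
  is_derive x 1 (fun x => cos (y * x)) (- (y * sin (y * x))).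
Proof.
have h : is_derive x 1 (fun x => y * x) y.
  by apply: is_derive_eq; rewrite /GRing.scale/=; ring.
by have := is_derive1_comp (is_derive_cos (y * x)) h; rewrite mulNr mulrC.
Qed.

Lemma measurable_cosM k : measurable_fun setT (fun y : R => cos (y * k)).
Proof.
apply: (measurableT_comp (f := cos)); last exact: measurable_funM.
by apply: continuous_measurable_fun; exact: continuous_cos.
Qed.

Lemma measurable_sinM k : measurable_fun setT (fun y : R => sin (y * k)).
Proof.
apply: (measurableT_comp (f := sin)); last exact: measurable_funM.
by apply: continuous_measurable_fun; exact: continuous_sin.
Qed.

Lemma integrable_le_gauss b c (u : R -> R) : 0 < b -> measurable_fun setT u ->
  (forall y, `|u y| <= c * gauss b y) -> mu.-integrable setT (EFin \o u).
Proof.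
move=> b0 mu_ ub; apply: (@le_integrable _ _ _ mu _ measurableT _
   (EFin \o (fun y => c * gauss b y))) => //.
- exact/measurable_EFinP.
- by move=> y _; rewrite lee_fin (le_trans (ub y))// ler_norm.
- rewrite (_ : _ \o _ = (fun x => c%:E * (gauss b x)%:E)%E)//.
  by apply: integrableZl => //; exact: integrable_gauss.
Qed.

(** By translation invariance the integral of [u (y + t)] is constant in t; differentiating it under
    the integral sign at t = 0 gives the claim, with the majorant of [gauss_shift_le]. *)
Lemma Rintegral_derive_eq0 b c (u du : R -> R) : 0 < b ->
  measurable_fun setT u -> (forall y, is_derive y 1 u (du y)) ->
  (forall y, `|u y| <= c * gauss b y) -> (forall y, `|du y| <= c * gauss b y) ->
  \int[mu]_y du y = 0.
Proof.
move=> b0 mu_ dudu ub dub.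
have c0 : 0 <= c.
  by have := le_trans (normr_ge0 _) (ub 0); rewrite pmulr_lge0// expR_gt0.
pose f (t y : R) := u (y + t).
have d1f t y : partial1of2 f t y = du (y + t).
  rewrite partial1of2E.
  have h : is_derive t 1 (fun t => y + t) 1.
    by have := is_deriveD (is_derive_cst y t 1) (is_derive_id t 1); rewrite add0r.
  have := @is_derive1_comp _ u _ t _ _ (dudu (y + t)) h.
  by rewrite mulr1 => /(@derive_val _ _ _ _ _ _ _).
have I0 : (`]-1, 1[%classic : set R) 0 by rewrite /= in_itv/=; apply/andP; split; lra.
have mshift (t : R) : measurable_fun setT (fun y : R => y + t) by exact: measurable_funD.
have intf (t : R) : (`]-1, 1[%classic : set R) t -> mu.-integrable setT (EFin \o f t).
  rewrite /= in_itv/= => /andP[t1 t2].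
  apply: (@integrable_le_gauss (b / 2) (c * expR b)); first by rewrite divr_gt0.
    exact: measurableT_comp mu_ (mshift t).
  move=> y; rewrite (le_trans (ub _))// -mulrA ler_wpM2l// gauss_shift_le//.
  by rewrite ler_norml; apply/andP; split; exact: ltW.
have derf (t y : R) : (`]-1, 1[%classic : set R) t -> setT y -> derivable (f^~ y) t 1.
  move=> _ _; have h : is_derive t 1 (fun t => y + t) 1.
    by have := is_deriveD (is_derive_cst y t 1) (is_derive_id t 1); rewrite add0r.
  by have := @is_derive1_comp _ u _ t _ _ (dudu (y + t)) h; case.
have G0 y : 0 <= c * expR b * gauss (b / 2) y.
  by rewrite mulr_ge0 ?gauss_ge0// mulr_ge0// expR_ge0.
have iG : mu.-integrable setT (EFin \o (fun y => c * expR b * gauss (b / 2) y)).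
  apply: (@integrable_le_gauss (b / 2) (c * expR b)); first by rewrite divr_gt0.
    by apply: measurable_funM => //; exact: measurable_gauss.
  by move=> y; rewrite ger0_norm.
have ubG (t y : R) : (`]-1, 1[%classic : set R) t -> setT y ->
    `|partial1of2 f t y| <= c * expR b * gauss (b / 2) y.
  rewrite /= in_itv/= => /andP[t1 t2] _; rewrite d1f (le_trans (dub _))//.
  rewrite -mulrA ler_wpM2l// gauss_shift_le//.
  by rewrite ler_norml; apply/andP; split; exact: ltW.
have := differentiation_under_integral measurableT I0 intf derf G0 iG ubG.
under [in RHS]eq_Rintegral do rewrite d1f addr0.
move=> <-; rewrite (_ : (fun _ => _) = cst (\int[mu]_y u y)).
  by rewrite derive1_cst.
apply/funext => t /=; rewrite /f.
have := @Rintegral_preserving _ _ (measurableTypeR R) (measurableTypeR R) R mu mu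
  (fun y : R => y + t) (mshift t) (fun A mA => lebesgue_measure_shift t mA) u mu_.
by [].
Qed.

Lemma Rintegral_gauss_sin b k : 0 < b ->
  \int[mu]_y (gauss b y * sin (y * k)) = 0.
Proof.
move=> b0; have mf : measurable_fun setT (fun y : R => gauss b y * sin (y * k)).
  by apply: measurable_funM; [exact: measurable_gauss|exact: measurable_sinM].
have := Rintegral_preserving (mu := mu) (nu := mu) (phi := fun y : R => - y) _ _ mf.
have -> : \int[mu]_x (gauss b (- x) * sin (- x * k)) =
          - \int[mu]_x (gauss b x * sin (x * k)).
  rewrite -mulN1r -RintegralZl//.
    by apply: eq_Rintegral => x _; rewrite /gauss sqrrN mulNr sinN mulrN mulN1r.
  apply: (@integrable_le_gauss b 1) => // y.
  by rewrite mul1r normrM ger0_norm ?gauss_ge0// ler_piMr ?gauss_ge0// sin_max.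
set I := Rintegral _ _ _ => h; have : - I = I.
  by apply: h; [exact: oppr_measurable|move=> A mA; exact: lebesgue_measureN].
lra.
Qed.

(** The left side [phi] solves 2 b phi'(x) = - x phi(x), and its value at 0 is the mass of the
    Gaussian. *)
Lemma Rintegral_gauss_cos b k : 0 < b ->
  \int[mu]_y (gauss b y * cos (y * k)) =
  Num.sqrt (pi / b) * gauss (4 * b)^-1 k.
Proof.
move=> b0; have bn0 : b != 0 by rewrite gt_eqF.
pose c0 := 1 + 2 / b.
have c00 : 0 <= c0 by rewrite addr_ge0// divr_ge0// ltW.
have b20 : 0 < b / 2 by rewrite divr_gt0.
have gle y : gauss b y <= gauss (b / 2) y.
  rewrite ler_expR lerN2 ler_wpM2r ?sqr_ge0//; lra.
pose phi x := \int[mu]_y (gauss b y * cos (y * x)).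
pose S x := \int[mu]_y (y * gauss b y * sin (y * x)).
have ic x : mu.-integrable setT (EFin \o (fun y => gauss b y * cos (y * x))).
  apply: (@integrable_le_gauss b 1) => // [|y].
    by apply: measurable_funM; [exact: measurable_gauss|exact: measurable_cosM].
  by rewrite mul1r normrM ger0_norm ?gauss_ge0// ler_piMr ?gauss_ge0// cos_max.
have ubS x y : `|y * gauss b y * sin (y * x)| <= c0 * gauss (b / 2) y.
  rewrite 2!normrM (ger0_norm (gauss_ge0 _ _)) (le_trans _ (gauss_norm_le y b0))//.
  by rewrite ler_piMr ?sin_max// mulr_ge0// gauss_ge0.
have mS x : measurable_fun setT (fun y => y * gauss b y * sin (y * x)).
  apply: measurable_funM; last exact: measurable_sinM.
  by apply: measurable_funM => //; exact: measurable_gauss.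
have iS x : mu.-integrable setT (EFin \o (fun y => y * gauss b y * sin (y * x))).
  exact: (@integrable_le_gauss (b / 2) c0).
(* Integration by parts, in the form that the derivative of [gauss b y * sin (y * x)] in y has
   integral 0. *)
have SE x : 2 * b * S x = x * phi x.
  have : \int[mu]_y (x * (gauss b y * cos (y * x)) -
            2 * b * (y * gauss b y * sin (y * x))) = 0.
    (* A single constant has to bound the function and its derivative: 1 serves the former,
       [|x| + 2 b c0] the latter. *)
    apply: (@Rintegral_derive_eq0 (b / 2) (1 + `|x| + 2 * b * c0)
      (fun y => gauss b y * sin (y * x))) => //.
    - by apply: measurable_funM; [exact: measurable_gauss|exact: measurable_sinM].
    - by move=> y; exact: is_derive_gauss_sin.
    - move=> y; rewrite normrM ger0_norm ?gauss_ge0//.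
      rewrite (@le_trans _ _ (1 * gauss (b / 2) y))//.
        by rewrite mul1r (le_trans _ (gle y))// ler_piMr ?gauss_ge0// sin_max.
      rewrite ler_wpM2r ?gauss_ge0// -addrA lerDl addr_ge0// !mulr_ge0// ltW//.
    - move=> y; rewrite (le_trans (ler_normB _ _))// [leRHS]mulrDl.
      apply: lerD; last first.
        have b2 : 0 <= 2 * b by rewrite mulr_ge0// ltW.
        by rewrite normrM (ger0_norm b2) -[leRHS]mulrA ler_wpM2l.
      rewrite 2!normrM (ger0_norm (gauss_ge0 _ _)).
      rewrite (@le_trans _ _ (`|x| * gauss (b / 2) y))//.
        rewrite ler_wpM2l// (le_trans _ (gle y))// ler_piMr ?gauss_ge0// cos_max//.
      by rewrite ler_wpM2r ?gauss_ge0// lerDr.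
  rewrite RintegralB//.
  - by rewrite !RintegralZl// => /eqP; rewrite subr_eq0 => /eqP <-.
  - rewrite (_ : _ \o _ = (fun y => x%:E * (gauss b y * cos (y * x))%:E)%E)//.
    by apply: integrableZl => //; exact: ic.
  - rewrite (_ : _ \o _ = (fun y => (2 * b)%:E * (y * gauss b y * sin (y * x))%:E)%E)//.
    by apply: integrableZl => //; exact: iS.
have dphi x : is_derive x 1 phi (- S x).
  pose f (x y : R) := gauss b y * cos (y * x).
  have hf x' y : is_derive x' 1 (fun x => f x y) (- (y * gauss b y * sin (y * x'))).
    have h := is_derive_cos_param y x'.
    by rewrite /f; apply: is_derive_eq; rewrite /GRing.scale/=; ring.
  have d1f x' y : partial1of2 f x' y = - (y * gauss b y * sin (y * x')).
    by rewrite partial1of2E; have /(@derive_val _ _ _ _ _ _ _) := hf x' y.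
  have Ix : (`]x - 1, x + 1[%classic : set R) x.
    by rewrite /= in_itv/=; apply/andP; split; lra.
  have intf (t : R) : (`]x - 1, x + 1[%classic : set R) t -> mu.-integrable setT (EFin \o f t).
    by move=> _; exact: ic.
  have derf (t y : R) : (`]x - 1, x + 1[%classic : set R) t -> setT y -> derivable (f^~ y) t 1.
    by move=> _ _; case: (hf t y).
  have G0 y : 0 <= c0 * gauss (b / 2) y by rewrite mulr_ge0// gauss_ge0.
  have iG : mu.-integrable setT (EFin \o (fun y => c0 * gauss (b / 2) y)).
    apply: (@integrable_le_gauss (b / 2) c0) => //.
      by apply: measurable_funM => //; exact: measurable_gauss.
    by move=> y; rewrite ger0_norm.
  have ubG (t y : R) : (`]x - 1, x + 1[%classic : set R) t -> setT y ->
      `|partial1of2 f t y| <= c0 * gauss (b / 2) y.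
    by move=> _ _; rewrite d1f normrN.
  have D := derivable_under_integral measurableT Ix intf derf G0 iG ubG.
  have := differentiation_under_integral measurableT Ix intf derf G0 iG ubG.
  rewrite derive1E => E; apply: DeriveDef => //; rewrite /phi [LHS]E.
  under eq_Rintegral do rewrite d1f -mulN1r.
  by rewrite RintegralZl// mulN1r.
(* The integrating factor of the differential equation; constancy of the product then determines
   [phi]. *)
have dh x : is_derive x 1 (fun x => phi x * expR ((4 * b)^-1 * x ^+ 2)) 0.
  have h1 := dphi x.
  have h2 : is_derive x 1 (fun x => expR ((4 * b)^-1 * x ^+ 2))
       ((2 * b)^-1 * x * expR ((4 * b)^-1 * x ^+ 2)).
    have h : is_derive x 1 (fun x => (4 * b)^-1 * x ^+ 2) ((2 * b)^-1 * x).
      by apply: is_derive_eq; rewrite /GRing.scale/=; field.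
    have hs := is_derive_expR ((4 * b)^-1 * x ^+ 2).
    by rewrite [X in is_derive _ _ _ X]mulrC; exact: (@is_derive1_comp _ expR _ x _ _ hs h).
  apply: is_derive_eq; rewrite /GRing.scale/=.
  have -> : S x = (2 * b)^-1 * (x * phi x) by rewrite -SE mulKf// mulf_neq0.
  by ring.
have := is_derive_0_is_cst k 0 dh.
rewrite expr0n/= mulr0 expR0 mulr1.
have -> : phi 0 = Num.sqrt (pi / b).
  rewrite /phi -Rintegral_gauss//; apply: eq_Rintegral => y _.
  by rewrite mulr0 cos0 mulr1.
move=> <-; rewrite /gauss -mulrA -expRD subrr expR0 mulr1//.
Qed.

Lemma cint_gauss b k : 0 < b ->
  cintegrable mu (fun y => (gauss b y)%:C * cexp (0 +i* (y * k))) /\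
  cint mu (fun y => (gauss b y)%:C * cexp (0 +i* (y * k))) =
  (Num.sqrt (pi / b) * gauss (4 * b)^-1 k)%:C.
Proof.
move=> b0; split.
  apply: (cintegrable_le (mu := mu) (u := gauss b)).
  - apply: cmeasurableM; first by apply: cmeasurable_real; exact: measurable_gauss.
    by apply: cmeasurable_cexp; apply: cmeasurable_mk => //; exact: measurable_funM.
  - exact: integrable_gauss.
  - by move=> y; rewrite Normc.normcM normc_phase mulr1 normc_real ger0_norm ?gauss_ge0.
rewrite /cint (_ : (fun _ => complex.Re _) = (fun y => gauss b y * cos (y * k))); last first.
  by apply/funext => y; rewrite /cexp/= expR0; simpc.
rewrite (_ : (fun _ => complex.Im _) = (fun y => gauss b y * sin (y * k))); last first.
  by apply/funext => y; rewrite /cexp/= expR0; simpc.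
by rewrite Rintegral_gauss_sin// Rintegral_gauss_cos.
Qed.

End gauss_1d.

(** * Mixed norms *)

Section Lnorm_le.
Context d (T : measurableType d) {R : realType}.
Variable mu : {measure set T -> \bar R}.
Local Open Scope ereal_scope.
Implicit Types (f g : T -> \bar R).

Lemma Lnormy_leP f (c : \bar R) : 0 <= c ->
  'N[mu]_+oo[f] <= c <-> \forall x \ae mu, `|f x| <= c.
Proof.
move=> c0; rewrite unlock; case: ifPn => [_|].
  by split => /ess_supP.
(* On a space of measure zero the norm is 0 by convention and every almost-everywhere statement
   holds. *)
rewrite -leNgt => mu0; split => // _.
exists setT; split => //.
by apply/eqP; rewrite eq_le mu0 measure_ge0.
Qed.

Lemma Lnormr_leP f (c : \bar R) (r : R) : (0 < r)%R -> 0 <= c ->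
  'N[mu]_r%:E[f] <= c <-> \int[mu]_x (`|f x| `^ r) <= c `^ r.
Proof.
move=> r0 c0; have I0 : 0 <= \int[mu]_x (`|f x| `^ r).
  by apply: integral_ge0 => x _; exact: poweR_ge0.
rewrite unlock; split => h.
  have := gt0_ler_poweR (ltW r0) _ _ h; rewrite !in_itv/= !leey !andbT.
  rewrite poweR_ge0 c0 -poweRrM mulVf ?gt_eqF// poweRe1//; exact.
have := gt0_ler_poweR (r := r^-1) _ _ _ h.
rewrite !in_itv/= !leey !andbT I0 poweR_ge0 -(poweRrM c) mulfV ?gt_eqF// poweRe1//.
by apply => //; rewrite invr_ge0 ltW.
Qed.

Lemma le_Lnorm (p : \bar R) f g : 1 <= p ->
  measurable_fun setT f -> measurable_fun setT g ->
  (forall x, `|f x| <= `|g x|) -> 'N[mu]_p[f] <= 'N[mu]_p[g].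
Proof.
case: p => [r| |//] p1 mf mg fg; last first.
  apply/Lnormy_leP; first exact: Lnorm_ge0.
  have := (Lnormy_leP g (Lnorm_ge0 mu +oo g)).1 (lexx _).
  by apply: filterS => x; exact: le_trans.
rewrite lee_fin in p1; have r0 : (0 < r)%R by rewrite (lt_le_trans _ p1).
apply/Lnormr_leP => //; first exact: Lnorm_ge0.
rewrite poweR_Lnorm ?gt_eqF//; apply: ge0_le_integral => //.
- by move=> x _; exact: poweR_ge0.
- by apply: (measurableT_comp (measurable_poweR _)); exact: measurableT_comp.
- by apply: (measurableT_comp (measurable_poweR _)); exact: measurableT_comp.
- move=> x _; apply: gt0_ler_poweR => //; first exact: ltW.
    by rewrite in_itv/= leey abse_ge0.
  by rewrite in_itv/= leey abse_ge0.
Qed.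

Lemma le_LnormZ (p : \bar R) f (k : R) : 1 <= p -> measurable_fun setT f ->
  (0 <= k)%R -> 'N[mu]_p[(fun x => k%:E * f x)] <= k%:E * 'N[mu]_p[f].
Proof.
case: p => [r| |//] p1 mf k0; last first.
  apply/Lnormy_leP; first by rewrite mule_ge0 ?lee_fin// Lnorm_ge0.
  have := (Lnormy_leP f (Lnorm_ge0 mu +oo f)).1 (lexx _).
  apply: filterS => x h; rewrite abseM gee0_abs ?lee_fin//.
  by rewrite lee_wpmul2l// lee_fin.
rewrite lee_fin in p1; have r0 : (0 < r)%R by rewrite (lt_le_trans _ p1).
apply/Lnormr_leP => //; first by rewrite mule_ge0 ?lee_fin// Lnorm_ge0.
rewrite poweRM ?lee_fin ?Lnorm_ge0// poweR_Lnorm ?gt_eqF//.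
rewrite -ge0_integralZl//.
- apply: ge0_le_integral => //.
  + by move=> x _; exact: poweR_ge0.
  + apply: (measurableT_comp (measurable_poweR _)); apply: measurableT_comp => //.
    exact: measurable_funeM.
  + apply: measurable_funeM.
    by apply: (measurableT_comp (measurable_poweR _)); exact: measurableT_comp.
  + by move=> x _; rewrite abseM poweRM// gee0_abs ?lee_fin.
- by apply: (measurableT_comp (measurable_poweR _)); exact: measurableT_comp.
- by move=> x _; exact: poweR_ge0.
- exact: poweR_ge0.
Qed.

End Lnorm_le.

Section Lnorm_param.
Context d1 d2 (X : measurableType d1) (Y : measurableType d2) {R : realType}.
Variable mu : {sigma_finite_measure set X -> \bar R}.
Local Open Scope ereal_scope.

(** The integral on the right depends measurably on a parameter and obeys Tonelli, which makes the
    exponent infinity accessible to the same tools as the finite ones. *)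
Lemma ae_le_int (f : X -> R) (c : R) : measurable_fun setT f ->
  (\forall x \ae mu, (f x <= c)%R) <->
  \int[mu]_x (Num.max (f x - c) 0)%:E = 0.
Proof.
move=> mf; have mm : measurable_fun setT (fun x => (Num.max (f x - c) 0)%:E).
  by apply/measurable_EFinP; apply: measurable_maxr => //; exact: measurable_funB.
have -> : \int[mu]_x (Num.max (f x - c) 0)%:E = \int[mu]_x `|(Num.max (f x - c) 0)%:E|.
  by apply: eq_integral => x _; rewrite gee0_abs// lee_fin le_max lexx orbT.
split => [h|/(ae_eq_integral_abs mu measurableT mm)].
  apply/(ae_eq_integral_abs mu measurableT mm).
  apply: filterS h => x h _ /=; congr (_%:E); apply/max_idPr.
  by rewrite subr_le0.
apply: filterS => x /(_ I) [/eqP]; rewrite eq_le => /andP[+ _].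
by rewrite ge_max subr_le0 => /andP[].
Qed.

Lemma measurable_Lnorm_param (p : \bar R) (H : X * Y -> R) : 1 <= p ->
  measurable_fun setT H -> (forall z, (0 <= H z)%R) ->
  measurable_fun setT (fun s => 'N[mu]_p[(fun x => (H (x, s))%:E)]).
Proof.
case: p => [r| |//] p1 mH H0.
  under eq_fun do rewrite unlock.
  apply: (measurableT_comp (measurable_poweR _)).
  pose F z := `|(H z)%:E| `^ r.
  apply: (measurable_fun_fubini_tonelli_G F) => [|z]; last exact: poweR_ge0.
  apply: (measurableT_comp (measurable_poweR _)); apply: measurableT_comp => //.
  exact/measurable_EFinP.
have mHs s : measurable_fun setT (fun x => H (x, s)).
  exact: measurableT_comp mH (measurable_pair2 _).
apply: (measurability _ (ErealGenOInfty.measurableE R)).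
move=> /= _ [_ [r ->] <-]; rewrite setTI.
have [r0|r0] := ltP r 0%R.
  rewrite (_ : _ @^-1` _ = setT)//; apply/seteqP; split => // s _ /=.
  by rewrite in_itv/= andbT (lt_le_trans _ (Lnorm_ge0 _ _ _)) ?lte_fin.
pose J s := \int[mu]_x (Num.max (H (x, s) - r) 0)%:E.
have mJ : measurable_fun setT J.
  apply: (measurable_fun_fubini_tonelli_G (fun z => (Num.max (H z - r) 0)%:E)).
    by apply/measurable_EFinP; apply: measurable_maxr => //; exact: measurable_funB.
  by move=> z; rewrite lee_fin le_max lexx orbT.
(* For r >= 0 the essential supremum is at most r exactly where [J] vanishes. *)
rewrite (_ : _ @^-1` _ = ~` (J @^-1` [set 0])); last first.
  apply/seteqP; split => s /=; rewrite in_itv/= andbT => h.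
    move=> /(ae_le_int r (mHs s)) h1; move: h; rewrite ltNge => /negP; apply.
    apply/Lnormy_leP; first by rewrite lee_fin.
    by apply: filterS h1 => x; rewrite gee0_abs lee_fin.
  rewrite ltNge; apply/negP => /(Lnormy_leP _ _ _) h1; apply: h.
  apply/(ae_le_int r (mHs s)).
  by move: h1; rewrite lee_fin => /(_ r0); apply: filterS => x; rewrite gee0_abs lee_fin.
apply: measurableC; rewrite -[X in measurable X]setTI.
exact: mJ.
Qed.

End Lnorm_param.

(** * Minkowski's integral inequality for exponents from 1 to infinity *)

Section minkowski_integral.
Context d1 d2 (X : measurableType d1) (Y : measurableType d2) {R : realType}.
Variable mu : {sigma_finite_measure set X -> \bar R}.
Variable nu : {sigma_finite_measure set Y -> \bar R}.
Local Open Scope ereal_scope.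

(* Hoelder's inequality with respect to the measure [W nu], applied to [H / W]. *)
Lemma minkowski_integral_gt0 (p : \bar R) (H : X * Y -> R) (W : Y -> R) :
  1 <= p -> measurable_fun setT H -> (forall z, (0 <= H z)%R) ->
  measurable_fun setT W -> (forall s, (0 < W s)%R) ->
  \int[nu]_s (W s)%:E < +oo ->
  (forall s, 'N[mu]_p[(fun x => (H (x, s))%:E)] <= (W s)%:E) ->
  'N[mu]_p[(fun x => \int[nu]_s (H (x, s))%:E)] <= \int[nu]_s (W s)%:E.
Proof.
move=> p1 mH H0 mW W0 Woo HW.
have mHs s : measurable_fun setT (fun x => H (x, s)).
  exact: measurableT_comp mH (measurable_pair2 _).
have mHx x : measurable_fun setT (fun s => H (x, s)).
  exact: measurableT_comp mH (measurable_pair1 _).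
have W0' s : 0 <= (W s)%:E by rewrite lee_fin ltW.
have O0 : 0 <= \int[nu]_s (W s)%:E by exact: integral_ge0.
have mHE : measurable_fun setT (fun z => (H z)%:E) by exact/measurable_EFinP.
have I0 x : 0 <= \int[nu]_s (H (x, s))%:E.
  by apply: integral_ge0 => s _; rewrite lee_fin.
case: p p1 HW => [r| |//] p1 HW; last first.
  apply/Lnormy_leP => //.
  have mm : measurable_fun setT (fun z => (Num.max (H z - W z.2) 0)%:E).
    apply/measurable_EFinP; apply: measurable_maxr => //; apply: measurable_funB => //.
    exact: measurableT_comp.
  have m0 z : 0 <= (Num.max (H z - W z.2) 0)%:E by rewrite lee_fin le_max lexx orbT.
  (* The excess of [H] over [W] vanishes for almost every x when s is fixed. By Tonelli its double
     integral is 0, so for almost every x its integral over s is 0. *)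
  pose J x := \int[nu]_s (Num.max (H (x, s) - W s) 0)%:E.
  have J0 : \int[mu]_x J x = 0.
    rewrite (fubini_tonelli (fun z => (Num.max (H z - W z.2) 0)%:E))//.
    apply: integral0_eq => s _ /=; apply: (ae_le_int mu (W s) (mHs s)).1.
    have /Lnormy_leP := HW s; move=> /(_ (W0' s)).
    by apply: filterS => x; rewrite gee0_abs lee_fin.
  have mJ : measurable_fun setT J.
    exact: (measurable_fun_fubini_tonelli_F (fun z => (Num.max (H z - W z.2) 0)%:E)).
  have J0' x : 0 <= J x by exact: integral_ge0.
  have : \int[mu]_x `|J x| = 0.
    by rewrite -J0; apply: eq_integral => x _; rewrite gee0_abs.
  move=> /(ae_eq_integral_abs mu measurableT mJ); apply: filterS => x /(_ I) Jx.
  rewrite gee0_abs//; apply: (@le_trans _ _ (\int[nu]_s (W s)%:E + J x)); last first.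
    by rewrite Jx adde0.
  rewrite /J -ge0_integralD//; last 2 first.
    exact/measurable_EFinP.
    exact: (measurableT_comp mm (measurable_pair1 x)).
  apply: ge0_le_integral => //.
  - by move=> s _; rewrite lee_fin.
  - exact/measurable_EFinP.
  - apply: emeasurable_funD; first exact/measurable_EFinP.
    exact: (measurableT_comp mm (measurable_pair1 x)).
  - move=> s _; rewrite -EFinD lee_fin -lerBlDl.
    by rewrite le_max lexx.
rewrite lee_fin in p1; have r0 : (0 < r)%R by rewrite (lt_le_trans _ p1).
(* The conjugate exponent used below is finite only for r > 1; for r = 1 Tonelli is enough. *)
have [r1|r1] := eqVneq r 1%R.
  rewrite r1 Lnorm1; under eq_integral do rewrite gee0_abs//.
  rewrite (fubini_tonelli (fun z => (H z)%:E))//.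
  apply: ge0_le_integral => //.
  - by move=> s _; apply: integral_ge0 => x _; rewrite lee_fin.
  - apply: (measurable_fun_fubini_tonelli_G (fun z => (H z)%:E)) => //.
  - exact/measurable_EFinP.
  - move=> s _; have := HW s; rewrite r1 Lnorm1.
    by under eq_integral do rewrite gee0_abs ?lee_fin//.
have {}r1 : (1 < r)%R by rewrite lt_neqAle eq_sym r1.
pose q := (r / (r - 1))%R.
have r10 : (0 < r - 1)%R by rewrite subr_gt0.
have q0 : (0 < q)%R by rewrite divr_gt0.
have rq : (r^-1 + q^-1 = 1)%R by rewrite /q; field; rewrite !gt_eqF.
have rdq : (r / q = r - 1)%R by rewrite /q; field; rewrite !gt_eqF.
(* Hoelder is applied to the product (H / v) v: the q-th power of v is [W], and the r-th power of H
   / v is [K], because r / q = r - 1. *)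
pose v s := (W s `^ q^-1)%R.
pose K z := (H z `^ r * (W z.2 `^ (r - 1))^-1)%R.
have v0 s : (0 < v s)%R by rewrite powR_gt0.
have mv : measurable_fun setT v by exact: (measurableT_comp (measurable_powR _)).
have K0 z : 0 <= (K z)%:E.
  by rewrite lee_fin mulr_ge0 ?powR_ge0// invr_ge0 powR_ge0.
have mwr : measurable_fun setT (fun s => (W s `^ (r - 1))^-1)%R.
  rewrite (_ : (fun _ => _) = (fun s => (W s `^ (- (r - 1)))%R)); last first.
    by apply/funext => s; rewrite powRN.
  exact: (measurableT_comp (measurable_powR _)).
have mK : measurable_fun setT (fun z => (K z)%:E).
  apply/measurable_EFinP; apply: measurable_funM.
    exact: (measurableT_comp (measurable_powR _)).
  exact: (measurableT_comp mwr).
set Om := \int[nu]_s (W s)%:E in O0 Woo *.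
have pt x : (\int[nu]_s (H (x, s))%:E) `^ r <= \int[nu]_s (K (x, s))%:E * Om `^ (r - 1).
  pose u s := (H (x, s) / v s)%R.
  have mu_ : measurable_fun setT u.
    apply: measurable_funM => //.
    rewrite (_ : (fun _ => _) = (fun s => (W s `^ (- q^-1))%R)); last first.
      by apply/funext => s; rewrite /v powRN.
    exact: (measurableT_comp (measurable_powR _)).
  have := hoelder nu mu_ mv r0 q0 rq.
  rewrite Lnorm1 (_ : \int[nu]_s `|(EFin \o (u \* v)%R) s| = \int[nu]_s (H (x, s))%:E); last first.
    apply: eq_integral => s _ /=; rewrite /u mulfVK ?gt_eqF//.
    by rewrite ger0_norm.
  move=> h; have := gt0_ler_poweR (ltW r0) _ _ h.
  rewrite !in_itv/= !leey !andbT I0 mule_ge0 ?Lnorm_ge0// => /(_ isT isT) {}h.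
  apply: (le_trans h); rewrite poweRM ?Lnorm_ge0// poweR_Lnorm ?gt_eqF//.
  rewrite (_ : \int[nu]_s (`|(EFin \o u) s| `^ r) = \int[nu]_s (K (x, s))%:E); last first.
    apply: eq_integral => s _ /=; congr (_%:E); rewrite /K/= /u.
    rewrite ger0_norm; last by rewrite divr_ge0// ltW.
    rewrite powRM//; last by rewrite invr_ge0 ltW.
    congr (_ * _)%R; rewrite -powR_inv1 ?ltW// -powRrM mulN1r powRN; congr (_^-1)%R.
    by rewrite /v -powRrM -rdq mulrC.
  rewrite unlock (_ : \int[nu]_s (`|(EFin \o v) s| `^ q) = Om).
    by rewrite -poweRrM mulrC rdq.
  apply: eq_integral => s _ /=; congr (_%:E).
  by rewrite ger0_norm ?(ltW (v0 _))// /v -powRrM mulVf ?gt_eqF// powRr1// ltW.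
apply/Lnormr_leP => //.
under eq_integral do rewrite gee0_abs//.
apply: (@le_trans _ _ (\int[mu]_x (\int[nu]_s (K (x, s))%:E * Om `^ (r - 1)))).
  have mI : measurable_fun setT (fun x => \int[nu]_s (H (x, s))%:E).
    apply: (measurable_fun_fubini_tonelli_F (fun z => (H z)%:E)) => //.
  apply: ge0_le_integral => //.
  - by move=> x _; exact: poweR_ge0.
  - exact: (measurableT_comp (measurable_poweR _)).
  - apply: emeasurable_funM => //.
    exact: (measurable_fun_fubini_tonelli_F (fun z => (K z)%:E)).
have mFK : measurable_fun setT (fun x => \int[nu]_s (K (x, s))%:E).
  exact: (measurable_fun_fubini_tonelli_F (fun z => (K z)%:E)).
rewrite ge0_integralZr//; last 2 first.
- by move=> x _; exact: integral_ge0.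
- exact: poweR_ge0.
rewrite (fubini_tonelli (fun z => (K z)%:E))//.
(* The hypothesis bounds the integral of H^r by W^r, and dividing by W^(r-1) leaves W. *)
have KW s : \int[mu]_x (K (x, s))%:E <= (W s)%:E.
  rewrite /K/=; under eq_integral do rewrite EFinM.
  rewrite ge0_integralZr//; last 3 first.
  - by apply/measurable_EFinP; exact: (measurableT_comp (measurable_powR _)).
  - by move=> x _; rewrite lee_fin powR_ge0.
  - by rewrite lee_fin invr_ge0 powR_ge0.
  have /(Lnormr_leP _ _ r0 (W0' s)) := HW s.
  under eq_integral do rewrite gee0_abs ?lee_fin//=.
  move=> h; apply: (@le_trans _ _ ((W s `^ r)%R%:E * ((W s `^ (r - 1))^-1)%R%:E)).
    by apply: lee_wpmul2r => //; rewrite lee_fin invr_ge0 powR_ge0.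
  rewrite -EFinM -powRN -powRD; last by rewrite (gt_eqF (W0 s)) implybT.
  by rewrite opprB addrC subrK powRr1// ltW.
have -> : Om `^ r = Om * Om `^ (r - 1).
  have e1 : (1 + (r - 1) = r)%R by rewrite addrC subrK.
  have E : Om `^ (1 + (r - 1)) = Om `^ 1 * Om `^ (r - 1).
    by apply: poweRD; rewrite /poweRD_def e1 gt_eqF.
  by rewrite e1 in E; rewrite E poweRe1.
rewrite lee_wpmul2r ?poweR_ge0//; apply: ge0_le_integral => //.
- by move=> s _; apply: integral_ge0.
- exact: (measurable_fun_fubini_tonelli_G (fun z => (K z)%:E)).
- exact/measurable_EFinP.
Qed.

(** Reduction to a finite and positive majorant. If [W] is integrable it is finite off a null set,
    where [H] may be replaced by 0; adding a small multiple of [rho] then makes it positive at an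
    arbitrarily small cost. *)
Lemma minkowski_integral (p : \bar R) (H : X * Y -> R) (W : Y -> \bar R)
    (rho : Y -> R) : 1 <= p -> measurable_fun setT H -> (forall z, (0 <= H z)%R) ->
  measurable_fun setT W ->
  (forall s, 'N[mu]_p[(fun x => (H (x, s))%:E)] <= W s) ->
  measurable_fun setT rho -> (forall s, (0 < rho s)%R) ->
  \int[nu]_s (rho s)%:E < +oo ->
  'N[mu]_p[(fun x => \int[nu]_s (H (x, s))%:E)] <= \int[nu]_s W s.
Proof.
move=> p1 mH H0 mW HW mrho rho0 rhooo.
have p0 : p != 0 by rewrite gt_eqF// (lt_le_trans _ p1).
have W0 s : 0 <= W s by rewrite (le_trans _ (HW s))// Lnorm_ge0.
have := leey (\int[nu]_s W s); rewrite le_eqVlt => /orP[/eqP ->|Woo].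
  by rewrite leey.
have iW : nu.-integrable setT W.
  by apply/integrableP; split => //; under eq_integral do rewrite gee0_abs//.
have Wfin := integrable_ae measurableT iW.
pose W' s := fine (W s).
pose H' z := (H z * (W z.2 != +oo%E)%:R)%R.
have W'0 s : (0 <= W' s)%R by exact: fine_ge0.
have mW' : measurable_fun setT W' by exact: (measurableT_comp (fine_measurable measurableT)).
have mind : measurable_fun setT (fun s => ((W s != +oo%E)%:R : R)).
  rewrite (_ : (fun _ => _) = \1_(W @^-1` (~` [set +oo]))).
    apply: measurable_indic; rewrite -[X in measurable X]setTI; apply: mW => //.
    exact: measurableC.
  by apply/funext => s; rewrite indicE; congr (_%:R); congr nat_of_bool;
    apply/idP/idP; rewrite inE /= => /eqP.
have mH' : measurable_fun setT H'.
  apply: measurable_funM => //; exact: (measurableT_comp mind).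
have H'0 z : (0 <= H' z)%R by rewrite mulr_ge0.
have mHs (G : X * Y -> R) s : measurable_fun setT G -> measurable_fun setT (fun x => (G (x, s))%:E).
  by move=> mG; apply/measurable_EFinP; exact: measurableT_comp mG (measurable_pair2 _).
have mHx (G : X * Y -> R) x : measurable_fun setT G -> measurable_fun setT (fun s => (G (x, s))%:E).
  by move=> mG; apply/measurable_EFinP; exact: measurableT_comp mG (measurable_pair1 _).
have IE x : \int[nu]_s (H (x, s))%:E = \int[nu]_s (H' (x, s))%:E.
  apply: ae_eq_integral => //; [exact: mHx|exact: mHx|].
  apply: filterS Wfin => s /(_ I) Ws _; rewrite /H'/= (_ : W s != +oo) ?mulr1//.
  by apply: contraTN Ws => /eqP ->.
have WE : \int[nu]_s W s = \int[nu]_s (W' s)%:E.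
  apply: ae_eq_integral => //; first exact/measurable_EFinP.
  by apply: filterS Wfin => s /(_ I) Ws _; rewrite fineK.
rewrite (eq_Lnorm _ _ IE) WE; apply/lee_addgt0Pr => e e0.
pose Om := fine (\int[nu]_s (rho s)%:E).
have OmE : \int[nu]_s (rho s)%:E = Om%:E.
  rewrite fineK// ge0_fin_numE//; apply: integral_ge0 => s _.
  by rewrite lee_fin ltW.
have Om0 : (0 <= Om)%R.
  by rewrite fine_ge0//; apply: integral_ge0 => s _; rewrite lee_fin ltW.
(* The added mass d Om is at most e; the 1 keeps the denominator positive. *)
pose d := (e / (1 + Om))%R.
have d0 : (0 < d)%R by rewrite divr_gt0// ltr_pwDl.
have mW2 : measurable_fun setT (fun s => W' s + d * rho s)%R.
  by apply: measurable_funD => //; exact: measurable_funM.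
have IW2 : \int[nu]_s (W' s + d * rho s)%:E <= \int[nu]_s (W' s)%:E + e%:E.
  under eq_integral do rewrite EFinD.
  rewrite ge0_integralD//.
  - rewrite leeD2l//; under eq_integral do rewrite EFinM.
    rewrite ge0_integralZl//.
    + rewrite OmE -EFinM lee_fin /d mulrAC ler_pdivrMr ?ltr_pwDl//.
      by apply: ler_wpM2l; [exact: ltW|rewrite lerDr].
    + exact/measurable_EFinP.
    + by move=> s _; rewrite lee_fin ltW.
    + by rewrite lee_fin ltW.
  - by move=> s _; rewrite lee_fin.
  - exact/measurable_EFinP.
  - by move=> s _; rewrite lee_fin mulr_ge0// ltW.
  - by apply/measurable_EFinP; exact: measurable_funM.
apply: le_trans (IW2).
apply: (@minkowski_integral_gt0 p H' (fun s => W' s + d * rho s)%R) => //.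
- by move=> s; rewrite ltr_wpDl// mulr_gt0.
- by apply: le_lt_trans IW2 _; rewrite -WE lte_add_pinfty// ltry.
- move=> s; apply: (@le_trans _ _ (W' s)%:E); last first.
    by rewrite lee_fin lerDl mulr_ge0// ltW.
  rewrite /W' /H'/=; have [Ws|Ws] := eqVneq (W s) +oo.
    rewrite Ws/=; under eq_Lnorm do rewrite mulr0.
    by rewrite Lnorm0.
  rewrite fineK ?ge0_fin_numE ?ltey//.
  by under eq_Lnorm do rewrite mulr1.
Qed.

End minkowski_integral.

Section sigma_finite_product.
Context {d1 d2 : measure_display} {T1 : measurableType d1} {T2 : measurableType d2}.
Context {R : realType}.
Variables (m1 : {sigma_finite_measure set T1 -> \bar R}).
Variables (m2 : {sigma_finite_measure set T2 -> \bar R}).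

(* The product of two sigma-finite measures is sigma-finite; the alias is there
   because the library's canonical instance on [m1 \x m2] only applies to
   subprobabilities. *)
Definition sf_prod : set (T1 * T2) -> \bar R := (m1 \x m2)%E.

HB.instance Definition _ := Measure.copy sf_prod (m1 \x m2)%E.

Let sf_prod_sigma_finite : sigma_finite setT sf_prod.
Proof.
have /sigma_finiteP[F [TF ndF Foo]] := sigma_finiteT m1.
have /sigma_finiteP[G [TG ndG Goo]] := sigma_finiteT m2.
exists (fun n => F n `*` G n).
  rewrite -setXTT TF TG; apply/seteqP; split => [[x y]|[x y]].
    move=> [/= [n _ Fnx] [k _ Gky]]; exists (maxn n k) => //; split.
    - by move: x Fnx; exact/subsetPset/ndF/leq_maxl.
    - by move: y Gky; exact/subsetPset/ndG/leq_maxr.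
  by move=> [n _ []/= ? ?]; split; exists n.
move=> k; have [? ?] := Foo k; have [? ?] := Goo k.
split; first exact: measurableX.
by rewrite [X in (X < _)%E]product_measure1E// lte_mul_pinfty// ge0_fin_numE.
Qed.

HB.instance Definition _ := Measure_isSigmaFinite.Build _ _ _ sf_prod sf_prod_sigma_finite.

End sigma_finite_product.

(** * Young's inequality in mixed norms *)

Section young.
Context {R : realType} (N M : nat).
Local Notation muN := (lebesgue_rV R N).
Local Notation muM := (lebesgue_rV R M).
Local Open Scope ereal_scope.

Lemma ge0_Lnorm_shift K (p : \bar R) (a : 'rV[R]_K) (f : 'rV[R]_K -> \bar R) : 1 <= p ->
  measurable_fun setT f ->
  'N[lebesgue_rV R K]_p[(fun x => f (x + a)%R)] <= 'N[lebesgue_rV R K]_p[f].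
Proof.
case: p => [r| |//] p1 mf; last first.
  apply/Lnormy_leP; first exact: Lnorm_ge0.
  have := (Lnormy_leP (lebesgue_rV R K) f (Lnorm_ge0 _ +oo f)).1 (lexx _).
  move=> [A [mA A0 AE]]; exists ((fun v => v + a)%R @^-1` A); split.
  - by rewrite -[X in measurable X]setTI; exact: measurable_rV_shift.
  - by rewrite -A0; exact: lebesgue_rV_shift.
  - by move=> x h; apply: AE.
rewrite lee_fin in p1; have r0 : (0 < r)%R by rewrite (lt_le_trans _ p1).
apply/Lnormr_leP => //; first exact: Lnorm_ge0.
rewrite poweR_Lnorm ?gt_eqF//.
rewrite (ge0_integral_rV_shift a (f := fun v => `|f v| `^ r))//.
  by apply: (measurableT_comp (measurable_poweR _)); exact: measurableT_comp.
by move=> v; exact: poweR_ge0.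
Qed.

Lemma Lnorm_lty_ae (p : \bar R) K (f : 'rV[R]_K -> \bar R) : 1 <= p ->
  measurable_fun setT f -> 'N[lebesgue_rV R K]_p[f] < +oo ->
  \forall x \ae (lebesgue_rV R K), `|f x| < +oo.
Proof.
case: p => [r| |//] p1 mf foo; last first.
  have := (Lnormy_leP (lebesgue_rV R K) f (Lnorm_ge0 _ +oo f)).1 (lexx _).
  by apply: filterS => x h; exact: le_lt_trans h foo.
rewrite lee_fin in p1; have r0 : (0 < r)%R by rewrite (lt_le_trans _ p1).
have I : (lebesgue_rV R K).-integrable setT (fun x => `|f x| `^ r).
  apply/integrableP; split.
    by apply: (measurableT_comp (measurable_poweR _)); exact: measurableT_comp.
  under eq_integral do rewrite gee0_abs ?poweR_ge0//.
  by rewrite -poweR_Lnorm ?gt_eqF//; exact: poweR_lty.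
have := integrable_ae measurableT I; apply: filterS => x /(_ Logic.I).
rewrite ge0_fin_numE ?poweR_ge0//; case: (f x) => [?| |] /=; rewrite ?ltry//.
  by rewrite gt_eqF// ltxx.
by rewrite gt_eqF// ltxx.
Qed.

(* Minkowski's inequality in each variable: the [L^{p,q}]-norm is translation
   invariant and hence non-increasing under averaging against [k]. *)
Lemma young_mixed (p q : \bar R) (A k B : 'rV[R]_N * 'rV[R]_M -> R) :
  1 <= p -> 1 <= q ->
  measurable_fun setT A -> (forall z, (0 <= A z)%R) ->
  measurable_fun setT k -> (forall z, (0 < k z)%R) ->
  \int[muN \x muM]_z (k z)%:E < +oo ->
  'N[muM]_q[(fun eta => 'N[muN]_p[(fun xi => (A (xi, eta))%:E)])] < +oo ->
  measurable_fun setT B -> (forall z, (0 <= B z)%R) ->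
  (forall z, (B z)%:E <= \int[muN \x muM]_w (k w * A (z.1 + w.1, z.2 + w.2))%:E) ->
  'N[muM]_q[(fun eta => 'N[muN]_p[(fun xi => (B (xi, eta))%:E)])] < +oo.
Proof.
move=> p1 q1 mA A0 mk k0 koo Aoo mB B0 BA.
pose h eta := 'N[muN]_p[(fun xi => (A (xi, eta))%:E)].
have mh : measurable_fun setT h by exact: measurable_Lnorm_param.
have h0 eta : 0 <= h eta by exact: Lnorm_ge0.
(* Minkowski's inequality takes a real-valued integrand, whereas [h] may be infinite on a null
   set. *)
pose h' eta := fine (h eta).
have mh' : measurable_fun setT h' by exact: (measurableT_comp (fine_measurable measurableT)).
have h'0 eta : (0 <= h' eta)%R by exact: fine_ge0.
have mkE : measurable_fun setT (fun z => (k z)%:E) by exact/measurable_EFinP.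
have k0E z : 0 <= (k z)%:E by rewrite lee_fin ltW.
have maddM (K : nat) : measurable_fun setT (fun z : 'rV[R]_K * 'rV[R]_K => (z.1 + z.2)%R).
  apply/measurable_fun_rVP => i.
  rewrite (_ : _ \o _ = (fun z : 'rV[R]_K * 'rV[R]_K => (rV_coord i z.1 : R) + (rV_coord i z.2 : R)))%R.
    apply: measurable_funD.
      exact: (measurableT_comp (measurable_rV_coord i)).
    exact: (measurableT_comp (measurable_rV_coord i)).
  by apply/funext => z; rewrite /rV_coord/= mxE.
have mG0 : measurable_fun setT
    (fun z : ('rV[R]_N * 'rV[R]_M) * ('rV[R]_N * 'rV[R]_M) =>
     k z.2 * A (z.1.1 + z.2.1, z.1.2 + z.2.2))%R.
  apply: measurable_funM; first exact: (measurableT_comp mk).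
  apply: (measurableT_comp mA); apply: measurable_fun_pair.
    apply: (measurableT_comp (maddM N) (g := fun z : ('rV[R]_N * 'rV[R]_M) * ('rV[R]_N * 'rV[R]_M) => (z.1.1, z.2.1))).
    apply: measurable_fun_pair; first exact: (measurableT_comp measurable_fst).
    exact: (measurableT_comp measurable_fst).
  apply: (measurableT_comp (maddM M) (g := fun z : ('rV[R]_N * 'rV[R]_M) * ('rV[R]_N * 'rV[R]_M) => (z.1.2, z.2.2))).
  apply: measurable_fun_pair; first exact: (measurableT_comp measurable_snd).
  exact: (measurableT_comp measurable_snd).
pose G (z : 'rV[R]_N * 'rV[R]_M) := \int[muN \x muM]_w (k w * A (z.1 + w.1, z.2 + w.2))%:E.
have mG : measurable_fun setT G.
  have F0 (z : ('rV[R]_N * 'rV[R]_M) * ('rV[R]_N * 'rV[R]_M)) :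
      0 <= (k z.2 * A (z.1.1 + z.2.1, z.1.2 + z.2.2))%:E.
    by rewrite lee_fin mulr_ge0// ltW.
  have /measurable_EFinP mG0E := mG0.
  exact: (@measurable_fun_fubini_tonelli_F _ _ _ _ _ (sf_prod muN muM) _ mG0E F0).
pose I2 eta := \int[muN \x muM]_w (k w * h' (eta + w.2))%:E.
have mkh : measurable_fun setT (fun z : 'rV[R]_M * ('rV[R]_N * 'rV[R]_M) =>
     (k z.2 * h' (z.1 + z.2.2)))%R.
  apply: measurable_funM; first exact: (measurableT_comp mk).
  apply: (measurableT_comp mh').
  apply: (measurableT_comp (maddM M) (g := fun z : 'rV[R]_M * ('rV[R]_N * 'rV[R]_M) => (z.1, z.2.2))).
  apply: measurable_fun_pair => //; exact: (measurableT_comp measurable_snd).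
have mI2 : measurable_fun setT I2.
  have F0 (z : 'rV[R]_M * ('rV[R]_N * 'rV[R]_M)) : 0 <= (k z.2 * h' (z.1 + z.2.2))%:E.
    by rewrite lee_fin mulr_ge0// ltW.
  have /measurable_EFinP mkhE := mkh.
  exact: (@measurable_fun_fubini_tonelli_F _ _ _ _ _ (sf_prod muN muM) _ mkhE F0).
have hfin := Lnorm_lty_ae q1 mh Aoo.
(* Minkowski in the first variable with eta fixed: the shift by w.1 is absorbed by the norm, the one
   by w.2 survives as a shift of [h]. *)
have step1 eta : 'N[muN]_p[(fun xi => G (xi, eta))] <= I2 eta.
  have mAe w2 : measurable_fun setT (fun xi => (A (xi, w2))%:E).
    by apply/measurable_EFinP; exact: measurableT_comp mA (measurable_pair2 _).
  have mkhe : measurable_fun setT (fun w : 'rV[R]_N * 'rV[R]_M => (k w)%:E * h (eta + w.2)%R).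
    apply: emeasurable_funM => //.
    apply: (measurableT_comp mh); apply: (measurableT_comp (maddM M) (g := fun w : 'rV[R]_N * 'rV[R]_M => (eta, w.2))).
    by apply: measurable_fun_pair.
  (* The exceptional w lie in the whole space times a translate of a null set, which is null for the
     product measure. *)
  rewrite (_ : I2 eta = \int[muN \x muM]_w ((k w)%:E * h (eta + w.2)%R)); last first.
    apply: ae_eq_integral => //.
      apply/measurable_EFinP.
      exact: (measurableT_comp mkh (measurable_pair1 eta)).
    case: hfin => D [mD D0 DE].
    exists (setT `*` ((fun v => v + eta)%R @^-1` D)); split.
    - apply: measurableX => //; rewrite -[X in measurable X]setTI.
      exact: measurable_rV_shift.
    - have mD' : measurable ((fun v => v + eta)%R @^-1` D).
        by rewrite -[X in measurable X]setTI; exact: measurable_rV_shift.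
      apply: etrans (product_measure1E muN muM measurableT mD') _.
      by rewrite [X in _ * X](lebesgue_rV_shift _ mD) D0 mule0.
    - move=> w /= nh; split => //=; apply: DE => /= hw; apply: nh => _.
      rewrite EFinM /h' fineK// ge0_fin_numE// addrC.
      by move: hw; rewrite gee0_abs.
  apply: (minkowski_integral (nu := sf_prod muN muM) (H := fun z : 'rV[R]_N * ('rV[R]_N * 'rV[R]_M) =>
     (k z.2 * A (z.1 + z.2.1, eta + z.2.2))%R) (rho := k)) => //.
  - apply: (measurableT_comp mG0 (g := fun z : 'rV[R]_N * ('rV[R]_N * 'rV[R]_M) => ((z.1, eta), z.2))).
    by apply: measurable_fun_pair => //; apply: measurable_fun_pair.
  - by move=> z; rewrite mulr_ge0// ltW.
  - move=> w /=; under eq_Lnorm do rewrite EFinM.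
    apply: (le_trans (le_LnormZ _ p1 _ (ltW (k0 w)))).
      exact: (measurableT_comp (mAe (eta + w.2)%R) (measurable_rV_shift _)).
    rewrite lee_wpmul2l//.
    exact: (ge0_Lnorm_shift w.1 p1 (mAe (eta + w.2)%R)).
have G0 z : 0 <= G z.
  by apply: integral_ge0 => w _; rewrite lee_fin mulr_ge0// ltW.
apply: (@le_lt_trans _ _ ('N[muM]_q[I2])).
  apply: le_Lnorm => //; first exact: measurable_Lnorm_param.
  move=> eta; rewrite !gee0_abs ?Lnorm_ge0//.
    apply: le_trans (step1 eta); apply: le_Lnorm => //.
    - by apply/measurable_EFinP; exact: measurableT_comp mB (measurable_pair2 _).
    - exact: measurableT_comp mG (measurable_pair2 _).
    - by move=> xi; rewrite !gee0_abs ?lee_fin//; exact: BA.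
  by apply: integral_ge0 => w _; rewrite lee_fin mulr_ge0// ltW.
(* Minkowski in the second variable absorbs the remaining shift, after which only the mass of [k] is
   left. *)
pose W w := (k w)%:E * 'N[muM]_q[h].
apply: (@le_lt_trans _ _ (\int[muN \x muM]_w W w)).
  apply: (minkowski_integral (nu := sf_prod muN muM) (H := fun z : 'rV[R]_M * ('rV[R]_N * 'rV[R]_M) =>
     (k z.2 * h' (z.1 + z.2.2))%R) (rho := k)) => //.
  - by move=> z; rewrite mulr_ge0// ltW.
  - apply: emeasurable_funM => //.
  - move=> w /=; under eq_Lnorm do rewrite EFinM.
    have mh'E : measurable_fun setT (EFin \o h') by exact/measurable_EFinP.
    apply: (le_trans (le_LnormZ _ q1 _ (ltW (k0 w)))).
      exact: (measurableT_comp mh'E (measurable_rV_shift _)).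
    rewrite lee_wpmul2l//.
    apply: (le_trans (ge0_Lnorm_shift w.2 q1 mh'E)).
    apply: le_Lnorm => // eta; rewrite !gee0_abs ?lee_fin//.
    rewrite /h' /=; have := h0 eta; case: (h eta) => //= y _; rewrite ?leey//.
rewrite /W ge0_integralZr//; last exact: Lnorm_ge0.
apply: lte_mul_pinfty => //; first by apply: integral_ge0.
by rewrite ge0_fin_numE//; apply: integral_ge0.
Qed.

End young.

(** * Gaussians on row vectors *)

Section measurable_rV_ops.
Context d (T : measurableType d) {R : realType}.

Lemma measurable_rV_entry m (f : T -> 'rV[R]_m) i : measurable_fun setT f ->
  measurable_fun setT (fun x => f x ord0 i).
Proof. by move=> mf; exact: (measurableT_comp (measurable_rV_coord i) mf). Qed.

Lemma measurable_rV_mk m (f : T -> 'rV[R]_m) :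
  (forall i, measurable_fun setT (fun x => f x ord0 i)) -> measurable_fun setT f.
Proof. by move=> mf; apply/measurable_fun_rVP => i; exact: mf. Qed.

Lemma measurable_rVD m (f g : T -> 'rV[R]_m) : measurable_fun setT f ->
  measurable_fun setT g -> measurable_fun setT (fun x => f x + g x).
Proof.
move=> mf mg; apply: measurable_rV_mk => i; under eq_fun do rewrite mxE.
by apply: measurable_funD; exact: measurable_rV_entry.
Qed.

Lemma measurable_rVZ m (a : R) (f : T -> 'rV[R]_m) : measurable_fun setT f ->
  measurable_fun setT (fun x => a *: f x).
Proof.
move=> mf; apply: measurable_rV_mk => i; under eq_fun do rewrite mxE.
by apply: measurable_funM => //; exact: measurable_rV_entry.
Qed.

Lemma measurable_rVB m (f g : T -> 'rV[R]_m) : measurable_fun setT f ->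
  measurable_fun setT g -> measurable_fun setT (fun x => f x - g x).
Proof.
move=> mf mg; under eq_fun do rewrite -scaleN1r.
by apply: measurable_rVD => //; exact: measurable_rVZ.
Qed.

Lemma measurable_lsubmx m (f : T -> 'rV[R]_(m + m)) : measurable_fun setT f ->
  measurable_fun setT (fun x => lsubmx (f x)).
Proof.
move=> mf; apply: measurable_rV_mk => i; under eq_fun do rewrite mxE.
exact: measurable_rV_entry.
Qed.

Lemma measurable_rsubmx m (f : T -> 'rV[R]_(m + m)) : measurable_fun setT f ->
  measurable_fun setT (fun x => rsubmx (f x)).
Proof.
move=> mf; apply: measurable_rV_mk => i; under eq_fun do rewrite mxE.
exact: measurable_rV_entry.
Qed.

Lemma measurable_row_mx m (f g : T -> 'rV[R]_m) : measurable_fun setT f ->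
  measurable_fun setT g -> measurable_fun setT (fun x => row_mx (f x) (g x)).
Proof.
move=> mf mg; apply: measurable_rV_mk => i; under eq_fun do rewrite mxE.
by case: fintype.split => j; exact: measurable_rV_entry.
Qed.

Lemma measurable_dot m (f g : T -> 'rV[R]_m) : measurable_fun setT f ->
  measurable_fun setT g -> measurable_fun setT (fun x => dot (f x) (g x)).
Proof.
move=> mf mg; apply: measurable_sum => i.
by apply: measurable_funM; exact: measurable_rV_entry.
Qed.

Lemma measurable_expR_comp (f : T -> R) : measurable_fun setT f ->
  measurable_fun setT (fun x => expR (f x)).
Proof. by move=> mf; apply: measurableT_comp => //; exact: measurable_expR. Qed.

End measurable_rV_ops.

Section dot_theory.
Context {K : comPzRingType} {m : nat}.
Implicit Types (x y z : 'rV[K]_m) (a : K).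

Lemma dotC x y : dot x y = dot y x.
Proof. by apply: eq_bigr => i _; rewrite mulrC. Qed.

Lemma dotDl x y z : dot (x + y) z = dot x z + dot y z.
Proof. by rewrite -big_split; apply: eq_bigr => i _; rewrite mxE mulrDl. Qed.

Lemma dotZl a x z : dot (a *: x) z = a * dot x z.
Proof. by rewrite mulr_sumr; apply: eq_bigr => i _; rewrite mxE mulrA. Qed.

Lemma dotDr x y z : dot z (x + y) = dot z x + dot z y.
Proof. by rewrite !(dotC z) dotDl. Qed.

Lemma dotZr a x z : dot z (a *: x) = a * dot z x.
Proof. by rewrite !(dotC z) dotZl. Qed.

Lemma dotNl x z : dot (- x) z = - dot x z.
Proof. by rewrite -scaleN1r dotZl mulN1r. Qed.

Lemma dotNr x z : dot z (- x) = - dot z x.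
Proof. by rewrite !(dotC z) dotNl. Qed.

End dot_theory.

Section gaussv.
Context {R : realType} {N : nat}.
Implicit Types (b : R) (v w : 'rV[R]_N).
Local Notation mu := (lebesgue_rV R N).

Lemma dot_ge0 v : 0 <= dot v v.
Proof. by apply: sumr_ge0 => i _; rewrite -expr2 sqr_ge0. Qed.

Lemma dot_entry_le v i : v ord0 i ^+ 2 <= dot v v.
Proof.
by rewrite /dot (bigD1 i)//= -expr2 lerDl sumr_ge0// => j _; rewrite -expr2 sqr_ge0.
Qed.

Definition gaussv b v := expR (- (b * dot v v)).

Lemma gaussv_ge0 b v : 0 <= gaussv b v. Proof. exact: expR_ge0. Qed.

Lemma gaussv_gt0 b v : 0 < gaussv b v. Proof. exact: expR_gt0. Qed.

Lemma gaussvE b v : gaussv b v = \prod_i gauss b (v ord0 i).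
Proof.
rewrite /gaussv /dot mulr_sumr -sumrN expR_sum.
by apply: eq_bigr => i _; rewrite /gauss expr2.
Qed.

Lemma measurable_gaussv b : measurable_fun setT (gaussv b).
Proof.
apply: measurable_expR_comp; apply: measurableT_comp => //.
by apply: measurable_funM => //; exact: measurable_dot.
Qed.

Lemma cint_gaussv b k w : 0 < b ->
  cintegrable mu (fun v => (gaussv b v)%:C * cexp (0 +i* (k * dot v w))) /\
  cint mu (fun v => (gaussv b v)%:C * cexp (0 +i* (k * dot v w))) =
  (Num.sqrt (pi / b) ^+ N * gaussv (4 * b)^-1 (k *: w))%:C.
Proof.
move=> b0.
pose h (i : 'I_N) (y : R) := (gauss b y)%:C * cexp (0 +i* (y * (k * w ord0 i))).
have hE : (fun v => (gaussv b v)%:C * cexp (0 +i* (k * dot v w))) =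
          (fun v : 'rV[R]_N => \prod_i h i (v ord0 i)).
  apply/funext => v; rewrite /h big_split/= gaussvE rmorph_prod; congr (_ * _).
  have -> : k * dot v w = \sum_i v ord0 i * (k * w ord0 i).
    by rewrite mulr_sumr; apply: eq_bigr => i _; ring.
  elim/big_rec2 : _ => [|i x y _ IH]; first by rewrite cexp0.
  by rewrite -IH -cexpD; congr cexp; simpc.
have [cI cE] := cint_prod_rV (h := h) (fun i => (cint_gauss (k * w ord0 i) b0).1).
rewrite hE; split => //; rewrite cE.
under eq_bigr => i _ do rewrite /h (cint_gauss (k * w ord0 i) b0).2.
rewrite -rmorph_prod big_split/= prodr_const card_ord gaussvE; congr ((_ * _)%:C).
by apply: eq_bigr => i _; rewrite mxE.
Qed.

Lemma gaussv_integral b : 0 < b -> mu.-integrable setT (EFin \o gaussv b) /\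
  \int[mu]_v gaussv b v = Num.sqrt (pi / b) ^+ N.
Proof.
move=> b0; have [cI cE] := cint_gaussv 0 0 b0.
have E : (fun v : 'rV[R]_N => (gaussv b v)%:C * cexp (0 +i* (0 * dot v 0))) =
         (fun v => (gaussv b v)%:C).
  by apply/funext => v; rewrite mul0r (_ : 0 +i* 0 = 0)// cexp0 mulr1.
rewrite E in cI cE; split; first exact: (cintegrable_Re cI).
move: cE; rewrite cint_real => -[->]; rewrite /gaussv dotZl mul0r mulr0 oppr0 expR0.
by rewrite mulr1.
Qed.

Lemma integrable_gaussv b : 0 < b -> mu.-integrable setT (EFin \o gaussv b).
Proof. by move=> /gaussv_integral[]. Qed.

End gaussv.

(** * Schwartz functions *)

Section continuous_measurable_rV.
Context {R : realType} {N : nat}.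

Lemma rV_entry_continuous (i : 'I_N) : continuous (fun v : 'rV[R]_N => v ord0 i).
Proof. exact: coord_continuous. Qed.

(** The sigma-algebra is generated by the coordinates, so an open set has to be exhibited as a
    countable union of boxes; those with rational centres and half-sides 1/(k+1) suffice. *)
Lemma continuous_measurable_rV (f : 'rV[R]_N -> R) : continuous f ->
  measurable_fun setT f.
Proof.
move=> cf; apply: (measurability _ (RGenOpens.measurableE R)).
move=> /= _ [A [a [b AE]] <-]; rewrite setTI.
set U := f @^-1` A.
have oU : open U.
  apply: open_comp => [x _|]; first exact: cf.
  by rewrite AE; exact: interval_open.
pose box (z : 'rV[rat]_N * nat) := [set v : 'rV[R]_N |
  forall i, (ball (ratr (z.1 ord0 i) : R) (z.2.+1%:R^-1)) (v ord0 i)].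
have mbox z : measurable (box z).
  apply: (@measurable_rV_box R N (fun i => ball (ratr (z.1 ord0 i) : R) (z.2.+1%:R^-1))) => i.
  exact: measurable_ball.
rewrite (_ : U = \bigcup_z (if `[< box z `<=` U >] then box z else set0)).
  apply: countable_bigcupT_measurable => [|z]; first exact: countableP.
  by case: ifPn.
apply/seteqP; split => [v Uv|v [z _]]; last by case: ifPn => // /asboolP; apply.
have /nbhs_ballP[e /= e0 eU] : nbhs v U by exact: open_nbhs_nbhs.
have [k ke] : exists k : nat, k.+1%:R^-1 < e / 2.
  have e20 : 0 < e / 2 by rewrite divr_gt0.
  exists (Num.bound (e / 2)^-1).
  rewrite -[ltRHS]invrK ltf_pV2 ?posrE ?invr_gt0//.
  rewrite (lt_trans (archi_boundP _)) ?invr_ge0 ?ltW// ?ltr_nat//.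
have rk i : exists q : rat, ball (v ord0 i) (k.+1%:R^-1) (ratr q : R).
  have k0 : 0 < k.+1%:R^-1 :> R by rewrite invr_gt0.
  have B0 : ball (v ord0 i) (k.+1%:R^-1) !=set0 by exists (v ord0 i); exact: ballxx.
  have [x [Bx [q _ qx]]] := @dense_rat R _ B0 (ball_open _ _).
  by exists q; rewrite qx.
have [q qP] := choice rk.
exists (\row_i q i, k) => //.
have bv : box (\row_i q i, k) v by move=> i /=; rewrite mxE; apply: ball_sym; exact: qP.
case: ifPn => // /asboolPn; case => w bw; apply: eU.
split => // i j; rewrite (ord1 i); have := bw j; rewrite /= mxE => qw.
by rewrite (splitr e); apply: (ball_triangle (le_ball (ltW ke) (qP j)) (le_ball (ltW ke) qw)).
Qed.

End continuous_measurable_rV.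

Section derive_rV.
Context {R : realType} {N : nat}.
Implicit Types (x v : 'rV[R]_N) (f : 'rV[R]_N -> R).

(** Reduces directional derivatives to derivatives on the line, where the chain rule is applied. *)
Lemma is_derive_line f x v df :
  is_derive x v f df <-> is_derive (0 : R) 1 (fun h : R => f (h *: v + x)) df.
Proof.
have E : (fun h : R => h^-1 *: (((fun h : R => f (h *: v + x)) \o shift 0) (h *: 1) -
     (fun h : R => f (h *: v + x)) 0)) = (fun h => h^-1 *: ((f \o shift x) (h *: v) - f x)).
  apply/funext => h /=; rewrite addr0 scale0r add0r.
  by rewrite /GRing.scale/= mulr1.
split=> -[d1 d2]; split.
- by rewrite /derivable E.
- by rewrite /derive E.
- by move: d1; rewrite /derivable E.
- by move: d2; rewrite /derive E.
Qed.

Lemma is_derive_entry x i j :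
  is_derive x 'e_i (fun v : 'rV[R]_N => v ord0 j) ((i == j)%:R).
Proof.
apply/is_derive_line; under eq_fun do rewrite !mxE eqxx/= [j == i]eq_sym.
have h1 := is_derive_id (0 : R) 1; have h2 := is_derive_cst ((i == j)%:R : R) (0 : R) 1.
have h3 := is_derive_cst (x ord0 j) (0 : R) 1.
have := is_deriveD (is_deriveM h1 h2) h3; congr is_derive.
by rewrite /GRing.scale/=; ring.
Qed.

Lemma is_derive_expR_comp f x v df : is_derive x v f df ->
  is_derive x v (fun y => expR (f y)) (expR (f x) * df).
Proof.
move=> /is_derive_line h; apply/is_derive_line.
have hs : is_derive (f (0 *: v + x)) 1 expR (expR (f x)).
  by rewrite scale0r add0r; exact: is_derive_expR.
exact: (@is_derive1_comp _ expR (fun h : R => f (h *: v + x)) 0 _ _ hs h).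
Qed.

End derive_rV.

Section polyfun.
Context {R : realType} {N : nat}.
Implicit Types (p : 'rV[R]_N -> R).

(** Polynomials are described as functions rather than as formal expressions: derivatives and growth
    bounds then follow by induction on the construction. *)
Inductive polyfun : ('rV[R]_N -> R) -> Prop :=
| polyfun_cst c : polyfun (fun=> c)
| polyfun_entry i : polyfun (fun x => x ord0 i)
| polyfunD p q : polyfun p -> polyfun q -> polyfun (fun x => p x + q x)
| polyfunM p q : polyfun p -> polyfun q -> polyfun (fun x => p x * q x).

Lemma polyfun_continuous p : polyfun p -> continuous p.
Proof.
elim=> [c|i|q r _ cq _ cr|q r _ cq _ cr] x.
- exact: cst_continuous.
- exact: rV_entry_continuous.
- exact: (cvgD (cq x) (cr x)).
- exact: (cvgM (cq x) (cr x)).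
Qed.

Lemma polyfun_derive p i : polyfun p ->
  exists2 p', polyfun p' & forall x, is_derive x 'e_i p (p' x).
Proof.
elim=> [c|j|q r pq [q' pq' qq'] pr [r' pr' rr']|q r pq [q' pq' qq'] pr [r' pr' rr']].
- exists (fun=> 0); first exact: polyfun_cst.
  by move=> x; exact: is_derive_cst.
- exists (fun=> (i == j)%:R); first exact: polyfun_cst.
  by move=> x; exact: is_derive_entry.
- exists (fun x => q' x + r' x); first exact: polyfunD.
  by move=> x; exact: is_deriveD.
- exists (fun x => q x * r' x + r x * q' x).
    by apply: polyfunD; exact: polyfunM.
  by move=> x; exact: is_deriveM.
Qed.

(** Since the rate b is arbitrary, a product is handled by giving b / 2 to each factor. *)
Lemma polyfun_bound p (b : R) : polyfun p -> 0 < b ->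
  exists2 C, 0 <= C & forall x, `|p x| <= C * expR (b * dot x x).
Proof.
move=> pp; elim: pp b => [c|i|q r _ IHq _ IHr|q r _ IHq _ IHr] b b0.
- exists `|c| => // x; rewrite ler_peMr// -expR0 ler_expR.
  by apply: mulr_ge0; [exact: ltW|exact: dot_ge0].
- exists (1 + b^-1); first by rewrite addr_ge0// invr_ge0 ltW.
  move=> x; rewrite (le_trans (norm_le_expR _ b0))// ler_wpM2l//.
    by rewrite addr_ge0// invr_ge0 ltW.
  by rewrite ler_expR ler_wpM2l ?dot_entry_le// ltW.
- have [C C0 hC] := IHq _ b0; have [D D0 hD] := IHr _ b0.
  exists (C + D); first exact: addr_ge0.
  by move=> x; rewrite mulrDl (le_trans (ler_normD _ _))// lerD.
- have b20 : 0 < b / 2 by rewrite divr_gt0.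
  have [C C0 hC] := IHq _ b20; have [D D0 hD] := IHr _ b20.
  exists (C * D); first exact: mulr_ge0.
  move=> x; rewrite normrM (le_trans (ler_pM _ _ (hC x) (hD x)))//.
  by rewrite mulrACA -expRD -mulrDl -splitr.
Qed.

Lemma polyfun_dot : polyfun (fun x => dot x x).
Proof.
rewrite /dot; elim: (index_enum _) => [|i s IH].
  by under eq_fun do rewrite big_nil; exact: polyfun_cst.
under eq_fun do rewrite big_cons.
by apply: polyfunD => //; apply: polyfunM; exact: polyfun_entry.
Qed.

Lemma polyfun_monomial (a : {ffun 'I_N -> nat}) :
  polyfun (fun x => \prod_i x ord0 i ^+ a i).
Proof.
elim: (index_enum _) => [|i s IH].
  by under eq_fun do rewrite big_nil; exact: polyfun_cst.
under eq_fun do rewrite big_cons.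
apply: polyfunM => //; elim: (a i) => [|k IHk].
  by under eq_fun do rewrite expr0; exact: polyfun_cst.
by under eq_fun do rewrite exprS; apply: polyfunM => //; exact: polyfun_entry.
Qed.

Lemma polyfun_gaussv_derive p b i : polyfun p -> exists2 q, polyfun q &
  forall x, is_derive x 'e_i (fun x => p x * gaussv b x) (q x * gaussv b x).
Proof.
move=> pp; have [p' pp' hp] := polyfun_derive i pp.
have pq : polyfun (fun x => - b * dot x x).
  by apply: polyfunM; [exact: polyfun_cst|exact: polyfun_dot].
have [q pq' hq] := polyfun_derive i pq.
exists (fun x => p x * q x + p' x); first by apply: polyfunD => //; exact: polyfunM.
move=> x; have := is_derive_expR_comp (hq x).
rewrite (_ : (fun y => expR (- b * dot y y)) = gaussv b); last first.
  by apply/funext => y; rewrite mulNr.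
rewrite mulNr -/(gaussv b x) => hG.
have := is_deriveM (hp x) hG; congr is_derive.
by rewrite /GRing.scale/=; ring.
Qed.

Lemma partials_polyfun_gaussv p b s : polyfun p ->
  exists2 q, polyfun q & partials s (fun x => p x * gaussv b x) = (fun x => q x * gaussv b x).
Proof.
move=> pp; elim: s => [|i s [q pq E]]; first by exists p.
have [q' pq' hq'] := polyfun_gaussv_derive b i pq.
exists q' => //; rewrite /= E; apply/funext => x.
by have /(@derive_val _ _ _ _ _ _ _) := hq' x.
Qed.

Lemma smooth_polyfun_gaussv p b : polyfun p -> smooth (fun x => p x * gaussv b x).
Proof.
move=> pp s; have [q pq ->] := partials_polyfun_gaussv b s pp; split.
  have cG : continuous (gaussv b : 'rV[R]_N -> R).
    have cq : continuous (fun x : 'rV[R]_N => - b * dot x x).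
      by apply: polyfun_continuous; apply: polyfunM; [exact: polyfun_cst|exact: polyfun_dot].
    move=> x; rewrite (_ : gaussv b = expR \o (fun x => - b * dot x x)); last first.
      by apply/funext => y; rewrite /gaussv/= mulNr.
    by apply: continuous_comp; [exact: cq|exact: continuous_expR].
  have cQ : continuous q := polyfun_continuous pq.
  by move=> x; exact: (cvgM (cQ x) (cG x)).
by move=> i x; have [q' _ hq'] := polyfun_gaussv_derive b i pq; case: (hq' x).
Qed.

(** Derivatives stay of the form polynomial times the same Gaussian, and [polyfun_bound] at the rate
    b cancels exactly this Gaussian. *)
Lemma schwartz_gaussv b : 0 < b -> schwartz (fun x : 'rV[R]_N => (gaussv b x)%:C).
Proof.
move=> b0.
(* The real part and the zero imaginary part are both put in the form polynomial times Gaussian, so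
   that one argument covers them. *)
have E1 : (fun x : 'rV[R]_N => gaussv b x) = (fun x => 1 * gaussv b x).
  by apply/funext => x; rewrite mul1r.
have E0 : (fun x : 'rV[R]_N => 0 : R) = (fun x => 0 * gaussv b x).
  by apply/funext => x; rewrite mul0r.
have S1 := smooth_polyfun_gaussv b (polyfun_cst 1); rewrite -E1 in S1.
have S0 := smooth_polyfun_gaussv b (polyfun_cst 0); rewrite -E0 in S0.
split; [exact: S1|exact: S0|move=> a s].
have [q pq Eq] := partials_polyfun_gaussv b s (polyfun_cst 1).
have [r pr Er] := partials_polyfun_gaussv b s (polyfun_cst 0).
have [C C0 hC] := polyfun_bound (polyfunM (polyfun_monomial a) pq) b0.
have [D D0 hD] := polyfun_bound (polyfunM (polyfun_monomial a) pr) b0.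
have ER : partials s (fun x : 'rV[R]_N => complex.Re (gaussv b x)%:C) =
    (fun x => q x * gaussv b x) by rewrite -Eq -E1.
have EI : partials s (fun x : 'rV[R]_N => complex.Im (gaussv b x)%:C) =
    (fun x => r x * gaussv b x) by rewrite -Er -E0.
exists (C + D) => x; rewrite /weighted_partials ER EI.
rewrite Normc.normcM normc_real.
apply: (le_trans (ler_wpM2l (normr_ge0 _) (normc_le_ReIm _))) => /=.
rewrite mulrDr -!normrM !mulrA !normrM.
rewrite !(ger0_norm (gaussv_ge0 _ _)) -!normrM.
have G1 : expR (b * dot x x) * gaussv b x = 1 by rewrite /gaussv -expRD subrr expR0.
apply: lerD.
  rewrite (le_trans (ler_wpM2r (gaussv_ge0 _ _) (hC x)))//.
  by rewrite -mulrA G1 mulr1.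
rewrite (le_trans (ler_wpM2r (gaussv_ge0 _ _) (hD x)))//.
by rewrite -mulrA G1 mulr1.
Qed.

End polyfun.

Section square_integrable.
Context d (T : measurableType d) {R : realType}.
Variable mu : {measure set T -> \bar R}.
Implicit Types (f g : T -> R[i]).

Definition square_integrable f := cmeasurable f /\
  mu.-integrable setT (EFin \o (fun x => normc (f x) ^+ 2)).

Lemma square_integrable_mul f g : square_integrable f -> square_integrable g ->
  cintegrable mu (fun x => f x * conjc (g x)).
Proof.
move=> [mf fi] [mg gi].
apply: (cintegrable_le (u := fun x => normc (f x) ^+ 2 + normc (g x) ^+ 2)).
- by apply: cmeasurableM => //; exact: cmeasurable_conj.
- exact: (integrableD measurableT fi gi).
- move=> x; rewrite Normc.normcM normc_conj.
  by have := normc_ge0 (f x); have := normc_ge0 (g x); nra.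
Qed.

End square_integrable.

(** * Decay of Schwartz functions; square integrable functions as tempered distributions *)

Section schwartz_decay.
Context {R : realType} {N : nat}.
Local Notation mu := (lebesgue_rV R N).
Implicit Types (x : 'rV[R]_N) (g h f : 'rV[R]_N -> R[i]) (a : {ffun 'I_N -> nat}).

Definition monomial a x : R := \prod_i x ord0 i ^+ a i.

(** A product is taken instead of a power of 1 + |x|^2: its inverse factors into integrable
    functions on the line, and it expands into monomials, which the Schwartz seminorms control. *)
Definition japanese x : R := \prod_i (1 + x ord0 i ^+ 2).

Lemma japanese_gt0 x : 0 < japanese x.
Proof. by apply: prodr_gt0 => i _; rewrite ltr_pwDl// sqr_ge0. Qed.

Lemma japanese_ge1 x : 1 <= japanese x.
Proof.
rewrite /japanese; elim/big_rec : _ => // i y _ y1.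
by rewrite (le_trans y1)// ler_peMl ?lerDl ?sqr_ge0// (le_trans ler01).
Qed.

Lemma japanese_expand : exists L : seq {ffun 'I_N -> nat},
  forall x, japanese x = \sum_(a <- L) `|monomial a x|.
Proof.
(* The induction runs over a partial product with an extra monomial, which collects the squares
   already picked from the other factors. *)
suff H (s : seq 'I_N) a : exists L : seq {ffun 'I_N -> nat}, forall x,
    (\prod_(i <- s) (1 + x ord0 i ^+ 2)) * `|monomial a x| = \sum_(b <- L) `|monomial b x|.
  have [L hL] := H (index_enum _) [ffun=> 0%N]; exists L => x.
  rewrite -hL /monomial [X in `|X|]big1 ?normr1 ?mulr1//.
  by move=> i _; rewrite ffunE expr0.
elim: s a => [|i s IH] a; first by exists [:: a] => x; rewrite big_nil big_seq1 mul1r.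
have [L1 h1] := IH a.
pose a' := [ffun j => if j == i then (a j).+2 else a j].
have [L2 h2] := IH a'.
exists (L1 ++ L2) => x; rewrite big_cat -h1 -h2 big_cons /=.
have -> : `|monomial a' x| = x ord0 i ^+ 2 * `|monomial a x|.
  rewrite /monomial (bigD1 i)//= [in RHS](bigD1 i)//= !normrM !ffunE eqxx.
  rewrite mulrA; congr (_ * _).
    by rewrite -addn2 exprD normrM mulrC (ger0_norm (sqr_ge0 _)).
  by congr (`|_|); apply: eq_bigr => j ji; rewrite ffunE (negbTE ji).
by rewrite mulrDl mul1r mulrDl; congr (_ + _); rewrite mulrCA mulrA mulrAC mulrC mulrA.
Qed.

Lemma normc_weighted_nil a g x :
  normc (weighted_partials a [::] g x) = `|monomial a x| * normc (g x).
Proof.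
by rewrite /weighted_partials Normc.normcM normc_real/=; case: (g x).
Qed.

(** Multiplying |g| by the weight gives a finite sum of monomials times |g|, each bounded by a
    Schwartz estimate without derivatives. *)
Lemma schwartz_decay g : schwartz g ->
  exists2 B, 0 <= B & forall x, normc (g x) <= B * (japanese x)^-1.
Proof.
move=> [_ _ sg]; have [L hL] := japanese_expand.
have H (L' : seq {ffun 'I_N -> nat}) : exists2 B, 0 <= B &
    forall x, \sum_(a <- L') `|monomial a x| * normc (g x) <= B.
  elim: L' => [|a L' [B B0 hB]]; first by exists 0 => // x; rewrite big_nil.
  have [B' hB'] := sg a [::].
  exists (`|B'| + B); first by rewrite addr_ge0.
  move=> x; rewrite big_cons; apply: lerD => //.
  by rewrite -normc_weighted_nil (le_trans (hB' x))// ler_norm.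
have [B B0 hB] := H L; exists B => // x.
by rewrite ler_pdivlMr ?japanese_gt0// mulrC hL mulr_suml.
Qed.

Lemma measurable_japaneseV : measurable_fun setT (fun x => (japanese x)^-1).
Proof.
rewrite (_ : (fun x => _) = (fun x => \prod_i (1 + x ord0 i ^+ 2)^-1)); last first.
  by apply/funext => x; rewrite /japanese prodfV.
apply: measurable_prod => i _.
have mh : measurable_fun setT (fun y : R => (1 + y ^+ 2)^-1).
  exact: continuous_measurable_fun (@continuous_oneDsqrV R).
exact: (measurableT_comp mh (measurable_rV_coord i)).
Qed.

Lemma integrable_japaneseV : mu.-integrable setT (EFin \o (fun x => (japanese x)^-1)).
Proof.
have i1 : (@lebesgue_measure R).-integrable setT (EFin \o (fun y : R => (1 + y ^+ 2)^-1)).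
  have mh : measurable_fun setT (fun y : R => (1 + y ^+ 2)^-1).
    exact: continuous_measurable_fun (@continuous_oneDsqrV R).
  apply/integrableP; split; first exact/measurable_EFinP.
  under eq_integral do rewrite /= ger0_norm ?invr_ge0 ?addr_ge0 ?sqr_ge0//.
  rewrite ge0_symfun_integralT//.
  - rewrite (_ : [set x | _] = `[0, +oo[%classic); last first.
      by apply/seteqP; split => x/=; rewrite in_itv/= andbT.
    rewrite [X in (_ * X)%E](integral0y_oneDsqr R) -EFinM ltry//.
  - by move=> x; rewrite invr_ge0 addr_ge0// sqr_ge0.
  - exact: (@continuous_oneDsqrV R).
  - by move=> x /=; rewrite sqrrN.
have [ci _] := cint_prod_rV (h := fun (_ : 'I_N) (y : R) => ((1 + y ^+ 2)^-1)%:C)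
  (fun _ => cintegrable_real i1).
have := cintegrable_Re ci; congr (_.-integrable _ _); apply/funext => x /=.
rewrite /japanese -rmorph_prod/= prodfV//.
Qed.

Lemma schwartz_cmeasurable g : schwartz g -> cmeasurable g.
Proof.
move=> [sr si _]; split; apply: continuous_measurable_rV.
  exact: (sr [::]).1.
exact: (si [::]).1.
Qed.

Lemma decay_square_integrable g B : cmeasurable g -> 0 <= B ->
  (forall x, normc (g x) <= B * (japanese x)^-1) -> square_integrable mu g.
Proof.
move=> mg B0 hB; split => //.
apply: (@le_integrable _ _ _ mu _ measurableT _
   (EFin \o (fun x => B ^+ 2 * (japanese x)^-1))).
- by apply/measurable_EFinP; apply: measurable_funX; exact: measurable_normc.
- move=> x _; have j0 := japanese_gt0 x; have j1 := japanese_ge1 x.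
  have jv0 : 0 <= (japanese x)^-1 by rewrite invr_ge0 ltW.
  have jv1 : (japanese x)^-1 <= 1 by rewrite invf_le1.
  rewrite lee_fin (ger0_norm (sqr_ge0 _)) ger0_norm ?mulr_ge0 ?sqr_ge0//.
  rewrite (@le_trans _ _ ((B * (japanese x)^-1) ^+ 2))//.
    by rewrite ler_sqr ?nnegrE ?normc_ge0// mulr_ge0.
  by rewrite exprMn ler_wpM2l ?sqr_ge0// expr2 ler_piMr.
- rewrite (_ : _ \o _ = (fun x => (B ^+ 2)%:E * ((japanese x)^-1)%:E)%E)//.
  by apply: integrableZl => //; exact: integrable_japaneseV.
Qed.

Lemma schwartz_square_integrable g : schwartz g -> square_integrable mu g.
Proof.
move=> sg; have [B B0 hB] := schwartz_decay sg.
exact: (decay_square_integrable (schwartz_cmeasurable sg) B0 hB).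
Qed.

Lemma Lp2_square_integrable f : Lp 2%:E f -> square_integrable mu f.
Proof.
move=> [mf foo]; split => //; apply/integrableP; split.
  by apply/measurable_EFinP; apply: measurable_funX; exact: measurable_normc.
have : ('N[mu]_2%:E[(fun x => (normc (f x))%:E)] `^ 2 < +oo)%E by exact: poweR_lty.
rewrite poweR_Lnorm//; congr (_ < _)%E; apply: eq_integral => x _ /=.
by rewrite !ger0_norm ?sqr_ge0 ?normc_ge0// powR_mulrn// normc_ge0.
Qed.

(** The neighbourhood is cut out by the monomials of [japanese]: when they are small on g - g0, this
    difference is at most a small multiple of the inverse weight, which is square integrable and so
    pairs with f. *)
Lemma tempered_distribution_of f : square_integrable mu f -> tempered (distribution_of f).
Proof.
move=> sf; have mf := sf.1.
have TI g : schwartz g -> cintegrable mu (fun x => f x * conjc (g x)).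
  by move=> sg; apply: square_integrable_mul => //; exact: schwartz_square_integrable.
split.
  move=> c g h sg sh; rewrite /distribution_of -!/(cint mu _).
  rewrite -cintZ; last exact: TI.
  rewrite -cintD; [|exact/cintegrableZ/TI|exact: TI].
  by apply: eq_cint => x; rewrite rmorphD rmorphM/=; ring.
move=> g0 sg0 e e0; have [L hL] := japanese_expand.
have sj : square_integrable mu (fun x => ((japanese x)^-1)%:C).
  apply: (@decay_square_integrable _ 1) => //.
    by apply: cmeasurable_real; exact: measurable_japaneseV.
  by move=> x; rewrite normc_real mul1r ger0_norm// invr_ge0 ltW// japanese_gt0.
have cK := square_integrable_mul sf sj.
have Koo := cK.2; set K := (\int[_]_x _)%E in Koo.
have K0 : (0 <= K)%E by apply: integral_ge0 => x _; rewrite lee_fin normc_ge0.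
pose M : R := (size L)%:R.
have D0 : 0 < 1 + 2 * M * fine K.
  by rewrite ltr_pwDl// !mulr_ge0// fine_ge0.
(* If all these seminorms are below delta, the pairing is at most 2 M delta K; the 1 in the
   denominator makes this strictly less than e. *)
exists [seq (a, [::]) | a <- L], (e / (1 + 2 * M * fine K)); first by rewrite divr_gt0.
set delta := _ / _ => g sg hg.
have d0 : 0 < delta by rewrite divr_gt0.
have bnd x : normc (g x - g0 x) <= M * delta * (japanese x)^-1.
  rewrite ler_pdivlMr ?japanese_gt0// mulrC hL mulr_suml.
  have {}hg a : a \in L -> `|monomial a x| * normc (g x - g0 x) <= delta.
    move=> aL.
    have hs : schwartz_seminorm a [::] (fun x => g x - g0 x) < delta := hg (a, [::]) (map_f _ aL).
    rewrite -(normc_weighted_nil a (fun x => g x - g0 x)).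
    (* A real [sup] dominates its set only when the set is bounded above, which follows from the
       Schwartz estimates for g and g0. *)
    apply: (le_trans _ (ltW hs)); apply: ub_le_sup; last by exists x.
    have [_ _ /(_ a [::])[B hB]] := sg; have [_ _ /(_ a [::])[B' hB']] := sg0.
    exists (B + B') => _ [y _ <-]; rewrite normc_weighted_nil.
    have := hB y; have := hB' y; rewrite !normc_weighted_nil => h1 h2.
    apply: (@le_trans _ _ (`|monomial a y| * (normc (g y) + normc (g0 y)))).
      by rewrite ler_wpM2l// -(normcN (g0 y)) le_normcD.
    by rewrite mulrDr lerD.
  have hsum (s : seq {ffun 'I_N -> nat}) (D : R) (t : {ffun 'I_N -> nat} -> R) :
      (forall a, a \in s -> t a <= D) -> \sum_(a <- s) t a <= (size s)%:R * D.
    elim: s => [|a s IH] ht; first by rewrite big_nil mul0r.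
    rewrite big_cons /= -natr1 addrC mulrDl mul1r lerD//.
      by apply: IH => b bL; apply: ht; rewrite inE bL orbT.
    by apply: ht; rewrite inE eqxx.
  exact: (hsum _ delta (fun a => `|monomial a x| * normc (g x - g0 x))).
have TB : distribution_of f g - distribution_of f g0 =
    cint mu (fun x => f x * conjc (g x - g0 x)).
  rewrite /distribution_of -!/(cint mu _) -mulN1r -cintZ; last exact: TI.
  rewrite -cintD; [|exact: TI|exact/cintegrableZ/TI].
  by apply: eq_cint => x; rewrite rmorphB/=; ring.
have cB : cintegrable mu (fun x => f x * conjc (g x - g0 x)).
  have := cintegrableD (TI _ sg) (cintegrableZ (-1) (TI _ sg0)).
  congr (cintegrable _ _); apply/funext => x; rewrite rmorphB/=; ring.
rewrite TB -lte_fin; apply: (le_lt_trans (normc_cint_le cB)).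
apply: (@le_lt_trans _ _ (2%:E * ((M * delta)%:E * K))%E).
  rewrite lee_wpmul2l// /K -ge0_integralZl//.
  - apply: ge0_le_integral => //.
    + by move=> x _; rewrite lee_fin normc_ge0.
    + by apply/measurable_EFinP; apply: measurable_normc; exact: cB.1.
    + by apply/measurable_EFinP; apply: measurable_funM => //; apply: measurable_normc; exact: cK.1.
    + move=> x _; rewrite -EFinM lee_fin !Normc.normcM !normc_conj normc_real.
      rewrite mulrCA ler_wpM2l ?normc_ge0// ger0_norm//.
      by rewrite invr_ge0 ltW// japanese_gt0.
  - by apply/measurable_EFinP; apply: measurable_normc; exact: cK.1.
  - by move=> x _; rewrite lee_fin normc_ge0.
  - by rewrite lee_fin mulr_ge0// ltW.
rewrite -(@fineK _ K) ?ge0_fin_numE// -!EFinM lte_fin.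
have -> : 2 * (M * delta * fine K) = e * ((2 * M * fine K) / (1 + 2 * M * fine K)).
  by rewrite /delta; field; rewrite gt_eqF.
by rewrite gtr_pMr// ltr_pdivrMr// mul1r ltrDr.
Qed.

End schwartz_decay.

(** * Narrow Gaussians detect a nonzero Schwartz function *)

Section gauss_pairing.
Context {R : realType} {N : nat}.
Local Notation mu := (lebesgue_rV R N).

Lemma dot_gaussv_le a (x : 'rV[R]_N) : 0 < a ->
  dot x x * gaussv a x <= 2 / a * gaussv (a / 2) x.
Proof.
move=> a0; have h := expR_ge1Dx (a / 2 * dot x x).
have h1 : dot x x <= 2 / a * expR (a / 2 * dot x x).
  rewrite -(@ler_pM2l _ (a / 2)) ?divr_gt0// mulrA (_ : a / 2 * (2 / a) = 1); last first.
    by field; rewrite gt_eqF.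
  by rewrite mul1r; lra.
rewrite (le_trans (ler_wpM2r (gaussv_ge0 _ _) h1))// -(mulrA (2 / a)) ler_wpM2l//.
  by rewrite divr_ge0// ltW.
by rewrite /gaussv -expRD ler_expR le_eqVlt; apply/orP; left; apply/eqP; field.
Qed.

(* As [a] tends to infinity, the normalised Gaussians centred at [x0] concentrate
   at [x0], so that their pairing with [h] has the sign of [h x0]. *)
Lemma gauss_pairing_gt0 (h : 'rV[R]_N -> R) (B : R) (x0 : 'rV[R]_N) :
  continuous h -> (forall x, `|h x| <= B) -> 0 < h x0 ->
  exists2 a, 0 < a & 0 < \int[mu]_z (gaussv a (z - x0) * h z).
Proof.
move=> ch hB h0; have mh := continuous_measurable_rV ch.
have B0 : 0 <= B := le_trans (normr_ge0 _) (hB x0).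
have hB0 : 0 < h x0 / 2 by rewrite divr_gt0.
have [e e0 he] : exists2 e : R, 0 < e & forall z, ball x0 e z -> h x0 / 2 <= h z.
  have /cvgrPdist_lt/(_ _ hB0) := ch x0.
  move=> /nbhs_ballP[e /= e0 he]; exists e => // z /he /=.
  by rewrite ltr_norml => /andP[_]; lra.
(* Chosen so that the quadratic minorant of [lb] has dropped to - B at distance e; nearer to x0,
   continuity gives the bound. *)
pose C := (B + h x0 / 2) / e ^+ 2.
have C0 : 0 < C by rewrite divr_gt0 ?exprn_gt0// ltr_wpDl.
have lb z : h x0 / 2 - C * dot (z - x0) (z - x0) <= h z.
  have [ez|ez] := ltP (dot (z - x0) (z - x0)) (e ^+ 2).
    rewrite (le_trans _ (he z _))//.
      by rewrite gerBl mulr_ge0 ?dot_ge0// ltW.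
    split => // i j; rewrite (ord1 i) /ball/= distrC.
    have := le_lt_trans (dot_entry_le (z - x0) j) ez; rewrite !mxE => hij.
    by rewrite -ltr_sqr ?nnegrE ?normr_ge0 ?(ltW e0)// real_normK ?num_real.
  have : C * e ^+ 2 <= C * dot (z - x0) (z - x0) by rewrite ler_wpM2l// ltW.
  rewrite {1}/C mulfVK ?expf_neq0 ?gt_eqF// => h1.
  by have := hB z; rewrite ler_norml => /andP[+ _]; lra.
(* The ratio of the masses of [gaussv (a / 2)] and [gaussv a], for every a. *)
pose s := Num.sqrt (2 : R) ^+ N.
have s0 : 0 < s by rewrite exprn_gt0// sqrtr_gt0.
(* Large enough for the contribution of the quadratic term, which is 2 C s / a in units of the mass
   m, to stay below h x0 / 2. *)
pose a := 1 + 8 * C * s / h x0.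
have a0 : 0 < a.
  have : 0 <= 8 * C * s / h x0.
    apply: divr_ge0; last exact: ltW.
    by apply: mulr_ge0; [apply: mulr_ge0 => //|]; exact: ltW.
  by rewrite /a; lra.
exists a => //; have [iG EG] := gaussv_integral (N := N) a0.
have a20 : 0 < a / 2 by rewrite divr_gt0.
have [iG2 EG2] := gaussv_integral (N := N) a20.
set m := Num.sqrt (pi / a) ^+ N in EG.
have m0 : 0 < m by rewrite exprn_gt0// sqrtr_gt0 divr_gt0// pi_gt0.
have {}EG2 : \int[mu]_v gaussv (a / 2) v = s * m.
  rewrite EG2 /s /m -exprMn -sqrtrM//; congr (Num.sqrt _ ^+ _).
  by field; rewrite gt_eqF.
have -> : \int[mu]_z (gaussv a (z - x0) * h z) = \int[mu]_z (gaussv a z * h (z + x0)).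
  have mf : measurable_fun setT (fun z : 'rV[R]_N => gaussv a z * h (z + x0)).
    apply: measurable_funM; first exact: measurable_gaussv.
    exact: (measurableT_comp mh (measurable_rV_shift _)).
  rewrite -(Rintegral_preserving (measurable_rV_shift (- x0))
    (fun A mA => lebesgue_rV_shift (- x0) mA) mf).
  by apply: eq_Rintegral => z _; rewrite subrK.
have key : (h x0 / 2 - C * (2 / a) * s) * m <= \int[mu]_z (gaussv a z * h (z + x0)).
  have -> : (h x0 / 2 - C * (2 / a) * s) * m =
      \int[mu]_z (h x0 / 2 * gaussv a z - C * (2 / a) * gaussv (a / 2) z).
    rewrite RintegralB//; first by rewrite !RintegralZl// EG EG2; ring.
      rewrite (_ : _ \o _ = (fun z => (h x0 / 2)%:E * (gaussv a z)%:E)%E)//.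
      exact: integrableZl.
    rewrite (_ : _ \o _ = (fun z => (C * (2 / a))%:E * (gaussv (a / 2) z)%:E)%E)//.
    exact: integrableZl.
  apply: le_Rintegral => //.
  - apply: (integrableB measurableT (f := fun z => (h x0 / 2 * gaussv a z)%:E)
      (g := fun z => (C * (2 / a) * gaussv (a / 2) z)%:E)).
      rewrite (_ : (fun _ => _) = (fun z => (h x0 / 2)%:E * (gaussv a z)%:E)%E)//.
      exact: integrableZl.
    rewrite (_ : (fun _ => _) = (fun z => (C * (2 / a))%:E * (gaussv (a / 2) z)%:E)%E)//.
    exact: integrableZl.
  - apply: (@le_integrable _ _ _ mu _ measurableT _ (EFin \o (fun z => B * gaussv a z))).
    + apply/measurable_EFinP; apply: measurable_funM; first exact: measurable_gaussv.
      exact: (measurableT_comp mh (measurable_rV_shift _)).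
    + move=> z _; rewrite lee_fin !normrM (ger0_norm (gaussv_ge0 _ _)) (ger0_norm B0).
      by rewrite mulrC ler_wpM2r// gaussv_ge0.
    + rewrite (_ : _ \o _ = (fun z => B%:E * (gaussv a z)%:E)%E)//.
      exact: integrableZl.
  - move=> z _; have := lb (z + x0); rewrite addrK => h1.
    apply: (@le_trans _ _ (gaussv a z * (h x0 / 2 - C * dot z z))); last first.
      by rewrite ler_wpM2l// gaussv_ge0.
    rewrite mulrBr (mulrC (gaussv a z)) lerD2l lerN2.
    rewrite [leLHS]mulrCA -[leRHS]mulrA ler_wpM2l ?(ltW C0)// mulrC.
    exact: dot_gaussv_le.
apply: lt_le_trans key; rewrite mulr_gt0// subr_gt0.
have -> : C * (2 / a) * s = 2 * C * s / a by field; rewrite gt_eqF.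
rewrite ltr_pdivrMr//.
have : a * h x0 = h x0 + 8 * C * s by rewrite /a; field; rewrite gt_eqF.
have : 0 < C * s by rewrite mulr_gt0.
nra.
Qed.

(** At a point where g is nonzero its real or its imaginary part is nonzero; up to sign,
    [gauss_pairing_gt0] applies to that part, and the corresponding part of the complex pairing does
    not vanish. *)
Lemma schwartz_gauss_pairing (g : 'rV[R]_N -> R[i]) : schwartz g -> g <> cst 0 ->
  exists a x0, 0 < a /\ cint mu (fun z => (gaussv a (z - x0))%:C * g z) != 0.
Proof.
move=> sg gn0; have [B B0 hB] := schwartz_decay sg.
have hB' x : normc (g x) <= B.
  rewrite (le_trans (hB x))// ler_piMr// invf_le1 ?japanese_gt0//.
  exact: japanese_ge1.
have [sr si _] := sg.
have cr : continuous (fun x => complex.Re (g x)) := (sr [::]).1.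
have ci : continuous (fun x => complex.Im (g x)) := (si [::]).1.
have [x0 gx0] : exists x0, g x0 != 0.
  by apply: contra_notP gn0 => /forallNP h; apply/funext => x; apply/eqP/negPn/negP/h.
have key (h : 'rV[R]_N -> R) : continuous h -> (forall x, `|h x| <= B) -> h x0 != 0 ->
    exists a, 0 < a /\ \int[mu]_z (gaussv a (z - x0) * h z) != 0.
  move=> ch hhB; rewrite neq_lt => /orP[hx0|hx0].
    have cN : continuous (fun x => - h x) by move=> x; exact: (cvgN (ch x)).
    have hN z : `|- h z| <= B by rewrite normrN.
    have hx0' : 0 < - h x0 by rewrite oppr_gt0.
    have [a a0 I0] := gauss_pairing_gt0 cN hN hx0'.
    exists a; split => //; apply/eqP => E; move: I0.
    under eq_Rintegral do rewrite mulrN -mulN1r.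
    rewrite RintegralZl//; first by rewrite E mulr0 ltxx.
    apply: (@le_integrable _ _ _ mu _ measurableT _ (EFin \o (fun z => B * gaussv a (z - x0)))).
    + apply/measurable_EFinP; apply: measurable_funM; last exact: continuous_measurable_rV.
      exact: (measurableT_comp (measurable_gaussv a) (measurable_rV_shift _)).
    + move=> z _; rewrite lee_fin !normrM (ger0_norm (gaussv_ge0 _ _)).
      rewrite (ger0_norm (le_trans (normr_ge0 _) (hhB x0))).
      by rewrite mulrC ler_wpM2r// gaussv_ge0.
    + rewrite (_ : _ \o _ = (fun z => B%:E * (gaussv a (z - x0))%:E)%E)//.
      apply: integrableZl => //.
      have := cintegrable_Re (cintegrable_preserving (measurable_rV_shift (- x0))
        (fun A mA => lebesgue_rV_shift (- x0) mA) (cintegrable_real (integrable_gaussv a0))).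
      by [].
  have [a a0 I0] := gauss_pairing_gt0 ch hhB hx0.
  by exists a; split => //; rewrite gt_eqF.
have Epair a (u v : R) : complex.Re (u%:C * (a +i* v)) = u * a /\
    complex.Im (u%:C * (a +i* v)) = u * v.
  by split => /=; rewrite mul0r ?subr0 ?addr0.
have [r0|r0] := eqVneq (complex.Re (g x0)) 0.
  have i0 : complex.Im (g x0) != 0.
    by apply: contra_neq gx0; case: (g x0) r0 => u v /= -> ->.
  have [a [a0 I0]] := key _ ci (fun x => le_trans (le_normr_Im _) (hB' x)) i0.
  exists a, x0; split => //; apply: contra_neq I0 => /(congr1 (@complex.Im R)) /=.
  move=> E; rewrite -[RHS]E; apply: eq_Rintegral => z _.
  by case: (g z) => u v; exact: (esym (Epair u _ v).2).
have [a [a0 I0]] := key _ cr (fun x => le_trans (le_normr_Re _) (hB' x)) r0.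
exists a, x0; split => //; apply: contra_neq I0 => /(congr1 (@complex.Re R)) /=.
move=> E; rewrite -[RHS]E; apply: eq_Rintegral => z _.
by case: (g z) => u v; exact: (esym (Epair u _ v).1).
Qed.

End gauss_pairing.

(** * Change of window *)

Section window_change.
Context {R : realType} {N : nat}.
Local Notation mu := (lebesgue_rV R N).
Local Notation E := 'rV[R]_N.
Implicit Types (f g : E -> R[i]) (s : R).

Definition phase (x : R) : R[i] := cexp (0 +i* x).

Lemma phaseD x y : phase (x + y) = phase x * phase y.
Proof. by rewrite /phase -cexpD; congr cexp; apply/eqP; rewrite eq_complex/= addr0 !eqxx. Qed.

Lemma conj_phase x : conjc (phase x) = phase (- x).
Proof. by rewrite /phase cexp_conj. Qed.

Lemma cmeasurable_phase d (T : measurableType d) (h : T -> R) :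
  measurable_fun setT h -> cmeasurable (fun x => phase (h x)).
Proof. by move=> mh; apply: cmeasurable_cexp; apply: cmeasurable_mk => //; exact: measurable_cst. Qed.

(** The short-time Fourier transform with window g, at position z.1 and, up to sign, frequency s
    z.2. Keeping the scale s outside z is what makes the passage from (xi, eta) to z measure
    preserving. *)
Definition stft s f g (z : E * E) : R[i] :=
  cint mu (fun X => f X * conjc (phase (- (s * dot z.2 X)) * g (X - z.1))).

Lemma lebesgue_rV_reflection (Z : E) (A : set E) : measurable A ->
  mu ((fun v => Z - v) @^-1` A) = mu A.
Proof.
move=> mA; have mB : measurable ((fun v : E => v + Z) @^-1` A).
  by rewrite -[X in measurable X]setTI; exact: measurable_rV_shift.
rewrite -(lebesgue_rV_shift Z mA) -(lebesgue_rVN mB); congr (mu _).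
by apply/seteqP; split => v /=; rewrite addrC.
Qed.

Lemma square_integrable_shift g y : square_integrable mu g ->
  square_integrable mu (fun X => g (X - y)).
Proof.
move=> [mg gi]; split; first exact: (cmeasurable_comp mg (measurable_rV_shift _)).
have /cintegrable_real gc := gi.
exact: (cintegrable_Re (cintegrable_preserving (measurable_rV_shift (- y))
  (fun A mA => lebesgue_rV_shift (- y) mA) gc)).
Qed.

Lemma square_integrable_phase (h : E -> R) g : measurable_fun setT h ->
  square_integrable mu g -> square_integrable mu (fun X => phase (h X) * g X).
Proof.
move=> mh [mg gi]; split; first by apply: cmeasurableM => //; exact: cmeasurable_phase.
by under eq_fun do rewrite Normc.normcM normc_phase mul1r.
Qed.

Lemma stft_integrable s f g z : square_integrable mu f -> square_integrable mu g ->
  cintegrable mu (fun X => f X * conjc (phase (- (s * dot z.2 X)) * g (X - z.1))).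
Proof.
move=> sf sg; apply: square_integrable_mul => //.
apply: square_integrable_phase; last exact: square_integrable_shift.
apply: measurableT_comp => //; apply: measurable_funM => //.
exact: measurable_dot.
Qed.

Lemma cmeasurable_stft_integrand d (T : measurableType d) s f g (X y w : T -> E) :
  cmeasurable f -> cmeasurable g -> measurable_fun setT X ->
  measurable_fun setT y -> measurable_fun setT w ->
  cmeasurable (fun x => f (X x) * conjc (phase (- (s * dot (w x) (X x))) * g (X x - y x))).
Proof.
move=> mf mg mX my mw; apply: cmeasurableM; first exact: cmeasurable_comp mf mX.
apply: cmeasurable_conj; apply: cmeasurableM.
  apply: cmeasurable_phase; apply: measurableT_comp => //; apply: measurable_funM => //.
  exact: measurable_dot.
by apply: (cmeasurable_comp mg); exact: measurable_rVB.
Qed.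

Lemma cmeasurable_stft s f g : cmeasurable f -> cmeasurable g ->
  cmeasurable (stft s f g).
Proof.
move=> mf mg; rewrite /stft.
apply: (cmeasurable_cint_param mu (f := fun x : (E * E) * E =>
  f x.2 * conjc (phase (- (s * dot x.1.2 x.2)) * g (x.2 - x.1.1)))).
apply: (@cmeasurable_stft_integrand _ _ s f g snd (fun x => x.1.1) (fun x => x.1.2)) => //.
  by apply: (measurableT_comp _ measurable_fst) => //; exact: measurable_fst.
by apply: (measurableT_comp _ measurable_fst) => //; exact: measurable_snd.
Qed.

(** In [window_kernel_cint], with v = y + x0, the left side consists of the position factor of the
    kernel and the outcome of the frequency integral. *)
Lemma gaussv_complete_square (a b : R) (v Z : E) : 0 < a -> 0 < b ->
  gaussv (a * b / (a + b)) v * gaussv (a + b) ((a / (a + b)) *: v - Z) =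
  gaussv b Z * gaussv a (Z - v).
Proof.
move=> a0 b0; have ab0 : a + b != 0 by rewrite gt_eqF// addr_gt0.
rewrite /gaussv -!expRD; congr expR.
rewrite !(dotDl, dotDr, dotNl, dotNr, dotZl, dotZr) (dotC Z v).
by field.
Qed.

(* Chosen so that, up to a constant, integrating the kernel against the
   time-frequency shifts of [g] gives [gaussv b]: the integral in the frequency
   variable produces [gaussv (a + b)], and completing the square leaves
   [gaussv b Z * gaussv a (Z - (z.1 + x0))]. *)
Definition window_kernel s (a b : R) (x0 : E) (z : E * E) : R[i] :=
  (gaussv (a * b / (a + b)) (z.1 + x0) *
   gaussv (s ^+ 2 / (4 * (a + b))) z.2)%:C *
  phase (s * (a / (a + b)) * dot z.2 (z.1 + x0)).

Section fixed_parameters.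
Variables (s a b : R) (x0 : E).
Hypotheses (s0 : s != 0) (a0 : 0 < a) (b0 : 0 < b).
Local Notation K := (fun z : E * E => gaussv (a * b / (a + b)) (z.1 + x0) *
   gaussv (s ^+ 2 / (4 * (a + b))) z.2).

Let ab0 : 0 < a + b. Proof. exact: addr_gt0. Qed.
Let al0 : 0 < a * b / (a + b). Proof. by rewrite divr_gt0// mulr_gt0. Qed.
Let be0 : 0 < s ^+ 2 / (4 * (a + b)).
Proof. by apply: divr_gt0; [rewrite exprn_even_gt0|rewrite mulr_gt0]. Qed.

Lemma normc_window_kernel z : normc (window_kernel s a b x0 z) = K z.
Proof.
by rewrite /window_kernel Normc.normcM normc_phase mulr1 normc_real ger0_norm//
  mulr_ge0// gaussv_ge0.
Qed.

Let mv : measurable_fun setT (fun z : E * E => z.1 + x0).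
Proof. exact: (measurableT_comp (measurable_rV_shift _) measurable_fst). Qed.

Let mK : measurable_fun setT K.
Proof.
apply: measurable_funM.
  exact: (measurableT_comp (measurable_gaussv _) mv).
exact: (measurableT_comp (measurable_gaussv _) measurable_snd).
Qed.

Lemma cmeasurable_window_kernel : cmeasurable (window_kernel s a b x0).
Proof.
apply: cmeasurableM; first exact: cmeasurable_real.
apply: cmeasurable_phase; apply: measurable_funM => //.
exact: (measurable_dot measurable_snd mv).
Qed.

Lemma integrable_window_kernel : (mu \x mu)%E.-integrable setT (EFin \o K).
Proof.
have [ia _] := gaussv_integral (N := N) al0.
have [ib Eb] := gaussv_integral (N := N) be0.
have cK : cintegrable (mu \x mu)%E (fun z => (K z)%:C).
  apply: cintegrable_prodP; first exact: cmeasurable_real.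
  have E x : (\int[mu]_y (normc ((K (x, y))%:C))%:E =
      (\int[mu]_y gaussv (s ^+ 2 / (4 * (a + b))) y)%:E *
      (gaussv (a * b / (a + b)) (x + x0))%:E)%E.
    under eq_integral do rewrite normc_real ger0_norm ?mulr_ge0 ?gaussv_ge0// EFinM /=.
    rewrite ge0_integralZl//.
    - by rewrite muleC fineK//; exact: integrable_fin_num.
    - by apply/measurable_EFinP; exact: measurable_gaussv.
    - by move=> y _; rewrite lee_fin gaussv_ge0.
    - by rewrite lee_fin gaussv_ge0.
  under eq_integral do rewrite E.
  have mg : measurable_fun setT (fun y : 'rV[R]_N => (gaussv (a * b / (a + b)) y)%:E).
    by apply/measurable_EFinP; exact: measurable_gaussv.
  have I0 : (0 <= \int[mu]_x (gaussv (a * b / (a + b)) (x + x0))%:E)%E.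
    by apply: integral_ge0 => x _; rewrite lee_fin gaussv_ge0.
  rewrite ge0_integralZl//.
  - rewrite lte_mul_pinfty// ?lee_fin ?Rintegral_ge0//.
      by move=> y _; exact: gaussv_ge0.
    rewrite (ge0_integral_rV_shift x0 (f := fun y => (gaussv (a * b / (a + b)) y)%:E))//.
      have /integrableP[_] := ia; congr (_ < _)%E.
      by apply: eq_integral => y _; rewrite /= ger0_norm// gaussv_ge0.
    by move=> v; rewrite lee_fin gaussv_ge0.
  - exact: (measurableT_comp mg (measurable_rV_shift _)).
  - by move=> y _; rewrite lee_fin gaussv_ge0.
  - by rewrite lee_fin Rintegral_ge0// => y _; exact: gaussv_ge0.
exact: (cintegrable_Re cK).
Qed.


Variable g : E -> R[i].
Hypotheses (mg : cmeasurable g) (B : R) (gB : forall x, normc (g x) <= B).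

Let B0 : 0 <= B. Proof. exact: le_trans (normc_ge0 _) (gB 0). Qed.

Let gauss_g_integrable : cintegrable mu (fun z => (gaussv a (z - x0))%:C * g z).
Proof.
apply: (cintegrable_le (u := fun z : E => gaussv a (z - x0) * B)).
- apply: cmeasurableM => //; apply: cmeasurable_real.
  exact: (measurableT_comp (measurable_gaussv _) (measurable_rV_shift _)).
- have h := cintegrable_preserving (measurable_rV_shift (- x0))
    (fun A mA => lebesgue_rV_shift (- x0) mA) (cintegrable_real (integrable_gaussv a0)).
  rewrite (_ : _ \o _ = (fun z => (gaussv a (z - x0))%:E * B%:E)%E)//.
  by apply: integrableZr => //; exact: (cintegrable_Re h).
- move=> z; rewrite Normc.normcM normc_real ger0_norm ?gaussv_ge0//.
  by rewrite ler_wpM2l// gaussv_ge0.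
Qed.

Lemma window_kernel_integrable Z :
  cintegrable (mu \x mu)%E (fun z => window_kernel s a b x0 z *
    (phase (- (s * dot z.2 Z)) * g (Z - z.1))).
Proof.
apply: (cintegrable_le (u := fun z => B * K z)).
- apply: cmeasurableM; first exact: cmeasurable_window_kernel.
  apply: cmeasurableM.
    apply: cmeasurable_phase; apply: measurableT_comp => //; apply: measurable_funM => //.
    exact: (measurable_dot measurable_snd).
  by apply: (cmeasurable_comp mg); apply: measurable_rVB => //; exact: measurable_fst.
- rewrite (_ : _ \o _ = (fun z => B%:E * (K z)%:E)%E)//.
  by apply: integrableZl => //; exact: integrable_window_kernel.
- move=> z; rewrite Normc.normcM normc_window_kernel Normc.normcM normc_phase mul1r mulrC.
  by rewrite ler_wpM2r// mulr_ge0// gaussv_ge0.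
Qed.

(** Once the frequency integral is done and the square completed, the substitution y -> Z - y turns
    the position integral into the pairing of g with a Gaussian centred at x0, in which Z no longer
    occurs. *)
Lemma window_kernel_cint Z :
  cint (mu \x mu)%E (fun z => window_kernel s a b x0 z *
    (phase (- (s * dot z.2 Z)) * g (Z - z.1))) =
  ((Num.sqrt (pi / (s ^+ 2 / (4 * (a + b)))) ^+ N)%:C *
    cint mu (fun z => (gaussv a (z - x0))%:C * g z)) * (gaussv b Z)%:C.
Proof.
rewrite -(cint_prod12 (window_kernel_integrable Z)) /=.
set C := Num.sqrt _ ^+ N.
have inner y : cint mu (fun w => window_kernel s a b x0 (y, w) *
      (phase (- (s * dot w Z)) * g (Z - y))) =
    (C * gaussv b Z)%:C * ((gaussv a ((Z - y) - x0))%:C * g (Z - y)).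
  have [ci cE] := cint_gaussv s ((a / (a + b)) *: (y + x0) - Z) be0.
  pose c := (gaussv (a * b / (a + b)) (y + x0))%:C * g (Z - y).
  transitivity (cint mu (fun w => c * ((gaussv (s ^+ 2 / (4 * (a + b))) w)%:C *
      cexp (0 +i* (s * dot w ((a / (a + b)) *: (y + x0) - Z)))))).
    apply: eq_cint => w; rewrite /window_kernel /c /= -/(phase _).
    have -> : s * dot w (a / (a + b) *: (y + x0) - Z) =
        s * (a / (a + b)) * dot w (y + x0) + - (s * dot w Z).
      by rewrite dotDr dotNr dotZr; ring.
    by rewrite phaseD rmorphM; ring.
  rewrite cintZ// cE -/C /c.
  (* The width of the frequency Gaussian was chosen so that the factor s of the character cancels
     here. *)
  have -> : (4 * (s ^+ 2 / (4 * (a + b))))^-1 = (a + b) / s ^+ 2.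
    by field; rewrite s0 gt_eqF.
  have -> : gaussv ((a + b) / s ^+ 2) (s *: (a / (a + b) *: (y + x0) - Z)) =
      gaussv (a + b) (a / (a + b) *: (y + x0) - Z).
    rewrite /gaussv dotZl dotZr; congr (expR (- _)).
    by field.
  have := gaussv_complete_square (y + x0) Z a0 b0.
  rewrite opprD addrA => h.
  transitivity ((C * (gaussv (a * b / (a + b)) (y + x0) *
     gaussv (a + b) (a / (a + b) *: (y + x0) - Z)))%:C * g (Z - y)).
    by rewrite !rmorphM/=; ring.
  by rewrite h !rmorphM/=; ring.
under eq_cint do rewrite inner.
have mrefl : measurable_fun setT (fun v : E => Z - v).
  by apply: measurable_rVB => //; exact: measurable_cst.
have refl A := @lebesgue_rV_reflection Z A.
rewrite cintZ; last first.
  exact: (cintegrable_preserving mrefl refl gauss_g_integrable).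
rewrite (cint_preserving mrefl refl gauss_g_integrable.1) rmorphM/=; ring.
Qed.

Variable f : E -> R[i].
Hypotheses (sf : square_integrable mu f) (sg : square_integrable mu g).
Variable z : E * E.

(** With x = (w, X): f at X against the shift by z of the w-th term in the average of shifts of g.
    Integrating in w first produces the window [gaussv b], integrating in X first produces
    transforms with window g. *)
Let H (x : (E * E) * E) : R[i] := f x.2 * conjc (phase (- (s * dot z.2 x.2)) *
  (window_kernel s a b x0 x.1 *
    (phase (- (s * dot x.1.2 (x.2 - z.1))) * g (x.2 - z.1 - x.1.1)))).

(** Two time-frequency shifts compose to the shift by the sum of their parameters, up to a
    unimodular factor free of X. *)
Let HE w X : H (w, X) = conjc (window_kernel s a b x0 w * phase (s * dot w.2 z.1)) *
  (f X * conjc (phase (- (s * dot (z.2 + w.2) X)) * g (X - (z.1 + w.1)))).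
Proof.
rewrite /H [(w, X).1]/= [(w, X).2]/= (_ : X - (z.1 + w.1) = X - z.1 - w.1) ?opprD ?addrA//.
have -> : - (s * dot w.2 (X - z.1)) = s * dot w.2 z.1 - s * dot w.2 X.
  by rewrite dotDr dotNr; ring.
have -> : - (s * dot (z.2 + w.2) X) = - (s * dot z.2 X) - s * dot w.2 X.
  by rewrite dotDl; ring.
rewrite !phaseD; move: (window_kernel _ _ _ _ w) (f X) (g _) => k u v.
move: (phase (- (s * dot z.2 X))) (phase (s * dot w.2 z.1)) (phase (- (s * dot w.2 X))).
move=> p1 p2 p3; rewrite !rmorphM/=; ring.
Qed.

Let mH : cmeasurable H.
Proof.
  apply: cmeasurableM; first exact: (cmeasurable_comp sf.1 measurable_snd).
  apply: cmeasurable_conj; apply: cmeasurableM.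
    apply: cmeasurable_phase; apply: measurableT_comp => //; apply: measurable_funM => //.
    by apply: (@measurable_dot _ _ _ _ (fun=> z.2) snd); [exact: measurable_cst|exact: measurable_snd].
  have m1 : measurable_fun setT (fun x : (E * E) * E => x.1.1).
    by apply: (measurableT_comp _ measurable_fst) => //; exact: measurable_fst.
  have m2 : measurable_fun setT (fun x : (E * E) * E => x.1.2).
    by apply: (measurableT_comp _ measurable_fst) => //; exact: measurable_snd.
  have m3 : measurable_fun setT (fun x : (E * E) * E => x.2 - z.1).
    by apply: measurable_rVB; [exact: measurable_snd|exact: measurable_cst].
  apply: cmeasurableM; first exact: (cmeasurable_comp cmeasurable_window_kernel measurable_fst).
  apply: cmeasurableM.
    apply: cmeasurable_phase; apply: measurableT_comp => //; apply: measurable_funM => //.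
    exact: (measurable_dot m2 m3).
  by apply: (cmeasurable_comp mg); exact: (measurable_rVB m3 m1).
Qed.

Let H_integrable : cintegrable (sf_prod mu mu \x mu)%E H.
Proof.
apply: cintegrable_prodP => //.
(* By |f| |g| <= |f|^2 + |g|^2 and translation invariance, the inner integral is at most M K(w) for
   every w, whatever the shift. *)
pose M := (\int[mu]_X (normc (f X) ^+ 2)%:E + \int[mu]_X (normc (g X) ^+ 2)%:E)%E.
have mf2 : measurable_fun setT (fun X => (normc (f X) ^+ 2)%:E).
  exact: measurable_int sf.2.
have mg2 : measurable_fun setT (fun X => (normc (g X) ^+ 2)%:E).
  exact: measurable_int sg.2.
have Moo : M \is a fin_num.
  by rewrite fin_numD !integrable_fin_num//; [exact: sg.2|exact: sf.2].
have M0 : (0 <= M)%E by apply: adde_ge0; apply: integral_ge0 => X _; rewrite lee_fin sqr_ge0.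
apply: (@le_lt_trans _ _ (\int[sf_prod mu mu]_w ((fine M)%:E * (K w)%:E))%E); last first.
  have iK : (sf_prod mu mu).-integrable setT (EFin \o K) := integrable_window_kernel.
  have := integrable_fin_num measurableT (integrableZl measurableT (fine M) iK).
  by rewrite ltey_eq => ->.
have K0 w : 0 <= K w by rewrite mulr_ge0// gaussv_ge0.
have mnH : measurable_fun setT (fun x => (normc (H x))%:E).
  by apply/measurable_EFinP; exact: measurable_normc.
apply: ge0_le_integral => //.
- by move=> w _; apply: integral_ge0 => X _; rewrite lee_fin normc_ge0.
- apply: (measurable_fun_fubini_tonelli_F (m2 := mu) (fun x => (normc (H x))%:E) mnH).
  by move=> x; rewrite lee_fin normc_ge0.
- by apply/measurable_EFinP; apply: measurable_funM => //; exact: mK.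
move=> w _.
have mgs : measurable_fun setT (fun X : E => (normc (g (X - (z.1 + w.1))) ^+ 2)%:E).
  exact: (measurableT_comp mg2 (measurable_rV_shift _)).
rewrite fineK// /M -(ge0_integral_rV_shift (- (z.1 + w.1)) mg2); last first.
  by move=> v; rewrite lee_fin sqr_ge0.
rewrite -ge0_integralD//; [|by move=> X _; rewrite lee_fin sqr_ge0..].
rewrite muleC -ge0_integralZl//.
- apply: ge0_le_integral => //.
  + by move=> X _; rewrite lee_fin normc_ge0.
  + exact: (measurableT_comp mnH (measurable_pair1 w)).
  + by apply: emeasurable_funM => //; exact: emeasurable_funD.
  + move=> X _; rewrite HE Normc.normcM normc_conj Normc.normcM normc_window_kernel.
    rewrite normc_phase mulr1 Normc.normcM normc_conj Normc.normcM normc_phase mul1r.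
    rewrite -EFinD -EFinM lee_fin ler_wpM2l//.
    by have := normc_ge0 (f X); have := normc_ge0 (g (X - (z.1 + w.1))); nra.
- exact: emeasurable_funD.
- by move=> X _; rewrite -EFinD lee_fin addr_ge0 ?sqr_ge0.
- by rewrite lee_fin.
Qed.

(** Fubini for [H], whose two iterated integrals are conj(c) times the transform with Gaussian
    window and the average of the transforms with window g. The factor 2 is that of
    [normc_cint_le]. *)
Lemma stft_window_change (c : R[i]) (gb_sq : square_integrable mu (fun X => (gaussv b X)%:C)) :
  (forall Z, cint (mu \x mu)%E (fun z => window_kernel s a b x0 z *
    (phase (- (s * dot z.2 Z)) * g (Z - z.1))) = c * (gaussv b Z)%:C) ->
  ((normc c * normc (stft s f (fun X => (gaussv b X)%:C) z))%:E <=
   \int[mu \x mu]_w (2 * K w * normc (stft s f g (z.1 + w.1, z.2 + w.2)))%:E)%E.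
Proof.
move=> hc.
have -> : normc c * normc (stft s f (fun X => (gaussv b X)%:C) z) =
   normc (conjc c * stft s f (fun X => (gaussv b X)%:C) z).
  by rewrite [in RHS]Normc.normcM normc_conj.
have E1 : conjc c * stft s f (fun X => (gaussv b X)%:C) z =
    cint (sf_prod mu mu) (fun w => cint mu (fun X => H (w, X))).
  rewrite (cint_prod12 H_integrable) -(cint_prod21 H_integrable).
  rewrite /stft -(cintZ _ (stft_integrable s z sf gb_sq)).
  apply: eq_cint => X.
  have ci := cintegrableZ (phase (- (s * dot z.2 X))) (window_kernel_integrable (X - z.1)).
  rewrite [RHS](cintZ (f X) (cintegrable_conj ci)) (cint_conj ci).
  rewrite (cintZ _ (window_kernel_integrable _)) hc !rmorphM/=; ring.
pose h w := conjc (window_kernel s a b x0 w * phase (s * dot w.2 z.1)) *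
  stft s f g (z.1 + w.1, z.2 + w.2).
have E2 w : cint mu (fun X => H (w, X)) = h w.
  under eq_cint do rewrite HE.
  rewrite cintZ//.
  exact: (stft_integrable s (z.1 + w.1, z.2 + w.2)).
have nh w : normc (h w) = K w * normc (stft s f g (z.1 + w.1, z.2 + w.2)).
  by rewrite /h Normc.normcM normc_conj Normc.normcM normc_window_kernel normc_phase mulr1.
rewrite E1; under eq_cint do rewrite E2.
have mh : cmeasurable h.
  apply: cmeasurableM.
    apply: cmeasurable_conj; apply: cmeasurableM; first exact: cmeasurable_window_kernel.
    apply: cmeasurable_phase; apply: measurable_funM => //.
    by apply: (@measurable_dot _ _ _ _ snd (fun=> z.1)); [exact: measurable_snd|exact: measurable_cst].
  apply: (cmeasurable_comp (cmeasurable_stft s sf.1 mg)).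
  by apply: measurable_fun_pair => /=; apply: measurable_rVD.
have mnh : measurable_fun setT (fun w => (normc (h w))%:E).
  by apply/measurable_EFinP; exact: measurable_normc.
have -> : (\int[mu \x mu]_w (2 * K w * normc (stft s f g (z.1 + w.1, z.2 + w.2)))%:E =
    2%:E * \int[sf_prod mu mu]_w (normc (h w))%:E)%E.
  rewrite -ge0_integralZl//.
    by apply: eq_integral => w _; rewrite nh -EFinM -mulrA.
  by move=> w _; rewrite lee_fin normc_ge0.
(* The estimate of [normc_cint_le] asks for integrability; otherwise the right side is infinite. *)
have [hoo|hoo] := ltP (\int[sf_prod mu mu]_w (normc (h w))%:E)%E +oo%E.
  exact: normc_cint_le.
by move: hoo; rewrite leye_eq => /eqP ->; rewrite gt0_muley ?leey// lte_fin.
Qed.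

End fixed_parameters.
(** The kernel is the same for all f and z. It is strictly positive because [young_mixed] also uses
    it as the auxiliary weight in Minkowski's inequality. *)
Lemma stft_window_bound s b g : s != 0 -> 0 < b -> schwartz g -> g <> cst 0 ->
  exists k : E * E -> R, [/\ measurable_fun setT k, forall z, 0 < k z,
    (\int[mu \x mu]_z (k z)%:E < +oo)%E &
    forall f, square_integrable mu f -> forall z,
      ((normc (stft s f (fun X => (gaussv b X)%:C) z))%:E <=
       \int[mu \x mu]_w (k w * normc (stft s f g (z.1 + w.1, z.2 + w.2)))%:E)%E].
Proof.
move=> s0 b0 schg gn0; have [a [x0 [a0 I0]]] := schwartz_gauss_pairing schg gn0.
have sg := schwartz_square_integrable schg.
have sb := schwartz_square_integrable (@schwartz_gaussv R N b b0).
have [B B0 hB] := schwartz_decay schg.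
have gB x : normc (g x) <= B.
  rewrite (le_trans (hB x))// ler_piMr// invf_le1 ?japanese_gt0//.
  exact: japanese_ge1.
pose c := (Num.sqrt (pi / (s ^+ 2 / (4 * (a + b)))) ^+ N)%:C *
  cint mu (fun z : E => (gaussv a (z - x0))%:C * g z).
have hc Z : _ = c * (gaussv b Z)%:C := window_kernel_cint x0 s0 a0 b0 sg.1 gB Z.
have c0 : c != 0.
  apply: mulf_neq0; last exact: I0.
  rewrite -normc_eq0 normc_real normr_eq0 expf_neq0// gt_eqF// sqrtr_gt0 divr_gt0 ?pi_gt0//.
  by apply: divr_gt0; [rewrite exprn_even_gt0|rewrite mulr_gt0// addr_gt0].
have nc0 : 0 < normc c by rewrite lt0r normc_ge0 normc_eq0 c0.
pose K z := normc (window_kernel s a b x0 z).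
have mK : measurable_fun setT K by apply: measurable_normc; exact: cmeasurable_window_kernel.
have KE := normc_window_kernel s a b x0.
have K0 z : 0 < K z by rewrite /K KE mulr_gt0// gaussv_gt0.
have iK : (mu \x mu)%E.-integrable setT (EFin \o K).
  rewrite (_ : K = (fun z => gaussv (a * b / (a + b)) (z.1 + x0) *
    gaussv (s ^+ 2 / (4 * (a + b))) z.2)); first exact: integrable_window_kernel.
  by apply/funext => z; exact: KE.
exists (fun z => (normc c)^-1 * (2 * K z)); split.
- by apply: measurable_funM => //; exact: measurable_funM.
- by move=> z; rewrite !mulr_gt0// invr_gt0.
- have := integrable_fin_num measurableT
    (integrableZl measurableT ((normc c)^-1 * 2) iK).
  rewrite (_ : (\int[_]_(x in _) _)%E =
     (\int[mu \x mu]_z ((normc c)^-1 * (2 * K z))%:E)%E); last first.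
    by apply: eq_integral => z _; rewrite /= -EFinM mulrA.
  by rewrite ltey_eq => ->.
- move=> f sf z; have := stft_window_change s0 a0 b0 sg.1 gB sf sg z sb hc.
  rewrite -(lee_pmul2l (x := (normc c)^-1%:E))// ?lte_fin ?invr_gt0//.
  rewrite -EFinM mulKf ?gt_eqF// => /le_trans; apply.
  rewrite -ge0_integralZl//.
  + rewrite le_eqVlt; apply/orP; left; apply/eqP; apply: eq_integral => w _.
    by rewrite /K KE -EFinM; congr EFin; ring.
  + apply/measurable_EFinP; apply: measurable_funM.
      by have := mK; rewrite /K; under eq_fun do rewrite KE; move=> h; exact: measurable_funM.
    apply: measurable_normc; apply: (cmeasurable_comp (cmeasurable_stft s sf.1 sg.1)).
    by apply: measurable_fun_pair => /=; apply: measurable_rVD.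
  + by move=> w _; rewrite lee_fin !mulr_ge0 ?gaussv_ge0 ?normc_ge0.
  + by rewrite lee_fin invr_ge0 ltW.
Qed.

End window_change.

(** * Twisted time-frequency shifts *)

Section hyperbolic.
Context {R : realType}.
Implicit Types x : R.

Lemma cosh_gt0 x : 0 < cosh x.
Proof. by rewrite divr_gt0// addr_gt0// expR_gt0. Qed.

(** Stated for an even expression so as to cover both signs of lam. *)
Lemma mul_sinh_gt0 x : x != 0 -> 0 < x * sinh x.
Proof.
rewrite neq_lt => /orP[x0|x0].
  rewrite nmulr_rgt0// /sinh pmulr_llt0 ?invr_gt0// subr_lt0 ltr_expR; lra.
by rewrite pmulr_rgt0// divr_gt0// subr_gt0 ltr_expR; lra.
Qed.

Lemma sinh_neq0 x : x != 0 -> sinh x != 0.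
Proof. by move=> /mul_sinh_gt0; apply: contraTneq => ->; rewrite mulr0 ltxx. Qed.

Lemma sqr_cosh x : cosh x ^+ 2 = 1 + sinh x ^+ 2.
Proof.
have h : expR x * expR (- x) = 1 by rewrite expRN mulfV// gt_eqF// expR_gt0.
by rewrite /cosh /sinh !expr_div_n; field: h.
Qed.

Lemma sinhD x y : sinh (x + y) = sinh x * cosh y + cosh x * sinh y.
Proof. by rewrite /sinh /cosh opprD !expRD; field. Qed.

Lemma coshD x y : cosh (x + y) = cosh x * cosh y + sinh x * sinh y.
Proof. by rewrite /sinh /cosh opprD !expRD; field. Qed.

Variable x : R.
Hypothesis x0 : x != 0.

Let x20 : x / 2 != 0. Proof. by rewrite mulf_neq0// invr_neq0. Qed.
Let ch0 : cosh (x / 2) != 0. Proof. by rewrite gt_eqF// cosh_gt0. Qed.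
Let sh0 : sinh (x / 2) != 0. Proof. exact: sinh_neq0. Qed.
Let x2E : x = x / 2 + x / 2. Proof. by field. Qed.

Lemma tanh_coth_half : tanh (x / 2) * coth (x / 2) = 1.
Proof. by rewrite /tanh /coth; field; rewrite sh0 ch0. Qed.

Let sinhE : sinh x = 2 * (sinh (x / 2) * cosh (x / 2)).
Proof. by rewrite {1}x2E sinhD; ring. Qed.

(** The source of the frequency scale lam / sinh lam. *)
Lemma coth_half_sub : coth (x / 2) - tanh (x / 2) = 2 / sinh x.
Proof.
rewrite sinhE /tanh /coth.
transitivity ((cosh (x / 2) ^+ 2 - sinh (x / 2) ^+ 2) / (sinh (x / 2) * cosh (x / 2))).
  by field; rewrite sh0 ch0.
by rewrite sqr_cosh addrK; field; rewrite sh0 ch0.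
Qed.

(** Relates the weight and the heat kernel at time 1 to the heat kernel at time 1/2. *)
Lemma coth_half : coth x = (coth (x / 2) + tanh (x / 2)) / 2.
Proof.
rewrite {1}/coth sinhE {1}x2E coshD /tanh /coth.
by field; rewrite sh0 ch0.
Qed.

Lemma mul_coth_half_gt0 : 0 < x * coth (x / 2).
Proof.
have -> : x * coth (x / 2) = 2 * (x / 2 * sinh (x / 2)) * cosh (x / 2) / sinh (x / 2) ^+ 2.
  by rewrite /coth; field.
apply: divr_gt0; last by rewrite exprn_even_gt0.
by apply: mulr_gt0; [rewrite mulr_gt0// mul_sinh_gt0|exact: cosh_gt0].
Qed.

Lemma div_sinh_gt0 : 0 < x / sinh x.
Proof.
have -> : x / sinh x = x * sinh x / sinh x ^+ 2 by field; exact: sinh_neq0.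
by rewrite divr_gt0 ?mul_sinh_gt0// exprn_even_gt0//= sinh_neq0.
Qed.

End hyperbolic.

Section symplectic_rotation.
Context {K : comPzRingType} {n : nat}.
Implicit Types x y z : 'rV[K]_(n + n).

(** The complex structure that links the symplectic form to the Euclidean product; with it all
    exponents become expressions in [dot] and [rot]. *)
Definition rot x : 'rV[K]_(n + n) := row_mx (- rsubmx x) (lsubmx x).

Lemma dot_split x y :
  dot x y = dot (lsubmx x) (lsubmx y) + dot (rsubmx x) (rsubmx y).
Proof. by rewrite /dot big_split_ord/=; congr (_ + _); apply: eq_bigr => i _; rewrite !mxE. Qed.

Lemma sympE x y : symp x y = dot x (rot y).
Proof.
rewrite dot_split row_mxKl row_mxKr dotNr /symp (dotC (rsubmx y)); ring.
Qed.

Lemma dot_rotl x y : dot (rot x) y = - dot x (rot y).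
Proof. by rewrite !dot_split !row_mxKl !row_mxKr dotNr dotNl; ring. Qed.

Lemma rotK x : rot (rot x) = - x.
Proof. by rewrite /rot row_mxKl row_mxKr -opp_row_mx hsubmxK. Qed.

Lemma rotD x y : rot (x + y) = rot x + rot y.
Proof. by rewrite /rot !linearD/= add_row_mx. Qed.

Lemma rotZ a x : rot (a *: x) = a *: rot x.
Proof. by rewrite /rot !linearZ/= scale_row_mx scalerN. Qed.

End symplectic_rotation.

Section time_frequency_shifts.
Context {R : realType} {n : nat}.
Local Notation E := 'rV[R]_(n + n).
Local Notation mu := (lebesgue_rV R (n + n)).
Implicit Types (lam : R) (f g : E -> R[i]) (z : E * E) (xi eta X : E).

(* [Pi lam xi eta] is, up to a unimodular factor, the time-frequency shift with
   parameters [shear lam (xi, eta)]. *)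
Definition shear lam z : E * E :=
  let y := z.1 - tanh (lam / 2) *: rot z.2 in
  (y, z.2 + (sinh lam / 2) *: rot y).

(** The operator [e_] translates by a multiple of [rot eta] and [tau] by xi. The phase of [tau],
    evaluated at the point already translated, contributes the term in tanh(lam/2). *)
Lemma PiE lam xi eta g X : Pi lam xi eta g X =
  phase (lam / 2 * (coth lam - tanh (lam / 2)) * dot xi eta) *
  (phase (- (lam / 2 * (coth (lam / 2) * dot eta X + dot (rot xi) X))) *
   g (X - (xi - tanh (lam / 2) *: rot eta))).
Proof.
rewrite /Pi /e_ /tau -!/(phase _).
set Y := row_mx _ _.
have YE : Y = X + tanh (lam / 2) *: rot eta.
  by rewrite -[X in RHS]hsubmxK /rot scale_row_mx add_row_mx scalerN.
rewrite -dot_split YE sympE opprB addrA.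
have -> : lam / 2 * (coth lam - tanh (lam / 2)) * dot xi eta =
  lam / 2 * coth lam * dot xi eta + - (lam / 2 * (tanh (lam / 2) * dot xi eta)) by ring.
rewrite [in X in _ = X * _]phaseD.
have -> : - (lam / 2 * (coth (lam / 2) * dot eta X + dot (rot xi) X)) =
   - (lam / 2 * coth (lam / 2) * dot X eta) + - (lam / 2 * dot X (rot xi)).
  by rewrite (dotC eta) (dotC (rot xi)); ring.
rewrite phaseD.
have -> : - (lam / 2 * dot (X + tanh (lam / 2) *: rot eta) (rot xi)) =
   - (lam / 2 * dot X (rot xi)) + - (lam / 2 * (tanh (lam / 2) * dot xi eta)).
  by rewrite dotDl dotZl dot_rotl rotK dotNr (dotC eta); ring.
rewrite phaseD (_ : X + tanh (lam / 2) *: rot eta - xi = X - xi + tanh (lam / 2) *: rot eta); last first.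
  by rewrite addrAC.
ring.
Qed.

(** Writing coth(lam/2) as tanh(lam/2) + 2 / sinh lam regroups the linear phase around [rot y],
    where y is the translation parameter, with lam / sinh lam as common factor. *)
Lemma Pi_shear lam xi eta g X : lam != 0 -> Pi lam xi eta g X =
  phase (lam / 2 * (coth lam - tanh (lam / 2)) * dot xi eta) *
  (phase (- (lam / sinh lam * dot (shear lam (xi, eta)).2 X)) *
   g (X - (shear lam (xi, eta)).1)).
Proof.
move=> lam0; rewrite PiE; congr (_ * (phase (- _) * _)).
have s0 := sinh_neq0 lam0; rewrite /shear [(_, _).2]/=.
have -> : rot (xi - tanh (lam / 2) *: rot eta) = rot xi + tanh (lam / 2) *: eta.
  by rewrite rotD -scaleNr rotZ rotK scalerN scaleNr opprK.
rewrite [in RHS]dotDl dotZl dotDl dotZl.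
have -> : coth (lam / 2) = tanh (lam / 2) + 2 / sinh lam.
  by rewrite -coth_half_sub// addrC subrK.
by field.
Qed.

Lemma distribution_Pi lam f g xi eta : lam != 0 ->
  square_integrable mu f -> square_integrable mu g ->
  distribution_of f (Pi lam xi eta g) =
  phase (- (lam / 2 * (coth lam - tanh (lam / 2)) * dot xi eta)) *
  stft (lam / sinh lam) f g (shear lam (xi, eta)).
Proof.
move=> lam0 sf sg; rewrite /distribution_of -!/(cint mu _) /stft.
rewrite -(cintZ _ (stft_integrable _ _ sf sg)); apply: eq_cint => X.
rewrite Pi_shear// -(conj_phase (lam / 2 * _ * _)).
move: (phase (lam / 2 * _ * _)) (phase (- _)) (g _) (f X) => p r u v.
by rewrite !rmorphM/=; ring.
Qed.

Lemma normc_distribution_Pi lam f g z : lam != 0 ->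
  square_integrable mu f -> square_integrable mu g ->
  normc (distribution_of f (Pi lam z.1 z.2 g)) =
  normc (stft (lam / sinh lam) f g (shear lam z)).
Proof.
move=> lam0 sf sg; rewrite distribution_Pi// Normc.normcM normc_phase mul1r.
by case: z.
Qed.

Lemma measurable_rot d (T : measurableType d) (h : T -> E) :
  measurable_fun setT h -> measurable_fun setT (fun x => rot (h x)).
Proof.
move=> mh; apply: measurable_row_mx; last exact: measurable_lsubmx.
under eq_fun do rewrite -scaleN1r.
by apply: measurable_rVZ; exact: measurable_rsubmx.
Qed.

Lemma measurable_shear lam : measurable_fun setT (shear lam).
Proof.
have my : measurable_fun setT (fun z : E * E => z.1 - tanh (lam / 2) *: rot z.2).
  by apply: measurable_rVB => //; apply: measurable_rVZ; exact: measurable_rot.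
apply: measurable_fun_pair => //; apply: measurable_rVD => //.
by apply: measurable_rVZ; exact: measurable_rot.
Qed.

Lemma shearD lam z w : shear lam (z.1 + w.1, z.2 + w.2) =
  ((shear lam z).1 + (shear lam w).1, (shear lam z).2 + (shear lam w).2).
Proof.
rewrite /shear/=; have -> : z.1 + w.1 - tanh (lam / 2) *: rot (z.2 + w.2) =
  (z.1 - tanh (lam / 2) *: rot z.2) + (w.1 - tanh (lam / 2) *: rot w.2).
  by rewrite rotD scalerDr opprD addrACA.
by congr pair; rewrite rotD scalerDr addrACA.
Qed.

(** Each of the two shears translates one variable by an amount depending on the other only, so
    Tonelli in the matching order reduces it to translation invariance. *)
Lemma ge0_integral_shear lam (h : E * E -> \bar R) : measurable_fun setT h ->
  (forall z, 0 <= h z)%E ->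
  (\int[mu \x mu]_z h (shear lam z) = \int[mu \x mu]_z h z)%E.
Proof.
move=> mh h0.
pose h1 (z : E * E) := h (z.1, z.2 + (sinh lam / 2) *: rot z.1).
have mh1 : measurable_fun setT h1.
  apply: (measurableT_comp mh); apply: measurable_fun_pair => //.
  by apply: measurable_rVD => //; apply: measurable_rVZ; exact: measurable_rot.
have mhs : measurable_fun setT (fun z => h (shear lam z)).
  exact: (measurableT_comp mh (measurable_shear lam)).
rewrite (fubini_tonelli2 (m1 := mu) (m2 := mu) _ mhs)// /fubini_G.
transitivity (\int[mu]_y \int[mu]_x h1 (x, y))%E.
  apply: eq_integral => y _.
  rewrite -(ge0_integral_rV_shift (- (tanh (lam / 2) *: rot y)) (f := fun x => h1 (x, y)))//.
    exact: (measurableT_comp mh1 (measurable_pair2 y)).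
  by move=> v; exact: h0.
have h10 z : (0 <= h1 z)%E by exact: h0.
rewrite -(fubini_tonelli2 (m1 := mu) (m2 := mu) _ mh1 h10).
rewrite (fubini_tonelli1 (m1 := mu) (m2 := mu) _ mh1 h10).
rewrite (fubini_tonelli1 (m1 := mu) (m2 := mu) _ mh h0).
apply: eq_integral => x _; rewrite /fubini_F /h1 /=.
apply: (ge0_integral_rV_shift _ (f := fun y => h (x, y))) => //.
exact: (measurableT_comp mh (measurable_pair1 x)).
Qed.

End time_frequency_shifts.

(** * The twisted Bargmann transform *)

Section bargmann_identity.
Context {R : realType}.

Lemma sum_complex (I : Type) (r : seq I) (P : pred I) (a b : I -> R) :
  \sum_(i <- r | P i) (a i +i* b i) =
  (\sum_(i <- r | P i) a i) +i* (\sum_(i <- r | P i) b i) :> R[i].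
Proof. by elim/big_rec3: _ => // i x y z _ ->. Qed.

Variable n : nat.
Local Notation E := 'rV[R]_(n + n).
Local Notation mu := (lebesgue_rV R (n + n)).
Implicit Types (xi eta X : E).

Lemma dot_complex_pt (a b c d : E) : dot (complex_pt a b) (complex_pt c d) =
  (dot a c - dot b d) +i* (dot a d + dot b c).
Proof.
rewrite /dot -sumrB -big_split/= -sum_complex.
by apply: eq_bigr => i _; rewrite !mxE; simpc.
Qed.

Lemma complex_ptB xi eta X :
  complex_pt xi eta - real_pt X = complex_pt (xi - X) eta.
Proof. by apply/rowP => i; rewrite !mxE; simpc. Qed.

Lemma symp_complex_pt xi eta X :
  symp (complex_pt xi eta) (real_pt X) = symp xi X +i* symp eta X.
Proof.
have -> : real_pt X = complex_pt X 0.
  by apply/rowP => i; rewrite !mxE.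
have rotE : rot (complex_pt X 0) = complex_pt (rot X) 0.
  apply/rowP => i; rewrite !mxE; case: fintype.split => j; rewrite !mxE//.
  by apply/eqP; rewrite eq_complex/= oppr0 !eqxx.
rewrite !sympE rotE dot_complex_pt.
have dot0 (x : E) : dot x 0 = 0 by rewrite -(scale0r 0) dotZr mul0r.
by rewrite !dot0 subr0 add0r.
Qed.

Lemma heat_complex_pt lam t (a b : E) : heat lam t (complex_pt a b) =
  ((4 * pi) ^- n * lam ^+ n * sinh (t * lam) ^- n)%:C *
  cexp ((- (4^-1 * lam * coth (t * lam) * (dot a a - dot b b))) +i*
        (- (4^-1 * lam * coth (t * lam) * (2 * dot a b)))).
Proof.
rewrite /heat dot_complex_pt; congr (_ * cexp _).
by rewrite (dotC b a); apply/eqP; rewrite eq_complex/=; apply/andP; split; apply/eqP; ring.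
Qed.

Lemma weight_complex_pt lam xi eta : weight lam (complex_pt xi eta) =
  @c_ R n lam * (expR (- (4^-1 * lam * coth lam * (dot xi xi + dot eta eta)) +
    lam / 2 * dot xi (rot eta)) ^+ 2).
Proof.
rewrite /weight.
have -> : re_pt (complex_pt xi eta) = xi by apply/rowP => i; rewrite !mxE.
have -> : im_pt (complex_pt xi eta) = eta by apply/rowP => i; rewrite !mxE.
have -> : \sum_j normc (complex_pt xi eta ord0 j) ^+ 2 = dot xi xi + dot eta eta.
  rewrite /dot -big_split/=; apply: eq_bigr => i _; rewrite !mxE/=.
  by rewrite sqr_sqrtr ?addr_ge0 ?sqr_ge0// !expr2.
by rewrite sympE -mulrA -!expRD -expRM_natl; congr (_ * expR _); field.
Qed.

(* The quotient of the normalising constants of the heat kernels at times 1/2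
   and 1, times the square root of that of the weight. *)
Definition bargmann_const lam : R := Num.sqrt (@c_ R n lam) *
  ((4 * pi) ^- n * lam ^+ n * sinh (1 * lam) ^- n)^-1 *
  ((4 * pi) ^- n * lam ^+ n * sinh (2^-1 * lam) ^- n).

(** The width lam coth(lam/2) / 4 is the coefficient in the heat kernel at time 1/2, so the terms
    quadratic in X agree; the other terms match through [coth_half] and the relation tanh coth =
    1. *)
Lemma bargmann_integrand lam xi eta X : lam != 0 ->
  (Num.sqrt (weight lam (complex_pt xi eta)))%:C *
  (heat lam 1 (complex_pt xi eta))^-1 *
  (heat lam 2^-1 (complex_pt xi eta - real_pt X) *
   cexp (- (0 +i* (lam / 2)) * symp (complex_pt xi eta) (real_pt X))) =
  (bargmann_const lam)%:C *
  conjc (Pi lam xi eta (fun X => (gaussv (lam * coth (lam / 2) / 4) X)%:C) X).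
Proof.
move=> lam0.
have c0 : 0 < @c_ R n lam.
  apply: mulr_gt0; first by rewrite invr_gt0 exprn_gt0// mulr_gt0// pi_gt0.
  by rewrite exprn_gt0// div_sinh_gt0.
rewrite weight_complex_pt sqrtrM ?(ltW c0)// sqrtr_sqr ger0_norm ?expR_ge0//.
rewrite complex_ptB !heat_complex_pt symp_complex_pt /bargmann_const.
move: (_ * sinh (1 * lam) ^- n) (_ * sinh (2^-1 * lam) ^- n) => A1 A2.
have ninv (x : R) (u : R[i]) : (x%:C * u)^-1 = (x^-1)%:C * u^-1.
  by rewrite invfM -fmorphV.
have rM (x y : R) : (x * y)%:C = x%:C * y%:C by rewrite rmorphM.
have cM (u v : R[i]) : conjc (u * v) = conjc u * conjc v by rewrite rmorphM.
rewrite PiE ninv (cM (phase _) (phase _ * _)) (cM (phase _) _%:C) !conj_phase opprK.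
rewrite (rM _ (expR _)) (rM _ A2) (rM _ A1^-1) -cexp_real -cexpN.
have -> : conjc (gaussv (lam * coth (lam / 2) / 4) (X - (xi - tanh (lam / 2) *: rot eta)))%:C =
  cexp (- (lam * coth (lam / 2) / 4 * dot (X - (xi - tanh (lam / 2) *: rot eta))
    (X - (xi - tanh (lam / 2) *: rot eta))))%:C.
  by rewrite cexp_real /= oppr0.
move: (Num.sqrt _) => S.
set e1 := cexp _; set e2 := cexp _; set e3 := cexp _; set e4 := cexp _.
transitivity (S%:C * (A1^-1)%:C * A2%:C * (e1 * e2 * (e3 * e4))); first by ring.
congr (_ * _); rewrite /e1 /e2 /e3 /e4 /phase -!cexpD; congr cexp.
rewrite !mul1r (mulrC 2^-1 lam) (coth_half lam0) !sympE.
(* With coth lam eliminated, tanh(lam/2) and coth(lam/2) are abstracted to variables subject only to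
   t c = 1, modulo which both exponents agree as polynomials. *)
have := tanh_coth_half lam0.
move: (tanh (lam / 2)) (coth (lam / 2)) => t c tc.
have antisym (x y : E) : dot x (rot y) = - dot y (rot x) by rewrite dotC dot_rotl.
rewrite !(dotDl, dotDr, dotNl, dotNr, dotZl, dotZr, dot_rotl, rotZ, rotK) !opprK.
rewrite (antisym eta X) (antisym eta xi) (dotC X xi) (dotC X eta).
apply/eqP; rewrite eq_complex/=; apply/andP; split; apply/eqP.
  by field: tc.
by field: tc.
Qed.

Lemma c_gt0 lam : lam != 0 -> 0 < @c_ R n lam.
Proof.
move=> lam0; apply: mulr_gt0; first by rewrite invr_gt0 exprn_gt0// mulr_gt0// pi_gt0.
by rewrite exprn_gt0// div_sinh_gt0.
Qed.

Lemma bargmann_const_neq0 lam : lam != 0 -> bargmann_const lam != 0.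
Proof.
move=> lam0.
have A0 s : s != 0 -> (4 * pi) ^- n * lam ^+ n * sinh (s * lam) ^- n != 0.
  move=> s0; apply: mulf_neq0.
    by apply: mulf_neq0; rewrite ?invr_neq0 ?expf_neq0// mulf_neq0// gt_eqF// pi_gt0.
  by rewrite invr_neq0// expf_neq0// sinh_neq0// mulf_neq0.
have h1 := A0 1 (oner_neq0 _); have h2 : (2^-1 : R) != 0 by rewrite invr_neq0.
have {}h2 := A0 _ h2.
apply: mulf_neq0 => //; apply: mulf_neq0; last by rewrite invr_neq0.
by rewrite gt_eqF// sqrtr_gt0 c_gt0.
Qed.

Lemma square_integrable_Pi lam xi eta (g : E -> R[i]) : square_integrable mu g ->
  square_integrable mu (Pi lam xi eta g).
Proof.
move=> sg; rewrite (funext (PiE lam xi eta g)).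
apply: square_integrable_phase; first exact: measurable_cst.
apply: square_integrable_phase; last exact: square_integrable_shift.
apply: measurableT_comp => //; apply: measurable_funM => //.
by apply: measurable_funD; [apply: measurable_funM => //|]; exact: measurable_dot.
Qed.

Lemma weight_bargmann lam (f : E -> R[i]) xi eta : lam != 0 -> square_integrable mu f ->
  (Num.sqrt (weight lam (complex_pt xi eta)))%:C * bargmann lam f (complex_pt xi eta) =
  (@c_ R n lam * bargmann_const lam)%:C * distribution_of f
    (Pi lam xi eta (fun X => (gaussv (lam * coth (lam / 2) / 4) X)%:C)).
Proof.
move=> lam0 sf; have key X := bargmann_integrand xi eta X lam0.
set gb := (fun X => (gaussv (lam * coth (lam / 2) / 4) X)%:C) in key *.
have b0 : 0 < lam * coth (lam / 2) / 4 by rewrite divr_gt0// mul_coth_half_gt0.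
have sgb : square_integrable mu gb by exact/schwartz_square_integrable/schwartz_gaussv.
pose h X : R[i] := heat lam 2^-1 (complex_pt xi eta - real_pt X) *
  cexp (- (0 +i* (lam / 2)) * symp (complex_pt xi eta) (real_pt X)).
pose P : R[i] := (Num.sqrt (weight lam (complex_pt xi eta)))%:C * (heat lam 1 (complex_pt xi eta))^-1.
have {}key X : P * h X = (bargmann_const lam)%:C * conjc (Pi lam xi eta gb X) := key X.
have C0 : (bargmann_const lam)%:C != 0.
  by rewrite -normc_eq0 normc_real normr_eq0 bargmann_const_neq0.
(* At X = 0 the right side of [key] is a nonzero constant times a phase times a value of the
   Gaussian. *)
have P0 : P != 0.
  apply/eqP => P0; have := key 0; rewrite P0 mul0r => /esym/eqP.
  rewrite mulf_eq0 (negbTE C0) orFb -normc_eq0 normc_conj PiE Normc.normcM normc_phase mul1r.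
  rewrite Normc.normcM normc_phase mul1r normc_real normr_eq0.
  by rewrite gt_eqF// gaussv_gt0.
have cPi := square_integrable_mul sf (square_integrable_Pi lam xi eta sgb).
(* Solving for f h exhibits it as a scalar multiple of a function known to be integrable, so the
   scalar can be taken out of the integral. *)
have hE X : f X * h X = P^-1 * (bargmann_const lam)%:C * (f X * conjc (Pi lam xi eta gb X)).
  transitivity (P^-1 * (f X * (P * h X))); first by rewrite (mulrCA (f X) P) mulKf.
  by rewrite key; ring.
have convE : twisted_conv_heat lam 2^-1 f (complex_pt xi eta) =
    P^-1 * (bargmann_const lam)%:C * cint mu (fun X => f X * conjc (Pi lam xi eta gb X)).
  rewrite -(cintZ _ cPi) -(eq_cint _ hE); congr cintegral.
  by apply/funext => X; rewrite /h mulrA.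
rewrite /bargmann convE -[distribution_of _ _]/(cint mu _).
transitivity ((@c_ R n lam)%:C * (P * P^-1) * ((bargmann_const lam)%:C *
  cint mu (fun X => f X * conjc (Pi lam xi eta gb X)))); first by rewrite /P; ring.
rewrite (mulfV P0) mulr1 mulrA; congr (_ * _).
by rewrite -rmorphM.
Qed.

End bargmann_identity.

(** * Change of window in the mixed norms and the equivalence *)

Section modulation.
Context {R : realType} {n : nat}.
Local Notation E := 'rV[R]_(n + n).
Local Notation mu := (lebesgue_rV R (n + n)).
Implicit Types (lam : R) (f g : E -> R[i]) (p q : \bar R).

Lemma LpqZ N M p q (c : R[i]) (F : 'rV[R]_N * 'rV[R]_M -> R[i]) :
  (1 <= p)%E -> (1 <= q)%E -> Lpq p q F -> Lpq p q (fun w => c * F w).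
Proof.
move=> p1 q1 [mF Foo]; split; first by apply: cmeasurableM => //; exact: cmeasurable_cst.
have mn : measurable_fun setT (fun w => (normc (F w))%:E).
  by apply/measurable_EFinP; exact: measurable_normc.
have mI G : cmeasurable G -> measurable_fun setT (fun eta : 'rV[R]_M =>
    'N[lebesgue_rV R N]_p[(fun xi => (normc (G (xi, eta)))%:E)]%E).
  move=> mG; apply: (measurable_Lnorm_param (lebesgue_rV R N) p1 (measurable_normc mG)).
  by move=> z; exact: normc_ge0.
have msec eta : measurable_fun setT (fun xi => (normc (F (xi, eta)))%:E).
  exact: (measurableT_comp mn (measurable_pair2 eta)).
apply: (@le_lt_trans _ _ ((normc c)%:E * 'N[lebesgue_rV R M]_q[(fun eta =>
    'N[lebesgue_rV R N]_p[(fun xi => (normc (F (xi, eta)))%:E)])])%E); last first.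
  by rewrite lte_mul_pinfty ?lee_fin ?normc_ge0.
apply: (le_trans _ (le_LnormZ _ q1 (mI _ mF) (normc_ge0 c))).
apply: le_Lnorm => //.
- apply: (mI (fun w => c * F w)).
  by apply: cmeasurableM => //; exact: cmeasurable_cst.
- by apply: measurable_funeM; exact: mI.
- move=> eta; rewrite gee0_abs ?Lnorm_ge0// gee0_abs ?mule_ge0 ?lee_fin ?normc_ge0 ?Lnorm_ge0//.
  rewrite (le_trans _ (le_LnormZ _ p1 (msec eta) (normc_ge0 c)))//.
  by under eq_fun do rewrite Normc.normcM EFinM.
Qed.

Lemma cmeasurable_distribution_Pi lam f g : lam != 0 ->
  square_integrable mu f -> square_integrable mu g ->
  cmeasurable (fun w : E * E => distribution_of f (Pi lam w.1 w.2 g)).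
Proof.
move=> lam0 sf sg; rewrite (_ : (fun _ => _) = (fun w : E * E =>
  phase (- (lam / 2 * (coth lam - tanh (lam / 2)) * dot w.1 w.2)) *
  stft (lam / sinh lam) f g (shear lam w))); last first.
  by apply/funext => -[xi eta]; exact: distribution_Pi.
apply: cmeasurableM.
  apply: cmeasurable_phase; apply: measurableT_comp => //; apply: measurable_funM => //.
  exact: measurable_dot.
exact: (cmeasurable_comp (cmeasurable_stft _ sf.1 sg.1) (measurable_shear lam)).
Qed.

Lemma Lpq_change_window lam f g b p q : lam != 0 -> (1 <= p)%E -> (1 <= q)%E ->
  0 < b -> square_integrable mu f -> schwartz g -> g <> cst 0 ->
  Lpq p q (fun w : E * E => distribution_of f (Pi lam w.1 w.2 g)) ->
  Lpq p q (fun w : E * E => distribution_of f (Pi lam w.1 w.2 (fun X => (gaussv b X)%:C))).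
Proof.
move=> lam0 p1 q1 b0 sf schg gn0 [mV Voo].
have sg := schwartz_square_integrable schg.
have sb := schwartz_square_integrable (@schwartz_gaussv R (n + n) b b0).
split; first exact: cmeasurable_distribution_Pi.
have s0 : lam / sinh lam != 0 by rewrite gt_eqF// div_sinh_gt0.
have [k [mk k0 koo hk]] := stft_window_bound s0 b0 schg gn0.
have mshear := @measurable_shear R n lam.
have mkE : measurable_fun setT (fun w : E * E => (k w)%:E) by exact/measurable_EFinP.
apply: (young_mixed (A := fun w => normc (distribution_of f (Pi lam w.1 w.2 g)))
  (k := k \o shear lam)
  (B := fun w => normc (distribution_of f (Pi lam w.1 w.2 (fun X => (gaussv b X)%:C))))
  p1 q1) => //.
- exact: measurable_normc.
- by move=> z; exact: normc_ge0.
- exact: (measurableT_comp mk mshear).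
- by move=> z; exact: k0.
- rewrite (ge0_integral_shear lam mkE)// => z.
  by rewrite lee_fin ltW.
- by apply: measurable_normc; exact: cmeasurable_distribution_Pi.
- by move=> z; exact: normc_ge0.
move=> z; rewrite normc_distribution_Pi//; apply: (le_trans (hk f sf _)).
have mS := measurable_normc (cmeasurable_stft (lam / sinh lam) sf.1 sg.1).
(* After the substitution w -> [shear lam w], additivity of the shear identifies the integrand as a
   translate by w in the variables (xi, eta). *)
rewrite -(@ge0_integral_shear _ _ lam (fun w => (k w * normc (stft (lam / sinh lam) f g
   ((shear lam z).1 + w.1, (shear lam z).2 + w.2)))%:E)).
- rewrite le_eqVlt; apply/orP; left; apply/eqP; apply: eq_integral => w _.
  congr (EFin (_ * _)); rewrite -(shearD lam z w).
  exact: (esym (normc_distribution_Pi (z.1 + w.1, z.2 + w.2) lam0 sf sg)).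
- apply/measurable_EFinP; apply: measurable_funM; first exact: mk.
  apply: (measurableT_comp mS).
  by apply: measurable_fun_pair => /=; apply: measurable_rVD.
- by move=> w; rewrite lee_fin mulr_ge0 ?normc_ge0// ltW.
Qed.

End modulation.

Theorem corollary3p5 (R : realType) (n : nat) (n_gt0 : (0 < n)%N)
    (lam : R) (lam_neq0 : lam != 0)
    (p q : \bar R) (p_ge1 : (1 <= p)%E) (q_ge1 : (1 <= q)%E)
    (f : 'rV[R]_(n + n) -> R[i]) (f_L2 : Lp 2%:E f) :
  twisted_modulation lam p q (distribution_of f) <->
  Lpq p q (fun w : 'rV[R]_(n + n) * 'rV[R]_(n + n) =>
    let zeta := complex_pt w.1 w.2 in
    (Num.sqrt (weight lam zeta))%:C * bargmann lam f zeta).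
Proof.
have sf := Lp2_square_integrable f_L2.
have b0 : 0 < lam * coth (lam / 2) / 4 by rewrite divr_gt0// mul_coth_half_gt0.
pose g0 (X : 'rV[R]_(n + n)) : R[i] := (gaussv (lam * coth (lam / 2) / 4) X)%:C.
have sg0 : schwartz g0 by exact: schwartz_gaussv.
pose C : R[i] := (@c_ R n lam * bargmann_const n lam)%:C.
have C0 : C != 0.
  by rewrite -normc_eq0 normc_real normr_eq0 mulf_neq0 ?bargmann_const_neq0// gt_eqF ?c_gt0.
have FE : (fun w : 'rV[R]_(n + n) * 'rV[R]_(n + n) =>
    let zeta := complex_pt w.1 w.2 in
    (Num.sqrt (weight lam zeta))%:C * bargmann lam f zeta) =
    (fun w => C * distribution_of f (Pi lam w.1 w.2 g0)).
  by apply/funext => w /=; exact: weight_bargmann.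
rewrite FE; split.
  move=> [_ [g [sg gn0 Vg]]]; apply: (LpqZ C p_ge1 q_ge1).
  exact: (Lpq_change_window lam_neq0 p_ge1 q_ge1 b0 sf sg gn0 Vg).
(* Dividing by C recovers the pairings with the Gaussian window, which is itself the witness. *)
move=> /(LpqZ C^-1 p_ge1 q_ge1) Vg; split; first exact: tempered_distribution_of.
exists g0; split => //.
  move=> /(congr1 (fun h => complex.Re (h 0))) /= g00.
  by have := gaussv_gt0 (lam * coth (lam / 2) / 4) (0 : 'rV[R]_(n + n)); rewrite g00 ltxx.
by move: Vg; under eq_fun do rewrite mulKf//.
Qed.
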